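(* Let $n\ge 2$ and $1\le \ell<n$ be integers, and let $\alpha>0$, $\beta$ and $\sigma$ be real numbers. Suppose $\lambda$ is a compactly supported nonnegative Borel measure on $\mathbb{R}^{\ell(n-\ell)}$ which satisfies, for some $c>0$, the condition $$\lambda\big(\{x\in\mathbb{R}^{\ell(n-\ell)}: |T_x\xi-p_2|\le r\}\big)\le c\, r^\beta$$ for all $\xi\in\mathbb{R}^\ell$ with $|\xi|=1$, all $p_2\in\mathbb{R}^{n-\ell}$, and all $r>0$. Suppose $E\subset\mathbb{R}^n$ is a Borel set with Hausdorff dimension at least $\alpha$. Suppose $$n-\ell+\sigma-\alpha<\beta .$$ Then for $\lambda$-almost all $x\in\mathbb{R}^{\ell(n-\ell)}$, the set $P_x(E)\subset\mathbb{R}^\ell$ has Sobolev dimension at least $\sigma$.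
   Context: Write $x=(x_i^j)$, where $i=1,\dots,\ell$ and $j=1,\dots,n-\ell$, for an element of $\mathbb{R}^{\ell(n-\ell)}$. For such $x$, the map $P_x:\mathbb{R}^n\to\mathbb{R}^\ell$ is defined by $$P_x(p_1,\dots,p_n)=\Big(p_1+\sum_{j=1}^{n-\ell}x_1^j p_{\ell+j},\ p_2+\sum_{j=1}^{n-\ell}x_2^j p_{\ell+j},\ \dots,\ p_\ell+\sum_{j=1}^{n-\ell}x_\ell^j p_{\ell+j}\Big),$$ and the map $T_x:\mathbb{R}^\ell\to\mathbb{R}^{n-\ell}$ is defined by $$T_x\xi=\Big(\sum_{i=1}^\ell x_i^1\xi_i,\ \dots,\ \sum_{i=1}^\ell x_i^{n-\ell}\xi_i\Big).$$ A set $F\subset\mathbb{R}^\ell$ has Sobolev dimension at least $\sigma$ if $F$ carries a Borel probability measure $\nu$ (i.e. $\nu$ is concentrated on $F$) such that $$\int_{\mathbb{R}^\ell}|\widehat{\nu}(\xi)|^2\,\frac{d\xi}{(1+|\xi|)^{\ell-\sigma}}<\infty,$$ where $\widehat{\nu}(\xi)=\int e^{-2\pi i\langle \xi,u\rangle}\,d\nu(u)$. *)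

(* Defs.v *)
From HB Require Import structures.
From mathcomp Require Import all_boot all_order all_algebra.
From mathcomp Require Import complex.
From mathcomp Require Import all_classical all_reals all_analysis.
From mathcomp Require Import measurable_realfun.

Set Implicit Arguments.
Unset Strict Implicit.
Unset Printing Implicit Defensive.

Import Order.TTheory GRing.Theory Num.Theory.
Import numFieldNormedType.Exports.

Local Open Scope classical_set_scope.
Local Open Scope ring_scope.

(* R^(mn) with its Borel sigma-algebra. The library's norm on matrices is the
   sup norm; it induces the usual topology. The Euclidean norm is [enorm]. *)
Definition borel_mx (R : realType) (m n : nat) :=
  g_sigma_algebraType (@open 'M[R]_(m, n)).

Section euclidean.
Context {R : realType} {n : nat}.
Implicit Types u v : 'rV[R]_n.

Definition edot u v : R := \sum_i u 0 i * v 0 i.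

Definition enorm u : R := Num.sqrt (edot u u).

End euclidean.

Section borel_mx_coordinates.
Context {R : realType} {m n : nat}.

Lemma measurable_coord i j :
  measurable_fun setT (fun M : borel_mx R m n => (M : 'M[R]_(m, n)) i j).
Proof.
apply: (measurability _ (RGenOpens.measurableE R)) => _ [_ [a [b ->]] <-].
rewrite setTI; apply: sub_sigma_algebra => /=.
have /continuousP := @coord_continuous R m n i j; apply.
exact: interval_open.
Qed.

Lemma measurable_fun_mx d (T : measurableType d) (f : T -> borel_mx R m n) :
  (forall i j, measurable_fun setT (fun t => (f t : 'M[R]_(m, n)) i j)) ->
  measurable_fun setT f.
Proof.
move=> mf; apply: (@measurability _ _ _ (borel_mx R m n) setT f (@open 'M[R]_(m, n))) => // _ [U oU <-]; rewrite setTI.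
pose box (qk : 'M[rat]_(m, n) * nat) : set 'M[R]_(m, n) :=
  ball (map_mx ratr qk.1 : 'M[R]_(m, n)) qk.2.+1%:R^-1.
have -> : f @^-1` U =
    \bigcup_qk (if pselect (box qk `<=` U) then f @^-1` box qk else set0).
  apply/seteqP; split => [t Uft|t [qk _]]; last first.
    by case: pselect => //= sub; exact: sub.
  have /nbhs_ballP[e /= e0 eU] : nbhs (f t : 'M[R]_(m, n)) U.
    exact: open_nbhs_nbhs.
  have [k ke] : exists k : nat, k.+1%:R^-1 < e / 2.
    have e20 : 0 < e / 2 by rewrite divr_gt0.
    have [k _ /(_ k (leqnn k)) ke] := near_infty_natSinv_lt (PosNum e20).
    by exists k.
  have k0 : (0 : R) < k.+1%:R^-1 by rewrite invr_gt0.
  have qP i j : exists q : rat,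
      @ball R R (ratr q) k.+1%:R^-1 ((f t : 'M[R]_(m, n)) i j).
    set x := (f t : 'M[R]_(m, n)) i j.
    have : ball x k.+1%:R^-1 `&` ratr @` setT !=set0.
      apply: dense_rat; last exact: ball_open.
      by exists x; exact: ballxx.
    by move=> [y [xy [q _ qy]]]; exists q; rewrite qy; exact: ball_sym.
  pose Q : 'M[rat]_(m, n) := \matrix_(i, j) sval (cid (qP i j)).
  have ftQ : box (Q, k) (f t).
    by split=> // i j; rewrite !mxE; case: cid.
  exists (Q, k) => //; case: pselect => //; case=> M QM.
  apply: eU; apply: (@le_ball _ _ _ (k.+1%:R^-1 + k.+1%:R^-1)).
    by rewrite (splitr e) lerD// ltW.
  by apply: ball_triangle QM; exact: ball_sym.
apply: countable_bigcupT_measurable => // qk.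
case: pselect => [?|?] /=; last exact: measurable0.
have -> : f @^-1` box qk = \bigcap_(ij : 'I_m * 'I_n)
    (fun t => (f t : 'M[R]_(m, n)) ij.1 ij.2) @^-1`
      @ball R R (ratr (qk.1 ij.1 ij.2)) qk.2.+1%:R^-1.
  apply/seteqP; split => [t [_ +] [i j] _|t ft]; first by move=> /(_ i j); rewrite mxE.
  by split => [|i j]; [rewrite invr_gt0|rewrite mxE; exact: (ft (i, j))].
apply: fin_bigcap_measurable => // -[i j] _.
rewrite -[_ @^-1` _]setTI; apply: mf => //.
exact: measurable_ball.
Qed.

End borel_mx_coordinates.

Section lebesgue_rV_step.
Context {R : realType} {l : nat}.

Definition cons_row (p : R * 'rV[R]_l) : 'rV[R]_l.+1 :=
  \row_i oapp (p.2 0) p.1 (unlift ord0 i).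

Lemma cons_row0 p : cons_row p 0 0 = p.1.
Proof. by rewrite mxE unlift_none. Qed.

Lemma cons_rowS p j : cons_row p 0 (lift ord0 j) = p.2 0 j.
Proof. by rewrite mxE liftK. Qed.

Lemma measurable_cons_row :
  measurable_fun setT
    (cons_row : measurableTypeR R * borel_mx R 1 l -> borel_mx R 1 l.+1).
Proof.
apply: measurable_fun_mx => i j; rewrite (ord1 i).
case: (unliftP ord0 j) => [k|] ->.
- rewrite (_ : (fun _ => _) =
    (fun M : borel_mx R 1 l => (M : 'rV[R]_l) 0 k) \o snd).
    by apply: measurableT_comp => //; exact: measurable_coord.
  by apply/funext => p; exact: cons_rowS.
- rewrite (_ : (fun _ => _) = fst) //.
  by apply/funext => p; exact: cons_row0.
Qed.

#[local] Hint Resolve measurable_cons_row : core.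

Variable mu : {sigma_finite_measure set (borel_mx R 1 l) -> \bar R}.

Definition lebesgue_step : set (borel_mx R 1 l.+1) -> \bar R :=
  pushforward ((@lebesgue_measure R \x mu)%E)
    (cons_row : measurableTypeR R * borel_mx R 1 l -> borel_mx R 1 l.+1).

Let step0 : lebesgue_step set0 = 0%E.
Proof. by rewrite /lebesgue_step /pushforward preimage_set0 measure0. Qed.

Let step_ge0 A : (0 <= lebesgue_step A)%E.
Proof. exact: measure_ge0. Qed.

Let step_sigma_additive : semi_sigma_additive lebesgue_step.
Proof.
exact: measure_semi_sigma_additive.
Qed.

HB.instance Definition _ := isMeasure.Build _ _ _ lebesgue_step
  step0 step_ge0 step_sigma_additive.

Let step_sigma_finite : sigma_finite setT lebesgue_step.
Proof.
have /sigma_finiteP[F [TF ndF Foo]] := sigma_finiteT (@lebesgue_measure R).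
have /sigma_finiteP[G [TG ndG Goo]] := sigma_finiteT mu.
pose uncons (v : borel_mx R 1 l.+1) : measurableTypeR R * borel_mx R 1 l :=
  ((v : 'rV[R]_l.+1) 0 0, \row_j (v : 'rV[R]_l.+1) 0 (lift ord0 j)).
have consK : cancel (cons_row : measurableTypeR R * borel_mx R 1 l -> _) uncons.
  move=> [x v]; rewrite /uncons cons_row0; congr pair.
  by apply/rowP => j; rewrite mxE cons_rowS.
have mu_uncons : measurable_fun setT uncons.
  apply/measurable_fun_pairP; split; first exact: measurable_coord.
  apply: measurable_fun_mx => i j.
  rewrite (_ : (fun _ => _) =
    fun t : borel_mx R 1 l.+1 => (t : 'rV[R]_l.+1) 0 (lift ord0 j)).
    exact: measurable_coord.
  by apply/funext => t; rewrite mxE.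
have FGT : \bigcup_k (F k `*` G k) = setT.
  apply/seteqP; split => // -[x v] _.
  have [[i _ Fix] [j _ Gjv]] : (\bigcup_k F k) x /\ (\bigcup_k G k) v.
    by rewrite -TF -TG.
  exists (maxn i j) => //; split => /=.
    by move: x Fix; exact/subsetPset/ndF/leq_maxl.
  by move: v Gjv; exact/subsetPset/ndG/leq_maxr.
exists (fun k => uncons @^-1` (F k `*` G k)).
  by rewrite -preimage_bigcup FGT preimage_setT.
move=> k; have [mF Flt] := Foo k; have [mG Glt] := Goo k; split.
  by rewrite -[_ @^-1` _]setTI; apply: mu_uncons => //; exact: measurableX.
rewrite /lebesgue_step /pushforward -comp_preimage.
rewrite (_ : uncons \o _ = id); last by apply/funext => p; exact: consK.
rewrite preimage_id (_ : (lebesgue_measure \x mu)%E _ =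
  (lebesgue_measure (F k) * mu (G k))%E); last exact: product_measure1E.
by rewrite lte_mul_pinfty// ge0_fin_numE.
Qed.

HB.instance Definition _ := Measure_isSigmaFinite.Build _ _ _ lebesgue_step
  step_sigma_finite.

End lebesgue_rV_step.

(* Lebesgue measure on R^l, as an iterated product measure; [lebesgue_rV_box]
   gives its value on boxes, which determines it. *)
Fixpoint lebesgue_rV (R : realType) (l : nat) :
    {sigma_finite_measure set (borel_mx R 1 l) -> \bar R} :=
  match l with
  | 0 => \d_ (0 : borel_mx R 1 0)
  | l'.+1 => lebesgue_step (lebesgue_rV R l')
  end.

Lemma lebesgue_rV_box (R : realType) (l : nat) (A : 'I_l -> set R) :
  (forall i, measurable (A i : set (measurableTypeR R))) ->
  lebesgue_rV R l [set v : 'rV[R]_l | forall i, A i (v 0 i)] =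
    (\prod_(i < l) lebesgue_measure (A i))%E.
Proof.
elim: l A => [|l IH] A mA.
  by rewrite big_ord0 /= diracE mem_set // => -[].
have mbox k (B : 'I_k -> set R) :
    (forall i, measurable (B i : set (measurableTypeR R))) ->
    measurable ([set v : 'rV[R]_k | forall i, B i (v 0 i)] :
      set (borel_mx R 1 k)).
  move=> mB; rewrite (_ : [set _ | _] = \bigcap_(i : 'I_k)
      ((fun v : borel_mx R 1 k => (v : 'rV[R]_k) 0 i) @^-1` B i)).
    apply: fin_bigcap_measurable => // i _; rewrite -[_ @^-1` _]setTI.
    exact: (@measurable_coord R 1 k 0 i measurableT (B i) (mB i)).
  by apply/seteqP; split => [v vB i _|v vB i]; exact: vB.
rewrite big_ord_recl -IH // /= /lebesgue_step /pushforward.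
rewrite [X in product_measure1 _ _ X](_ : _ = A ord0 `*`
    [set v : 'rV[R]_l | forall i, A (lift ord0 i) (v 0 i)]).
  apply: (@product_measure1E _ _ (measurableTypeR R) (borel_mx R 1 l) R
    lebesgue_measure (lebesgue_rV R l)) => //.
  by apply: (@mbox l (fun i => A (lift ord0 i))) => i; exact: (mA (lift ord0 i)).
apply/seteqP; split => [[x v] /= xvA|[x v] [/= xA vA] i].
  split=> [|i]; first by have := xvA ord0; rewrite cons_row0.
  by have := xvA (lift ord0 i); rewrite cons_rowS.
by case: (unliftP ord0 i) => [j|] ->; rewrite ?cons_rowS ?cons_row0.
Qed.

Section fourier.
Context {R : realType} {d : measure_display} {T : measurableType d}.

Definition cis (t : R) : R[i] := Complex (cos t) (sin t).

Definition integralC (mu : {measure set T -> \bar R}) (f : T -> R[i]) : R[i] :=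
  Complex (\int[mu]_u complex.Re (f u)) (\int[mu]_u complex.Im (f u)).

End fourier.

Definition fourier (R : realType) (l : nat)
    (nu : {measure set (borel_mx R 1 l) -> \bar R}) (xi : 'rV[R]_l) : R[i] :=
  integralC nu (fun u => cis (- (2 * pi * edot xi u))).

(* [nu] is concentrated on [F] when the complement of [F], which need not be
   Borel, is [nu]-negligible. *)
Definition sobolev_dim_ge (R : realType) (l : nat) (F : set 'rV[R]_l)
    (sigma : R) : Prop :=
  exists nu : probability (borel_mx R 1 l) R,
    nu.-negligible (~` F) /\
    (\int[lebesgue_rV R l]_xi
      (complex.ComplexField.Normc.normc (fourier nu xi) ^+ 2 /
       (1 + enorm xi) `^ (l%:R - sigma))%:E < +oo)%E.

Section hausdorff.
Context {R : realType} {n : nat}.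
Implicit Types (A : set 'rV[R]_n) (s delta : R).
Local Open Scope ereal_scope.

(* The diameter of the empty set is 0. *)
Definition diameter A : \bar R :=
  ereal_sup (0 |` [set (enorm (x - y))%:E | x in A & y in A]).

(* |A|^s, where the empty set contributes 0 also when s = 0 *)
Definition diam_pow s A : \bar R :=
  if A == set0 then 0 else poweR (diameter A) s.

Definition hausdorff_premeasure s delta A : \bar R :=
  ereal_inf [set \sum_(0 <= k <oo) diam_pow s (U k) |
    U in [set U : (set 'rV[R]_n)^nat |
      (forall k, diameter (U k) <= delta%:E) /\ A `<=` \bigcup_k U k]].

(* The limit as delta tends to 0 is a supremum, by monotonicity in delta. *)
Definition hausdorff_measure s A : \bar R :=
  ereal_sup [set hausdorff_premeasure s delta A |
    delta in [set delta : R | (0 < delta)%R]].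

Definition hausdorff_dim A : \bar R :=
  ereal_inf [set s%:E | s in [set s : R | (0 <= s)%R /\
    hausdorff_measure s A = 0]].

End hausdorff.

Section projections.
Context {R : realType} {n l : nat}.
Implicit Type x : 'M[R]_(l, n - l).

Definition Pmap (ln : (l <= n)%N) x (p : 'rV[R]_n) : 'rV[R]_l :=
  \row_i (p 0 (widen_ord ln i) +
    \sum_(j < n - l) x i j * p 0 (cast_ord (subnKC ln) (rshift l j))).

Definition Tmap x (xi : 'rV[R]_l) : 'rV[R]_(n - l) :=
  \row_j \sum_(i < l) x i j * xi 0 i.

End projections.

Definition compactly_supported (R : realType) (m n : nat)
    (mu : {measure set (borel_mx R m n) -> \bar R}) : Prop :=
  exists2 K : set 'M[R]_(m, n), compact K & mu (~` K) = 0%E.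

(* Main.v *)
Require Import Defs.
From HB Require Import structures.
From mathcomp Require Import all_boot all_order all_algebra.
From mathcomp Require Import all_classical all_reals all_analysis.
From mathcomp Require Import measurable_realfun.
From mathcomp Require Import ring lra zify.

(* Fix s < alpha with n - l + sigma - beta < s. In binary coordinates the
   Hausdorff content of [E] is a capacity, so Choquet's theorem gives a compact
   subset of positive content, and a flow on the binary tree turns it into a
   Frostman measure mu of exponent s. The Fourier transform of the image of a
   measure under P_x at xi is that of the measure at (xi, T_x xi). After mu has
   been multiplied by a density which makes |hat mu|^2 bounded by its local
   averages, the average over x of |hat mu (xi, T_x xi)|^2 is at most
   C |xi|^-beta times the integral of |hat mu|^2 over the zeta in a cube of side
   O(|xi|) whose first l coordinates are close to xi. As the integral of
   |hat mu|^2 over the cube of side 2^k is O(2^(k (n - s))), the shell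
   |xi| ~ 2^k contributes O(2^(k (sigma - l - beta + n - s))) to the average of
   the Sobolev integrals, a convergent geometric series. *)

Set Implicit Arguments.
Unset Strict Implicit.
Unset Printing Implicit Defensive.

Import Order.TTheory GRing.Theory Num.Theory.
Import numFieldNormedType.Exports.

Local Open Scope classical_set_scope.
Local Open Scope ring_scope.

(** * A capacity on the Cantor space *)

(** The set [E] is only Borel, and its Hausdorff measure of exponent s may be infinite. The content
    is used in its place because it is at most 1 and strongly subadditive, hence continuous along
    increasing unions; yet if it vanishes in every integer translate of the unit cube, so does the
    Hausdorff measure.

    The obstacle in the averaging is that [lambda] may be singular. The frequencies (xi, T_x xi)
    then need not spread over any volume, while the energy bound controls |hat mu|^2 only in the
    mean over volumes. The density |hat kappa|^2 of a small box repairs this: the new transform is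
    an integral of hat mu against the autocorrelation of the box, whose support is compact, so the
    local averages run over a bounded cube and have no tails. The new measure is absolutely
    continuous with respect to mu, so it lives on the same compact subset of [E]. The factor
    |xi|^-beta arises because the x for which T_x xi is within O(1) of a given point form, after
    division by |xi|, a slab of width O(1/|xi|). *)

Lemma set_mono (T : Type) (A : (set T)^nat) :
  (forall k, A k `<=` A k.+1) -> forall i j, (i <= j)%N -> A i `<=` A j.
Proof.
move=> hA i j /subnK <-; elim: (j - i)%N => [//|k IH].
by rewrite addSn; exact: subset_trans (hA _).
Qed.

Section cantor_content.
Context {R : realType} (rho : R).
Hypotheses (rho_gt0 : 0 < rho) (rho_half : 1 / 2 <= rho) (rho_le1 : rho <= 1).

Implicit Types (w : seq bool) (x : nat -> bool) (O : set (seq bool)).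

(** Upward closed sets of words encode open sets; for them [open_of] turns intersections of word
    sets into intersections of open sets. *)
Definition hereditary O := forall w b, O w -> O (rcons w b).

Definition open_of O : set (nat -> bool) := [set x | exists k, O (mkseq x k)].

(* The least cost, with price [rho ^+ size v] for a word [v], of covering the part
   of [O] below [w] by words with at most [N] letters more than [w]. *)
Fixpoint content_depth (N : nat) O w : R :=
  if N is N'.+1 then
    Num.min (rho ^+ size w)
      (content_depth N' O (rcons w false) + content_depth N' O (rcons w true))
  else if `[< O w >] then rho ^+ size w else 0.

Lemma content_depth_ge0 N O w : 0 <= content_depth N O w.
Proof.
elim: N w => [|N IH] w /=; first by case: ifP => // _; rewrite exprn_ge0// ltW.
by rewrite le_min exprn_ge0 ?(ltW rho_gt0)//= addr_ge0.
Qed.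

Lemma content_depth_le N O w : content_depth N O w <= rho ^+ size w.
Proof.
case: N => [|N] /=; last by rewrite ge_min lexx.
by case: ifP => // _; rewrite exprn_ge0// ltW.
Qed.

Lemma content_depth_mono N O O' w : O `<=` O' ->
  content_depth N O w <= content_depth N O' w.
Proof.
move=> OO'; elim: N w => [|N IH] w /=.
  case: asboolP => [/OO' O'w|_]; first by rewrite asboolT.
  by case: ifP => // _; rewrite exprn_ge0// ltW.
by rewrite le_min ge_min lexx/= ge_min; apply/orP; right; exact: lerD.
Qed.

(** A word of [O] may be exchanged for its two children without saving anything, since 2 * rho is at
    least 1. *)
Lemma content_depthS N O w : hereditary O ->
  content_depth N O w <= content_depth N.+1 O w.
Proof.
move=> hO; elim: N w => [|N IH] w.
  rewrite /=; case: asboolP => [Ow|_].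
    rewrite !asboolT; [|exact: hO..].
    have : 0 <= rho ^+ size w * (rho - 1 / 2).
      by rewrite mulr_ge0 ?subr_ge0// exprn_ge0// ltW.
    by rewrite le_min lexx/= !size_rcons exprS; lra.
  rewrite le_min exprn_ge0 ?(ltW rho_gt0)//= addr_ge0//;
    by case: ifP => // _; rewrite exprn_ge0// ltW.
rewrite [in leLHS]/=; set N1 := N.+1; rewrite /= /N1.
by rewrite le_min ge_min lexx/= ge_min; apply/orP; right; exact: lerD.
Qed.

Lemma content_depth_homo O w : hereditary O ->
  {homo (fun N => content_depth N O w) : m n / (m <= n)%N >-> m <= n}.
Proof.
move=> hO m n /subnK <-; elim: (n - m)%N => [//|k IH].
by rewrite addSn; exact: (le_trans IH (content_depthS _ _ hO)).
Qed.

(** Strong subadditivity survives the minimum with a common price, because the value at the union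
    dominates, and that at the intersection is dominated by, the values at both sets. *)
Lemma content_depthUI N O O' w :
  content_depth N (O `|` O') w + content_depth N (O `&` O') w <=
  content_depth N O w + content_depth N O' w.
Proof.
elim: N w => [|N IH] w.
  rewrite /= /setU /setI/= asbool_or asbool_and.
  have : 0 <= rho ^+ size w by rewrite exprn_ge0// ltW.
  by case: asboolP => _; case: asboolP => _ /=; lra.
have := IH (rcons w false); have := IH (rcons w true).
have mono b P P' : P `<=` P' ->
  content_depth N P (rcons w b) <= content_depth N P' (rcons w b).
  exact: content_depth_mono.
have := mono false _ _ (@subIsetl _ O O'); have := mono true _ _ (@subIsetl _ O O').
have := mono false _ _ (@subIsetr _ O O'); have := mono true _ _ (@subIsetr _ O O').
rewrite /=.
by rewrite !minEle; do 4!case: ifP; lra.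
Qed.

(** For hereditary sets the values increase with the depth, so the supremum is a limit of finite
    problems. *)
Definition open_content O : R := sup (range (fun N => content_depth N O [::])).

Lemma content_depth_le1 N O : content_depth N O [::] <= 1.
Proof. by have := content_depth_le N O [::]; rewrite expr0. Qed.

Lemma open_content_ub O N : content_depth N O [::] <= open_content O.
Proof.
apply: sup_ubound; last by exists N.
by exists 1 => _ [k _ <-]; exact: content_depth_le1.
Qed.

Lemma open_content_le O a :
  (forall N, content_depth N O [::] <= a) -> open_content O <= a.
Proof.
move=> h; apply: sup_le_ub; first by exists (content_depth 0 O [::]); exists 0%N.
by move=> _ [k _ <-].
Qed.

Lemma open_content_ge0 O : 0 <= open_content O.
Proof. exact: le_trans (content_depth_ge0 0 O [::]) (open_content_ub _ _). Qed.

Lemma hereditaryU O O' : hereditary O -> hereditary O' -> hereditary (O `|` O').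
Proof. by move=> h h' w b [/h|/h'] H; [left|right]. Qed.

Lemma hereditaryI O O' : hereditary O -> hereditary O' -> hereditary (O `&` O').
Proof. by move=> h h' w b [ Ow O'w]; split; [exact: h|exact: h']. Qed.

Lemma open_contentUI O O' : hereditary O -> hereditary O' ->
  open_content (O `|` O') + open_content (O `&` O') <=
  open_content O + open_content O'.
Proof.
move=> hO hO'; rewrite -lerBrDr; apply: open_content_le => N.
rewrite lerBrDr -lerBrDl; apply: open_content_le => N'; rewrite lerBrDl.
have hU := @content_depth_homo _ [::] (hereditaryU hO hO').
have hI := @content_depth_homo _ [::] (hereditaryI hO hO').
apply: le_trans (lerD (hU _ _ (leq_maxl N N')) (hI _ _ (leq_maxr N N'))) _.
apply: le_trans (content_depthUI _ _ _ _) _.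
by apply: lerD; exact: open_content_ub.
Qed.

(** A fixed depth consults finitely many words only, and each of them is settled at a finite stage
    of the union. *)
Lemma content_depth_bigcup (O : (set (seq bool))^nat) N w :
  (forall k, O k `<=` O k.+1) ->
  exists k, content_depth N (\bigcup_k O k) w <= content_depth N (O k) w.
Proof.
move=> hO; elim: N w => [|N IH] w /=.
  case: asboolP => [[k _ Okw]|_]; first by exists k; rewrite asboolT.
  by exists 0%N; case: ifP => // _; rewrite exprn_ge0// ltW.
have [i hi] := IH (rcons w false); have [j hj] := IH (rcons w true).
exists (maxn i j); rewrite le_min ge_min lexx/= ge_min; apply/orP; right.
apply: lerD.
  exact: le_trans hi (content_depth_mono _ _ (set_mono hO (leq_maxl _ _))).
exact: le_trans hj (content_depth_mono _ _ (set_mono hO (leq_maxr _ _))).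
Qed.

Definition content (A : set (nat -> bool)) : R :=
  inf [set open_content O | O in [set O | hereditary O /\ A `<=` open_of O]].

Lemma content_has_inf A :
  has_inf [set open_content O | O in [set O | hereditary O /\ A `<=` open_of O]].
Proof.
split; last by exists 0; move=> _ [G _ <-]; exact: open_content_ge0.
exists (open_content setT); exists setT; last by [].
by split => [//|x _]; exists 0%N.
Qed.

Lemma content_lb A O : hereditary O -> A `<=` open_of O ->
  content A <= open_content O.
Proof.
move=> hO AO; apply: ge_inf; last by exists O.
by have [] := content_has_inf A.
Qed.

Lemma content_ge A a :
  (forall O, hereditary O -> A `<=` open_of O -> a <= open_content O) ->
  a <= content A.
Proof.
move=> h; apply: lb_le_inf; first by have [] := content_has_inf A.
by move=> _ [G [hG AG] <-]; exact: h.
Qed.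

Lemma content_adherent A e : 0 < e -> exists O,
  [/\ hereditary O, A `<=` open_of O & open_content O < content A + e].
Proof.
move=> e0; have [_ [G [hG AG] <-] h] := inf_adherent e0 (content_has_inf A).
by exists G.
Qed.

Lemma content_ge0 A : 0 <= content A.
Proof. by apply: content_ge => O _ _; exact: open_content_ge0. Qed.

Lemma content_mono A B : A `<=` B -> content A <= content B.
Proof.
move=> AB; apply: content_ge => O hO BO; apply: content_lb => //.
exact: subset_trans BO.
Qed.

Lemma content0 : content set0 = 0.
Proof.
apply/eqP; rewrite eq_le content_ge0 andbT.
apply: (@le_trans _ _ (open_content set0)); first exact: content_lb.
apply: open_content_le => N; suff -> : content_depth N set0 [::] = 0 by [].
elim: N [::] => [|N IH] w /=; first by rewrite asboolF.
by rewrite !IH addr0 min_r// exprn_ge0// ltW.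
Qed.

Lemma contentU A B : content (A `|` B) <= content A + content B.
Proof.
apply/ler_addgt0Pr => e e0; have e20 : 0 < e / 2 by rewrite divr_gt0.
have [ O [hO AO lO]] := content_adherent A e20.
have [ O' [hO' BO' lO']] := content_adherent B e20.
have := open_contentUI hO hO'; have := open_content_ge0 (O `&` O').
have : content (A `|` B) <= open_content (O `|` O').
  apply: content_lb; first exact: hereditaryU.
  by move=> x [/AO[k ?]|/BO'[k ?]]; exists k; [left|right].
by lra.
Qed.

Lemma hereditary_mkseq O x j k : hereditary O -> (j <= k)%N ->
  O (mkseq x j) -> O (mkseq x k).
Proof.
move=> hO /subnK <- h; elim: (k - j)%N => [//|i IH].
by rewrite addSn mkseqS; exact: hO.
Qed.

(* Choquet's argument: strong subadditivity makes the excess of the union of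
   near-optimal open covers at most the sum of the excesses. *)
Lemma content_bigcup_le (A : (set (nat -> bool))^nat) t :
  (forall k, A k `<=` A k.+1) -> (forall k, content (A k) <= t) ->
  content (\bigcup_k A k) <= t.
Proof.
move=> ndA hA; apply/ler_addgt0Pr => e e0.
pose ee k : R := e / 2 ^+ k.+1.
have ee0 k : 0 < ee k by rewrite divr_gt0// exprn_gt0.
pose O k := sval (cid (content_adherent (A k) (ee0 k))).
have [hO AO lO] : [/\ forall k, hereditary (O k), forall k, A k `<=` open_of (O k)
    & forall k, open_content (O k) < content (A k) + ee k].
  by split => k; rewrite /O; case: cid => /= ? [].
pose H k := \bigcup_(j in `I_k.+1) O j.
have HS k : H k.+1 = H k `|` O k.+1.
  apply/seteqP; split => [w [j /= jk Ow]|w [[j /= jk Ow]|Ow]].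
  - by move: jk; rewrite ltnS leq_eqVlt => /predU1P[<-|jk]; [right|left; exists j].
  - by exists j => //=; exact: ltnW.
  - by exists k.+1 => /=.
have hH k : hereditary (H k) by move=> w b [j jk /hO Ow]; exists j.
have AH k j : (k <= j)%N -> A k `<=` open_of (H j).
  by move=> kj x /AO[i Oi]; exists i; exists k.
(* The errors [ee j] for j at most k add up to e * (1 - 2^-(k+1)). *)
have lH k : open_content (H k) <= content (A k) + e * (1 - (2 ^+ k.+1)^-1).
  elim: k => [|k IH].
    rewrite /H (_ : \bigcup_(j in _) _ = O 0%N).
      by have := lO 0%N; rewrite /ee expr1; lra.
    by apply/seteqP; split => [w [[]]//|w Ow]; exists 0%N.
  have := open_contentUI (hH k) (hO k.+1); rewrite -HS.
  (* Both open sets contain [A k], so their intersection costs at least [content (A k)]; this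
     cancels that term of the bound for [H k]. *)
  have : content (A k) <= open_content (H k `&` O k.+1).
    apply: content_lb; first exact: hereditaryI.
    move=> x Ax; have [i Hi] := AH k k (leqnn _) _ Ax.
    have [j Oj] := AO _ _ (ndA _ _ Ax).
    exists (maxn i j); split.
      exact: hereditary_mkseq (leq_maxl _ _) Hi.
    exact: hereditary_mkseq (leq_maxr _ _) Oj.
  have := lO k.+1; rewrite /ee [in X in _ + X](exprS _ k.+1).
  have : 0 < (2 : R) ^+ k.+1 by rewrite exprn_gt0.
  rewrite (exprS _ k.+1); move: IH; set p := 2 ^+ k.+1; move=> IH p0.
  rewrite invfM; lra.
have ndH k : H k `<=` H k.+1 by rewrite HS; exact: subsetUl.
apply: (@le_trans _ _ (open_content (\bigcup_k H k))).
  apply: content_lb; first by move=> w b [k _ /hH Hw]; exists k.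
  by move=> x [k _ /(AH k k (leqnn _))[j Hj]]; exists j, k.
apply: open_content_le => N.
have [k /le_trans->//] := content_depth_bigcup N [::] ndH.
apply: le_trans (open_content_ub _ _) _; apply: le_trans (lH k) _.
have : 0 < e * (2 ^+ k.+1)^-1 by rewrite mulr_gt0// invr_gt0 exprn_gt0.
by have := hA k; lra.
Qed.

Definition cylinder w : set (nat -> bool) := [set x | mkseq x (size w) = w].

Lemma content_cylinder w : content (cylinder w) <= rho ^+ size w.
Proof.
have hp : hereditary (fun v => prefix w v).
  by move=> v b /prefixP[s ->]; apply/prefixP; exists (rcons s b); rewrite rcons_cat.
apply: (@le_trans _ _ (open_content (fun v => prefix w v))).
  apply: content_lb => // x; rewrite /cylinder/= => wx.
  by exists (size w); rewrite wx prefix_refl.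
have rle v : (size w <= size v)%N -> rho ^+ size v <= rho ^+ size w.
  by move=> wv; rewrite ler_wiXn2l// ltW.
apply: open_content_le => N.
(* The induction needs a bound at every word: a word incomparable with [w] costs nothing, and an
   ancestor of [w] has one child at most that costs anything. *)
suff : forall v, content_depth N (fun v => prefix w v) v <=
    if prefix v w || prefix w v then rho ^+ size w else 0.
  by move=> /(_ [::]); rewrite prefix0s.
elim: N => [|N IH] v /=.
  case: asboolP => [wv|_]; first by rewrite wv orbT; exact/rle/size_prefix.
  by case: ifP => // _; rewrite exprn_ge0// ltW.
have [wv|wv] := leqP (size w) (size v).
  case: ifP => [_|/norP[_ nwv]]; first by rewrite ge_min rle.
  have nwb b : prefix w (rcons v b) = false.
    apply/negP; rewrite prefixE => /eqP h; move/negP: nwv; apply.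
    by rewrite prefixE; move: h; rewrite -cats1 takel_cat// => ->.
  have nbw b : prefix (rcons v b) w = false.
    by apply/negP => /size_prefix; rewrite size_rcons leqNgt ltnS wv.
  rewrite ge_min; apply/orP; right.
  by have := IH (rcons v false); have := IH (rcons v true); rewrite !nwb !nbw/=; lra.
rewrite ge_min; apply/orP; right.
have nwb b : prefix w (rcons v b) -> w = rcons v b.
  rewrite prefixE => /eqP <-; rewrite take_oversize// size_rcons//.
have pE b : prefix (rcons v b) w || prefix w (rcons v b) =
    prefix v w && (nth false w (size v) == b).
  apply/orP/andP => [[|/nwb wE]|[]].
  - rewrite !prefixE size_rcons (take_nth false)// => /eqP/rcons_inj[-> ->].
    by rewrite !eqxx.
  - by rewrite {1 2}wE prefix_rcons nth_rcons ltnn !eqxx.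
  - rewrite prefixE => /eqP h /eqP nb; left.
    by rewrite prefixE size_rcons (take_nth false)// h nb.
have := IH (rcons v false); have := IH (rcons v true).
rewrite !pE; have -> : prefix w v = false.
  by apply/negP => /size_prefix; rewrite leqNgt wv.
by case: (prefix v w); case: (nth false w (size v)) => /=; lra.
Qed.

Lemma prefix_split w w' : w' != w ->
  prefix w w' = prefix (rcons w false) w' (+) prefix (rcons w true) w' :> bool.
Proof.
move=> w'w; apply/idP/idP => [|].
  move=> /prefixP[[|b v] w'E]; first by rewrite w'E cats0 eqxx in w'w.
  rewrite w'E !prefixE !size_rcons -cat_rcons.
  rewrite !take_cat !size_rcons ltnn subnn take0 cats0 !eqseq_rcons !eqxx.
  by case: b {w'E}.
have sub b : prefix (rcons w b) w' -> prefix w w'.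
  exact: prefix_trans (prefix_rcons _ _).
by case: (boolP (prefix _ _)) => [/sub//|_]; case: (boolP (prefix _ _)) => [/sub|].
Qed.

(* The cover consists of the minimal words [w] at which the content of the open
   set inside [w] reaches its maximal value [rho ^+ size w]. *)
Lemma content_lt_cover A e : content A < e -> exists V : set (seq bool),
  A `<=` \bigcup_(w in V) cylinder w /\
  forall s : seq (seq bool), uniq s -> (forall w, w \in s -> V w) ->
    \sum_(w <- s) rho ^+ size w <= e.
Proof.
rewrite -subr_gt0 => /(content_adherent A)[G [hG AG]].
rewrite addrC subrK => /ltW Ge.
pose stop w := exists N, rho ^+ size w <= content_depth N G w.
pose V := [set w | stop w /\ forall j, (j < size w)%N -> ~ stop (take j w)].
exists V; split.
  move=> x /AG[k Gk].
  have hs : exists j, `[< stop (mkseq x j) >].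
    exists k; apply/asboolP; exists 0%N; rewrite /= asboolT// size_mkseq.
  case: (ex_minnP hs) => j /asboolP sj jmin; exists (mkseq x j); last first.
    by rewrite /cylinder/= size_mkseq.
  split=> // i; rewrite size_mkseq => ij; rewrite /mkseq -map_take take_iota.
  rewrite (minn_idPl (ltnW ij)) => si.
  by have := jmin i; rewrite leqNgt ij => /(_ (asboolT si)).
have /choice[N hN] : forall w, exists N, stop w -> rho ^+ size w <= content_depth N G w.
  move=> w; have [[N hN]|h] := pselect (stop w); first by exists N.
  by exists 0%N.
move=> s us sV.
have one M w : stop w -> (N w <= M)%N ->
    \sum_(w' <- s | w' == w) rho ^+ size w' <= content_depth M G w.
  move=> sw NM; have [ws|ws] := boolP (w \in s).
    rewrite -big_filter filter_pred1_uniq// big_seq1.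
    exact: le_trans (hN _ sw) (content_depth_homo _ hG NM).
  rewrite big_seq_cond big1 ?content_depth_ge0// => i /andP[iw /eqP iE].
  by rewrite -iE iw in ws.
(* Descent in the tree, with a depth [M] that suffices for all words of [s] below [w]. If [w] stops,
   minimality leaves no other word of [s] below it; if not, its price is not attained and the
   minimum is the sum over the two children. *)
have cl M : forall w, (forall j, (j < size w)%N -> ~ stop (take j w)) ->
    (forall w', w' \in s -> prefix w w' -> (size w' + N w' <= size w + M)%N) ->
    \sum_(w' <- s | prefix w w') rho ^+ size w' <= content_depth M G w.
  elim: M => [|M IH] w wmin wM.
    have [ws|ws] := boolP (w \in s).
      have sw : stop w by case: (sV w ws).
      have Nw : (N w <= 0)%N by have := wM w ws (prefix_refl _); lia.
      apply: le_trans (one _ _ sw Nw).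
      rewrite big_seq_cond [leRHS]big_seq_cond.
      rewrite (eq_bigl (fun i => (i \in s) && (i == w))) // => i.
      apply/andP/andP => -[is_ h]; split=> //; last by rewrite (eqP h) prefix_refl.
      have := wM i is_ h; move/prefixP: h => [v ->]; rewrite size_cat.
      by case: v => [|? ?] /=; [rewrite cats0|lia].
    rewrite big_seq_cond big1 ?content_depth_ge0// => i /andP[iw h].
    have := wM i iw h; move/prefixP: h iw => [v ->]; rewrite size_cat.
    by case: v => [|? ?] /=; [rewrite cats0 (negbTE ws)|lia].
  have [sw|nsw] := pselect (stop w).
    have [ws|ws] := boolP (w \in s).
      have Nw : (N w <= M.+1)%N by have := wM w ws (prefix_refl _); lia.
      apply: le_trans (one _ _ sw Nw).
      rewrite big_seq_cond [leRHS]big_seq_cond.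
      rewrite (eq_bigl (fun i => (i \in s) && (i == w))) // => i.
      apply/andP/andP => -[is_ h]; split=> //; last by rewrite (eqP h) prefix_refl.
      move: h (sV i is_) => /prefixP[[|b v] ->]; first by rewrite cats0.
      move=> [_ /(_ (size w))]; rewrite size_cat take_size_cat//= => h.
      by exfalso; apply: h => //; lia.
    rewrite big_seq_cond big1 ?content_depth_ge0// => i /andP[is_].
    move=> /prefixP[[|b v] iE]; first by rewrite -(cats0 w) -iE is_ in ws.
    move: (sV i is_) => [_ /(_ (size w))]; rewrite iE size_cat take_size_cat//= => h.
    by exfalso; apply: h => //; lia.
  have ws : w \notin s by apply/negP => /sV[].
  have -> : content_depth M.+1 G w =
      content_depth M G (rcons w false) + content_depth M G (rcons w true).
    rewrite /= minEge; case: ifP => // h; exfalso; apply: nsw.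
    by exists M.+1; rewrite /= le_min lexx/= ltW// ltNge h.
  have hch b : \sum_(w' <- s | prefix (rcons w b) w') rho ^+ size w' <=
      content_depth M G (rcons w b).
    apply: IH.
    - move=> j; rewrite size_rcons ltnS leq_eqVlt => /predU1P[->|jw].
        by rewrite -cats1 take_size_cat.
      by rewrite -cats1 takel_cat; [exact: wmin|exact: ltnW].
    - move=> w' w's h; rewrite size_rcons addSnnS; apply: wM => //.
      exact: prefix_trans (prefix_rcons _ _) h.
  apply: le_trans (lerD (hch false) (hch true)).
  rewrite !(big_mkcond (fun w' => prefix _ w')) -big_split/=.
  rewrite !big_seq; apply: ler_sum => w' w's; rewrite prefix_split; last first.
    by apply: contraNneq ws => <-.
  have : 0 <= rho ^+ size w' by rewrite exprn_ge0// ltW.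
  by case: prefix; case: prefix => /=; lra.
pose M := \max_(w <- s) (size w + N w)%N.
apply: le_trans (le_trans (open_content_ub G M) Ge).
apply: le_trans (cl M [::] _ _) => // [|w' w's _].
  by under [leRHS]eq_bigl do rewrite prefix0s.
rewrite add0n /M.
exact: (@leq_bigmax_seq _ s (fun w => true) (fun w => (size w + N w)%N)).
Qed.

End cantor_content.

(** * Analytic sets *)

Lemma word_choice (T : Type) (P : seq T -> Prop) : P [::] ->
  (forall w, P w -> exists a, P (rcons w a)) ->
  exists f : nat -> T, forall k, P (mkseq f k).
Proof.
move=> P0 hP; have [a0 _] := hP _ P0.
have /choice[a ha] : forall w, exists a, P w -> P (rcons w a).
  move=> w; have [/hP[b Pb]|h] := pselect (P w); first by exists b.
  by exists a0.
pose fix W k : seq T := if k is k'.+1 then rcons (W k') (a (W k')) else [::].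
exists (fun k => a (W k)) => k.
have -> : mkseq (fun k => a (W k)) k = W k by elim: k => // k IH; rewrite mkseqS IH.
by elim: k => //= k IH; exact: ha.
Qed.

(** The basic neighbourhoods of the product topology; closedness and continuity on sequences are
    phrased through them. *)
Definition agree (T : Type) k (f g : nat -> T) := forall i, (i < k)%N -> f i = g i.

Lemma agree_mkseq (T : Type) k (f g : nat -> T) :
  agree k f g <-> mkseq f k = mkseq g k.
Proof.
split=> [h|h i ik]; last by rewrite -(nth_mkseq (f 0%N) f ik) h nth_mkseq.
apply/(@eq_from_nth _ (f 0%N)); rewrite !size_mkseq// => i ik.
by rewrite !nth_mkseq// h.
Qed.

Lemma agreeW (T : Type) j k (f g : nat -> T) : (j <= k)%N -> agree k f g -> agree j f g.
Proof. by move=> jk h i ij; apply: h; exact: leq_trans jk. Qed.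

(** Sequential compactness of a product of finite sets: if infinitely many [g k] extend a word, then
    infinitely many of them agree on one of the finitely many next letters. Bounding the letters
    below [k] is enough, as only late sequences count. *)
Lemma konig (T : eqType) (g : nat -> nat -> T) (P : nat -> seq T) :
  (forall k i, (i < k)%N -> g k i \in P i) ->
  exists f, forall j K, exists2 k, (K <= k)%N & agree j f (g k).
Proof.
move=> gP.
pose inf w := forall K, exists2 k, (K <= k)%N & mkseq (g k) (size w) = w.
have [|w iw|f hf] := @word_choice T inf.
- by move=> K; exists K.
- apply/not_existsP => h.
  have /choice[K hK] : forall a, exists K, forall k, (K <= k)%N ->
      mkseq (g k) (size w).+1 <> rcons w a.
    move=> a; have /existsNP[K hK] := h a; exists K => k Kk E; apply: hK.
    by exists k => //; rewrite size_rcons.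
  have [k] := iw (maxn (size w).+1 (\max_(a <- P (size w)) K a)).
  rewrite geq_max => /andP[wk Kk] E.
  apply: (hK (g k (size w)) k); last by rewrite mkseqS E.
  apply: leq_trans Kk; apply: (@leq_bigmax_seq _ _ (fun=> true) K) => //.
  exact: gP.
- exists f => j K; have [k Kk] := hf j K; rewrite size_mkseq => E.
  by exists k => //; apply/agree_mkseq.
Qed.

Definition seq_closed (K : set (nat -> bool)) :=
  forall x, (forall k, exists2 x', agree k x x' & K x') -> K x.

Definition seq_closed2 (C : (nat -> bool) -> (nat -> nat) -> Prop) :=
  forall x f, (forall k, exists x' f', [/\ agree k x x', agree k f f' & C x' f']) ->
  C x f.

(** Suslin's definition: the projection of a closed subset of the product of the Cantor and Baire
    spaces. *)
Definition analytic (A : set (nat -> bool)) :=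
  exists2 C, seq_closed2 C & forall x, A x <-> exists f, C x f.

(** The bounds [n i] confine the pairs to a compact set: position [i] takes at most 2 * (n i + 1)
    values. *)
Lemma seq_closed2_konig C (n : nat -> nat) (x : nat -> nat -> bool)
    (f : nat -> nat -> nat) : seq_closed2 C ->
  (forall k, C (x k) (f k)) -> (forall k i, (i < k)%N -> (f k i <= n i)%N) ->
  exists x' f', [/\ C x' f', forall i, (f' i <= n i)%N &
    forall j, exists2 k, (j <= k)%N & agree j x' (x k)].
Proof.
move=> Ccl Cxf fn.
have [k i ik|h hh] := @konig (bool * nat)%type (fun k i => (x k i, f k i))
  (fun i => [seq (b, m) | b <- [:: true; false], m <- iota 0 (n i).+1]).
  apply/allpairsP; exists (x k i, f k i); split=> //.
    by rewrite !inE; case: (x k i).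
  by rewrite mem_iota/= add0n ltnS; exact: fn.
exists (fun i => (h i).1), (fun i => (h i).2); split.
- apply: Ccl => k; have [j _ hj] := hh k 0%N; exists (x j), (f j).
  by split=> // i ik; rewrite hj.
- move=> i; have [k ik hk] := hh i.+1 i.+1.
  by rewrite (hk i (ltnSn _)) /=; exact: fn.
- by move=> j; have [k jk hk] := hh j j; exists k => // i ij; rewrite hk.
Qed.

(** Choquet's capacitability theorem. The bounds on the successive letters of the code are chosen
    one at a time, each keeping the content above [t] by continuity along increasing unions; all
    bounds together cut out a compact set. *)
Lemma analytic_inner_closed (R : realType) (rho : R) A t :
  0 < rho -> 1 / 2 <= rho -> analytic A -> t < content rho A ->
  exists K, [/\ seq_closed K, K `<=` A & t <= content rho K].
Proof.
move=> rho0 rho2 [C Ccl AC] tA.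
pose AA (w : seq nat) := [set x | exists2 f, C x f &
  forall i, (i < size w)%N -> (f i <= nth 0%N w i)%N].
have [||n hn] := @word_choice _ (fun w => t < content rho (AA w)).
- apply: lt_le_trans tA _; apply: content_mono => // x /AC[f Cxf].
  by exists f.
- move=> w tw; apply/not_existsP => h; move: tw; apply/negP; rewrite -leNgt.
  have -> : AA w = \bigcup_m AA (rcons w m).
    apply/seteqP; split=> x.
      move=> [f Cxf fw]; exists (f (size w)) => //; exists f => // i.
      rewrite size_rcons ltnS leq_eqVlt nth_rcons => /predU1P[->|iw].
        by rewrite ltnn eqxx.
      by rewrite iw; exact: fw.
    move=> [m _ [f Cxf fw]]; exists f => // i iw.
    by have := fw i; rewrite size_rcons nth_rcons iw => -> //; exact: ltnW.
  apply: content_bigcup_le => // [m x [f Cxf fw]|m].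
    exists f => // i iw; apply: leq_trans (fw i _) _; first by rewrite !size_rcons in iw *.
    by rewrite !nth_rcons; case: ifP => // _; case: ifP.
  by rewrite leNgt; apply/negP; exact: h.
pose K := [set x | exists2 f, C x f & forall i, (f i <= n i)%N].
exists K; split.
- move=> x hx.
  have /choice[xf hxf] : forall k, exists p : (nat -> bool) * (nat -> nat),
      [/\ agree k x p.1, C p.1 p.2 & forall i, (p.2 i <= n i)%N].
    by move=> k; have [x' xx' [f Cf fn]] := hx k; exists (x', f).
  have [|k i _|x' [f' [Cx' f'n xx']]] := @seq_closed2_konig C n
    (fun k => (xf k).1) (fun k => (xf k).2) Ccl.
  + by move=> k; have [] := hxf k.
  + by have [] := hxf k.
  suff -> : x = x' by exists f'.
  apply/funext => i; have [k ik hk] := xx' i.+1; have [hk' _ _] := hxf k.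
  by rewrite hk// hk'//; exact: leq_trans ik.
- by move=> x [f Cxf _]; apply/AC; exists f.
- apply: content_ge => // O hO KO.
  (* Otherwise each stage has a point outside the open set, and a limit of these points would lie in
     [K] but not in the open set. *)
  suff [k Ak] : exists k, AA (mkseq n k) `<=` open_of O.
    apply: le_trans (ltW (hn k)) _; exact: content_lb.
  apply/not_existsP => h.
  have /choice[xf hxf] : forall k, exists p : (nat -> bool) * (nat -> nat),
      [/\ C p.1 p.2, forall i, (i < k)%N -> (p.2 i <= n i)%N & ~ open_of O p.1].
    move=> k; have /existsNP[x] := h k.
    move=> /not_implyP[[f Cxf fn] Ox]; exists (x, f); split=> // i ik.
    by have := fn i; rewrite size_mkseq nth_mkseq// => ->.
  have [||x' [f' [Cx' f'n xx']]] := @seq_closed2_konig C n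
    (fun k => (xf k).1) (fun k => (xf k).2) Ccl.
  + by move=> k; have [] := hxf k.
  + by move=> k i ik; have [_ hi _] := hxf k; exact: hi.
  have [j Oj] : open_of O x' by apply: KO; exists f'.
  have [k _ /agree_mkseq ak] := xx' j; have [_ _] := hxf k; apply.
  by exists j; rewrite -ak.
Qed.

(** The first letter of the code names a set of the family, the remaining letters are a code for
    that set. *)
Lemma analytic_bigcup (A : (set (nat -> bool))^nat) :
  (forall i, analytic (A i)) -> analytic (\bigcup_i A i).
Proof.
move=> hA.
have /choice[C hC] : forall i, exists C, seq_closed2 C /\
    forall x, A i x <-> exists f, C x f.
  by move=> i; have [C] := hA i; exists C.
exists (fun x f => C (f 0%N) x (fun j => f j.+1)).
  move=> x f h; apply: (hC (f 0%N)).1 => k.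
  have [x' [f' [xx' ff' Cxf]]] := h k.+1; exists x', (fun j => f' j.+1); split.
  - exact: agreeW (leqnSn _) xx'.
  - by move=> j jk; rewrite ff'.
  - by rewrite ff'.
move=> x; split.
  move=> [i _ /(hC i).2 [f Cxf]].
  by exists (fun j => if j is j'.+1 then f j' else i).
by move=> [f Cxf]; exists (f 0%N) => //; apply/(hC (f 0%N)).2; eexists; exact: Cxf.
Qed.

(** One code interleaves codes for all the sets, through the pairing [pickle]. *)
Lemma analytic_bigcap (A : (set (nat -> bool))^nat) :
  (forall i, analytic (A i)) -> analytic (\bigcap_i A i).
Proof.
move=> hA.
have /choice[C hC] : forall i, exists C, seq_closed2 C /\
    forall x, A i x <-> exists f, C x f.
  by move=> i; have [C] := hA i; exists C.
exists (fun x f => forall i, C i x (fun j => f (pickle (i, j)))).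
  move=> x f h i; apply: (hC i).1 => k.
  (* The agreement must reach every position at which the first [k] letters of the [i]-th code are
     stored. *)
  have [x' [f' [xx' ff' Cxf]]] := h (maxn k (\max_(j < k) (pickle (i, j : nat)).+1)).
  exists x', (fun j => f' (pickle (i, j))); split=> //.
  - exact: agreeW (leq_maxl _ _) xx'.
  - move=> j jk; apply: ff'; rewrite leq_max; apply/orP; right.
    exact: (@leq_bigmax _ (fun j : 'I_k => (pickle (i, j : nat)).+1) (Ordinal jk)).
move=> x; split.
  move=> Ax; have /choice[f hf] : forall i, exists f, C i x f.
    by move=> i; apply/(hC i).2; exact: Ax.
  exists (fun p => if unpickle p is Some (i, j) then f i j else 0%N) => i.
  rewrite [X in C i x X](_ : _ = f i); first exact: hf.
  by apply/funext => j; rewrite pickleK.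
by move=> [f Cxf] i _; apply/(hC i).2; eexists; exact: Cxf.
Qed.

Lemma analytic_closed A : seq_closed A -> analytic A.
Proof.
move=> Acl; exists (fun x _ => A x) => [x f h|x].
  by apply: Acl => k; have [x' [f' [xx' _ Ax']]] := h k; exists x'.
by split=> [Ax|[]//]; exists id.
Qed.

(** The first letter of the code is the radius of a neighbourhood contained in [A]. *)
Lemma analytic_open A :
  (forall x, A x -> exists k, forall x', agree k x x' -> A x') -> analytic A.
Proof.
move=> Aop; exists (fun x f => forall x', agree (f 0%N) x x' -> A x').
  (* The 1 forces both codes to have the same first letter, hence the same radius. *)
  move=> x f h y xy; have [x' [f' [xx' ff' Cxf]]] := h (maxn 1 (f 0%N)).
  apply: Cxf => i; rewrite -ff' ?leq_max// => ik.
  by rewrite -xx' ?xy// leq_max ik orbT.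
move=> x; split=> [/Aop[k hk]|[f]]; first by exists (fun=> k).
by apply.
Qed.

(* Closure under complements is only available for the class of sets that are
   analytic together with their complement. *)
Lemma analytic_borel_preimage (T : topologicalType) (g : (nat -> bool) -> T)
    (E : set T) :
  (forall U x, open U -> U (g x) -> exists k, forall x', agree k x x' -> U (g x')) ->
  <<s @open T >> E -> analytic (g @^-1` E).
Proof.
move=> gC.
pose M := [set E : set T | analytic (g @^-1` E) /\ analytic (g @^-1` (~` E))].
suff ME : <<s @open T >> `<=` M by move=> /ME[].
apply: smallest_sub.
  split.
  - split; rewrite ?setC0; last by apply: analytic_open => x _; exists 0%N.
    by apply: analytic_open => x [].
  - by move=> A [h h']; split; rewrite setTD// setCK.
  - move=> A hA; split.
      by rewrite preimage_bigcup; apply: analytic_bigcup => i; have [] := hA i.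
    rewrite setC_bigcup preimage_bigcap; apply: analytic_bigcap => i.
    by have [] := hA i.
move=> U oU; have gU x := gC U x oU; split; first exact: analytic_open.
apply: analytic_closed => x h Ux; have [k hk] := gU _ Ux.
by have [x' xx'] := h k; apply; exact: hk.
Qed.

(** * Frostman measures *)

Section flow.
Context {R : realType} (rho : R).
Hypotheses (rho_gt0 : 0 < rho) (rho_half : 1 / 2 <= rho) (rho_le1 : rho <= 1).
Variable K : set (nat -> bool).

Let cw w := content rho (K `&` cylinder w).
Let m := content rho K.

Let cw_le w : cw w <= rho ^+ size w.
Proof.
apply: le_trans (content_cylinder rho_gt0 rho_le1 w).
by apply: content_mono => //; exact: subIsetr.
Qed.

Let cw_split w : cw w <= cw (rcons w false) + cw (rcons w true).
Proof.
apply: le_trans (contentU rho_gt0 rho_half (K `&` cylinder _) (K `&` cylinder _)).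
apply: content_mono => // x [Kx]; rewrite /cylinder/= => xw.
have E : mkseq x (size w).+1 = rcons w (x (size w)) by rewrite mkseqS xw.
by case xb: (x (size w)) E => E; [right|left]; split => //; rewrite size_rcons.
Qed.

(** Left end and length of the interval that a word receives; the word is reversed so that the
    recursion removes its last letter. The child [false] takes as much as its content allows, the
    child [true] takes the rest. *)
Let Fixpoint rnode (v : seq bool) : R * R :=
  if v is b :: v' then
    let s := rnode v' in
    let th0 := Num.min s.2 (cw (rev (false :: v'))) in
    if b then (s.1 + th0, s.2 - th0) else (s.1, th0)
  else (0, m).

Let node w := rnode (rev w).
Let th0 w := Num.min (node w).2 (cw (rcons w false)).

Let node_rcons w b : node (rcons w b) =
  if b then ((node w).1 + th0 w, (node w).2 - th0 w) else ((node w).1, th0 w).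
Proof. by rewrite /node rev_rcons /= /th0 rev_cons revK. Qed.

Let bit (t : R) w := ~~ (t < (node w).1 + th0 w).

Let Fixpoint wd t k : seq bool :=
  if k is k'.+1 then rcons (wd t k') (bit t (wd t k')) else [::].

Let branch t k := bit t (wd t k).

Let mkseq_branch t k : mkseq (branch t) k = wd t k.
Proof. by elim: k => // k IH; rewrite mkseqS IH. Qed.

Let size_wd t k : size (wd t k) = k.
Proof. by rewrite -mkseq_branch size_mkseq. Qed.

Let nodeP t k : 0 <= t < m ->
  [/\ (node (wd t k)).1 <= t, t < (node (wd t k)).1 + (node (wd t k)).2 &
      (node (wd t k)).2 <= cw (wd t k)].
Proof.
move=> /andP[t0 tm]; elim: k => [|k [IH1 IH2 IH3]].
  by rewrite /node/= add0r; split=> //; apply: content_mono => //.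
rewrite /= node_rcons; case: (boolP (bit t (wd t k))) => [|].
  rewrite /bit -leNgt /= => h; split => //; first by lra.
  (* If [false] is filled up to its content, subadditivity leaves at most the content of [true];
     otherwise nothing is left. *)
  have := cw_split (wd t k); rewrite /th0 minEle; case: ifP => h'; last by lra.
  by move=> _; rewrite subrr; exact: content_ge0.
by rewrite /bit negbK/= => h; split => //; rewrite /th0 ge_min lexx orbT.
Qed.

Let measurable_bit w b : measurable [set t : measurableTypeR R | bit t w = b].
Proof.
have -> : [set t | bit t w = b] =
    if b then `[(node w).1 + th0 w, +oo[%classic else `]-oo, (node w).1 + th0 w[%classic.
  apply/seteqP; split=> t; rewrite /bit; case: b => /=;
    rewrite in_itv/= ?andbT ?leNgt.
  - by move=> ->.
  - by move=> /negbFE.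
  - by move=> ->.
  - by move=> ->.
by case: b; exact: measurable_itv.
Qed.

Let measurable_wd k w : measurable [set t : measurableTypeR R | wd t k = w].
Proof.
elim: k w => [|k IH] w.
  have [->|w0] := eqVneq w [::].
    by rewrite (_ : [set _ | _] = setT)//; apply/seteqP; split.
  rewrite (_ : [set _ | _] = set0)//; apply/seteqP; split=> // t /= /esym h.
  by rewrite h eqxx in w0.
case/lastP: w => [|v b].
  rewrite (_ : [set _ | _] = set0)//; apply/seteqP; split=> // t /= h.
  by have := congr1 size h; rewrite size_rcons.
rewrite (_ : [set _ | _] = [set t | wd t k = v] `&` [set t | bit t v = b]).
  by apply: measurableI.
apply/seteqP; split=> t /=.
  by move=> /rcons_inj[-> h]; split.
by move=> [-> ->].
Qed.

(* Splitting [0, content K) along the binary tree, each child receiving at most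
   its own content, makes Lebesgue measure flow down to the branches in [K]. *)
Lemma frostman_branch : seq_closed K -> exists f : R -> nat -> bool,
  [/\ forall t, 0 <= t < m -> K (f t),
      forall k, measurable_fun setT (fun t : measurableTypeR R => f t k) &
      forall w, (lebesgue_measure ([set t : R | (0 <= t < m)%R /\
        mkseq (f t) (size w) = w] : set (measurableTypeR R)) <= (rho ^+ size w)%:E)%E].
Proof.
move=> Kcl; exists branch; split.
- move=> t tm; apply: Kcl => k; have [h1 h2 h3] := nodeP k tm.
  (* The interval of the word contains [t], so its length is positive, and the content dominates
     this length. Hence [K] meets every cylinder along the branch. *)
  have : 0 < content rho (K `&` cylinder (wd t k)) by rewrite -/(cw _); lra.
  have [->|/set0P[x [Kx]]] := eqVneq (K `&` cylinder (wd t k)) set0.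
    by rewrite content0// ltxx.
  rewrite /cylinder/= size_wd -mkseq_branch => xt _.
  by exists x => //; apply/agree_mkseq.
- move=> k; apply: (measurable_fun_bool true) => //; rewrite setTI.
  rewrite (_ : _ @^-1` _ = \bigcup_w [set t | wd t k.+1 = rcons w true]).
    by apply: countable_bigcupT_measurable => // w; exact: measurable_wd.
  apply/seteqP; split=> t /=; rewrite /branch.
    by move=> h; exists (wd t k); rewrite /= ?h.
  by move=> [w _ /rcons_inj[]].
- move=> w.
  (* The bound on the length of an interval is known for words on the branch of some [t] only. *)
  have [->|/set0P[t0 [t0m t0w]]] := eqVneq [set t : R | (0 <= t < m)%R /\
        mkseq (branch t) (size w) = w] set0.
    by rewrite measure0 lee_fin exprn_ge0// ltW.
  have [h1 h2 h3] := nodeP (size w) t0m; rewrite -mkseq_branch t0w in h1 h2 h3.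
  pose I := [set` Interval (BLeft (node w).1) (BLeft ((node w).1 + (node w).2))].
  apply: (@le_trans _ _ (lebesgue_measure (I : set (measurableTypeR R)))).
    apply: le_measure; rewrite ?inE.
    - rewrite (_ : [set _ | _] = `[0, m[%classic `&` [set t | wd t (size w) = w]).
        by apply: measurableI => //; exact: measurable_itv.
      by apply/seteqP; split=> t /=; rewrite in_itv/= mkseq_branch.
    - exact: measurable_itv.
    - move=> t [tm tw]; have := nodeP (size w) tm; rewrite -mkseq_branch tw.
      by move=> [h1' h2' _]; rewrite /I /= in_itv/= h1' h2'.
  rewrite /I lebesgue_measure_itv/= lte_fin ltrDl.
  case: ifP => _; last by rewrite lee_fin exprn_ge0// ltW.
  by rewrite -EFinD addrAC subrr add0r lee_fin (le_trans h3).
Qed.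

End flow.

(** * Densities, restrictions, products and images of finite measures *)

Section density.
Context d (T : measurableType d) (R : realType).
Variables (mu : {measure set T -> \bar R}) (f : T -> R).
Hypotheses (mf : measurable_fun setT f) (f0 : forall x, 0 <= f x).
Local Open Scope ereal_scope.

(** The two proofs are arguments, so that the measure structure, which depends on them, can be
    inferred from the term. *)
Definition mdensity of measurable_fun setT f & (forall x, (0 <= f x)%R) :
  set T -> \bar R := fun A => \int[mu]_(x in A) (f x)%:E.

Local Notation nu := (mdensity mf f0).

Let nu0 : nu set0 = 0.
Proof. by rewrite /mdensity integral_set0. Qed.

Let nu_ge0 A : 0 <= nu A.
Proof. by apply: integral_ge0 => x _; rewrite lee_fin. Qed.

Let nu_sigma_additive : semi_sigma_additive nu.
Proof.
move=> /= F mF tF mUF; rewrite /mdensity; apply: cvg_toP.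
  apply: ereal_nondecreasing_is_cvgn => m n mn.
  apply: lee_sum_nneg_natr => // k _ _.
  by apply: integral_ge0 => /= x Fkx; rewrite lee_fin.
rewrite ge0_integral_bigcup//=.
- by apply: measurable_funTS; apply: measurableT_comp.
- by move=> x _; rewrite lee_fin.
Qed.

HB.instance Definition _ := isMeasure.Build _ _ _ nu nu0 nu_ge0 nu_sigma_additive.

Let integral_indic_mdensity (A : set T) : measurable A ->
  \int[nu]_x (\1_A x)%:E = \int[mu]_x ((\1_A x)%:E * (f x)%:E).
Proof.
move=> mA; rewrite integral_indic// setIT /= /mdensity integral_mkcond.
apply: eq_integral => x _; rewrite patchE indicE.
by case: (x \in A); rewrite /= ?mul1e ?mul0e.
Qed.

Import HBNNSimple.

Let integral_nnsfun_mdensity (g : {nnsfun T >-> R}) :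
  \int[nu]_x (g x)%:E = \int[mu]_x ((g x)%:E * (f x)%:E).
Proof.
have mfE : measurable_fun setT (EFin \o f) by exact/measurable_EFinP.
under [LHS]eq_integral do rewrite fimfunE -fsumEFin//.
rewrite [LHS]ge0_integral_fsum//; last 2 first.
  - by move=> r; exact/measurable_EFinP/measurableT_comp.
  - by move=> n x _; rewrite EFinM nnfun_muleindic_ge0.
under [RHS]eq_integral.
  move=> x _; rewrite fimfunE -fsumEFin// muleC ge0_mule_fsumr; last first.
    by move=> r; rewrite EFinM nnfun_muleindic_ge0.
  over.
rewrite [RHS]ge0_integral_fsum//; last 2 first.
  - move=> r; apply: emeasurable_funM => //.
    by apply/measurable_EFinP; apply/measurableT_comp.
  - move=> n x _; apply: mule_ge0; first by rewrite lee_fin.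
    by rewrite EFinM nnfun_muleindic_ge0.
apply: eq_fsbigr => r /[!inE] -[t _ <-].
under [RHS]eq_integral do rewrite muleC EFinM -muleA.
have gt0 : (0 <= g t)%R by [].
under [LHS]eq_integral do rewrite EFinM.
have mi : measurable_fun setT (fun x => (\1_(g @^-1` [set g t]) x)%:E : \bar R).
  by apply/measurable_EFinP.
rewrite !ge0_integralZl//.
- by congr (_ * _); exact: integral_indic_mdensity.
- exact: emeasurable_funM.
- by move=> x _; rewrite mule_ge0 ?lee_fin.
Qed.

Lemma ge0_integral_mdensity (g : T -> \bar R) : measurable_fun setT g ->
  (forall x, 0 <= g x) -> \int[nu]_x g x = \int[mu]_x (g x * (f x)%:E).
Proof.
move=> mg g0; pose g_ := nnsfun_approx measurableT mg.
have mg_ n : measurable_fun setT (EFin \o g_ n) by apply/measurable_EFinP.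
have nd x : nondecreasing_seq (fun n => g_ n x).
  by move=> m n mn; exact/lefP/nd_nnsfun_approx.
have mfE : measurable_fun setT (EFin \o f) by exact/measurable_EFinP.
transitivity (limn (fun n => \int[nu]_x (g_ n x)%:E)).
  rewrite -monotone_convergence//=.
  - by apply: eq_integral => x _; apply/esym/cvg_lim => //; exact: cvg_nnsfun_approx.
  - by move=> n x _; rewrite lee_fin.
  - by move=> x _ m n mn; rewrite lee_fin; exact: nd.
under eq_fun do rewrite integral_nnsfun_mdensity.
rewrite -monotone_convergence//=.
- apply: eq_integral => x _; apply/cvg_lim => //.
  apply: cvgeZr => //; exact: cvg_nnsfun_approx.
- by move=> n; exact: emeasurable_funM (mg_ n) mfE.
- by move=> n x _; rewrite mule_ge0// lee_fin.
- by move=> x _ m n mn; rewrite lee_wpmul2r ?lee_fin//; exact: nd.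
Qed.

Section finite.
Hypothesis foo : \int[mu]_x (f x)%:E < +oo.

Definition mfdensity of \int[mu]_x (f x)%:E < +oo : set T -> \bar R := nu.

HB.instance Definition _ := Measure.on (mfdensity foo).

Let mfdensity_fin : fin_num_fun (mfdensity foo).
Proof.
move=> U mU; rewrite ge0_fin_numE ?measure_ge0//.
apply: le_lt_trans foo; apply: ge0_subset_integral => //.
- by apply/measurable_EFinP.
- by move=> x _; rewrite lee_fin.
Qed.

HB.instance Definition _ := Measure_isFinite.Build _ _ _ (mfdensity foo) mfdensity_fin.

End finite.

End density.

Lemma exists_density d (T : measurableType d) (R : realType)
    (mu : {measure set T -> \bar R}) (f : T -> R) :
  measurable_fun setT f -> (forall x, 0 <= f x) ->
  (\int[mu]_x (f x)%:E < +oo)%E ->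
  exists nu : {finite_measure set T -> \bar R},
    (forall A, nu A = \int[mu]_(x in A) (f x)%:E)%E /\
    forall g : T -> \bar R, measurable_fun setT g -> (forall x, 0 <= g x)%E ->
      (\int[nu]_x g x = \int[mu]_x (g x * (f x)%:E))%E.
Proof.
move=> mf f0 foo; exists (mfdensity mf f0 foo); split=> // g mg g0.
exact: ge0_integral_mdensity.
Qed.

(** The density is the indicator of [D]. This is how Lebesgue measure on a box becomes a finite
    measure in the sense of the structure. *)
Lemma exists_restr d (T : measurableType d) (R : realType)
    (mu : {measure set T -> \bar R}) (D : set T) :
  measurable D -> (mu D < +oo)%E ->
  exists nu : {finite_measure set T -> \bar R},
    (forall A, measurable A -> nu A = mu (A `&` D)) /\
    forall g : T -> \bar R, measurable_fun setT g -> (forall x, 0 <= g x)%E ->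
      (\int[nu]_x g x = \int[mu]_(x in D) g x)%E.
Proof.
move=> mD Doo.
have [|//||nu [nuE nuI]] := @exists_density _ _ _ mu (\1_D : T -> R).
- exact: measurable_indic.
- by rewrite integral_indic// setIT.
exists nu; split=> [A mA|g mg g0]; first by rewrite nuE integral_indic// setIC.
rewrite nuI// [RHS]integral_mkcond; apply: eq_integral => x _.
by rewrite patchE indicE; case: (x \in D); rewrite /= ?mule1 ?mule0.
Qed.

Section finite_product.
Context d1 d2 (T1 : measurableType d1) (T2 : measurableType d2) (R : realType).
Variables (m1 : {finite_measure set T1 -> \bar R}).
Variables (m2 : {finite_measure set T2 -> \bar R}).

Let product_fin : fin_num_fun (m1 \x m2)%E.
Proof.
move=> A mA; rewrite ge0_fin_numE//.
apply: (@le_lt_trans _ _ ((m1 \x m2)%E setT)); first by rewrite le_measure ?inE.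
rewrite -setXTT product_measure1E//.
by rewrite lte_mul_pinfty// ?fin_num_measure// -ge0_fin_numE// fin_num_measure.
Qed.

Definition fprod : set (T1 * T2) -> \bar R := (m1 \x m2)%E.
HB.instance Definition _ := Measure.on fprod.
HB.instance Definition _ := Measure_isFinite.Build _ _ _ fprod product_fin.

End finite_product.

Section bounded.
Context (R : realType).
Implicit Types (M : R).
Lemma bounded_integrable d (T : measurableType d)
    (mu : {finite_measure set T -> \bar R}) (f : T -> R) M :
  measurable_fun setT f -> (forall x, `|f x| <= M) ->
  mu.-integrable setT (EFin \o f).
Proof.
move=> mf fM; apply: measurable_bounded_integrable => //.
  by rewrite -ge0_fin_numE// fin_num_measure.
by exists M; split; rewrite ?num_real// => x Mx y _; exact: le_trans (fM y) (ltW Mx).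
Qed.

Context d1 d2 (T1 : measurableType d1) (T2 : measurableType d2).
Variables (m1 : {finite_measure set T1 -> \bar R}) (m2 : {finite_measure set T2 -> \bar R}).

Lemma bounded_Rintegral d (T : measurableType d)
    (mu : {finite_measure set T -> \bar R}) (f : T -> R) M :
  measurable_fun setT f -> (forall x, `|f x| <= M) ->
  `|\int[mu]_x f x| <= M * fine (mu setT).
Proof.
move=> mf fM; have fi := bounded_integrable mu mf fM.
apply: le_trans (le_normr_Rintegral _ _) _ => //.
have -> : M * fine (mu setT) = \int[mu]_x M by rewrite Rintegral_cst.
apply: le_Rintegral => //.
- apply: (@bounded_integrable _ _ _ _ M); first exact: measurableT_comp.
  by move=> x; rewrite normr_id.
- by apply: (@bounded_integrable _ _ _ _ `|M|).
Qed.

Lemma measurable_Rintegral2 (f : T1 * T2 -> R) M :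
  measurable_fun setT f -> (forall z, `|f z| <= M) ->
  measurable_fun setT (fun x => \int[m2]_y f (x, y)).
Proof.
move=> mf fM; apply: (measurableT_comp (fine_measurable measurableT)).
apply: (@measurable_fubini_F _ _ _ _ _ m1 m2 (EFin \o f)).
exact: (bounded_integrable (fprod m1 m2) mf fM).
Qed.

Lemma Rfubini (f : T1 * T2 -> R) M :
  measurable_fun setT f -> (forall z, `|f z| <= M) ->
  \int[m1]_x \int[m2]_y f (x, y) = \int[m2]_y \int[m1]_x f (x, y).
Proof.
move=> mf fM; have fi := bounded_integrable (fprod m1 m2) mf fM.
rewrite /Rintegral; congr fine.
under eq_integral => x _.
  rewrite fineK; last first.
    apply: integrable_fin_num => //; apply: bounded_integrable => //.
    exact: measurableT_comp (pair1_measurable _).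
  over.
under [RHS]eq_integral => y _.
  rewrite fineK; last first.
    apply: integrable_fin_num => //; apply: bounded_integrable => //.
    exact: measurableT_comp (pair2_measurable _).
  over.
exact: (Fubini fi).
Qed.

End bounded.

Section finite_pushforward.
Context d d' (T : measurableType d) (T' : measurableType d') (R : realType).
Variables (mu : {finite_measure set T -> \bar R}) (f : T -> T').
Hypothesis mf : measurable_fun setT f.

Definition fpushforward of measurable_fun setT f : set T' -> \bar R :=
  pushforward mu f.

Let fpushforward0 : fpushforward mf set0 = 0%E.
Proof. by rewrite /fpushforward /pushforward preimage_set0 measure0. Qed.

Let fpushforward_ge0 A : (0 <= fpushforward mf A)%E.
Proof. exact: measure_ge0. Qed.

Let fpushforward_sigma_additive : semi_sigma_additive (fpushforward mf).
Proof. exact: (@measure_semi_sigma_additive _ _ _ (pushforward mu f)). Qed.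

HB.instance Definition _ := isMeasure.Build _ _ _ (fpushforward mf)
  fpushforward0 fpushforward_ge0 fpushforward_sigma_additive.

Let fpushforward_fin : fin_num_fun (fpushforward mf).
Proof.
move=> A mA; apply: fin_num_measure; rewrite -[_ @^-1` _]setTI; exact: mf.
Qed.

HB.instance Definition _ := Measure_isFinite.Build _ _ _ (fpushforward mf)
  fpushforward_fin.

End finite_pushforward.

Lemma exists_pushforward d d' (T : measurableType d) (T' : measurableType d')
    (R : realType) (mu : {finite_measure set T -> \bar R}) (f : T -> T') :
  measurable_fun setT f ->
  exists nu : {finite_measure set T' -> \bar R},
    (forall A, nu A = mu (f @^-1` A)) /\
    forall g : T' -> \bar R, measurable_fun setT g -> (forall x, 0 <= g x)%E ->
      (\int[nu]_x g x = \int[mu]_x g (f x))%E.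
Proof.
move=> mf; exists (fpushforward mu mf); split=> // g mg g0.
by rewrite ge0_integral_pushforward.
Qed.

(** * Binary expansions *)

Section binary.
Context {R : realType}.
Implicit Types b : nat -> bool.

Fixpoint bin_trunc b k : nat := if k is k'.+1 then 2 * bin_trunc b k' + b k' else 0.

Lemma bin_trunc_lt b k : (bin_trunc b k < 2 ^ k)%N.
Proof. by elim: k => //= k IH; rewrite expnS; case: (b k); lia. Qed.

Lemma bin_trunc_inj b b' k : bin_trunc b k = bin_trunc b' k -> agree k b b'.
Proof.
elim: k => [_ i //|k IH] /= E i; rewrite ltnS leq_eqVlt => /predU1P[->|ik].
  by move: E; case: (b k); case: (b' k); lia.
by apply: IH => //; move: E; case: (b k); case: (b' k); lia.
Qed.

Lemma eq_bin_trunc b b' k : agree k b b' -> bin_trunc b k = bin_trunc b' k.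
Proof.
by elim: k => //= k IH h; rewrite IH ?h// => i ik; apply: h; exact: ltnW.
Qed.

Definition bin_approx b k : R := (bin_trunc b k)%:R / 2 ^+ k.

Lemma bin_approxS b k : bin_approx b k.+1 = bin_approx b k + (b k)%:R / 2 ^+ k.+1.
Proof.
have p0 : (2 : R) ^+ k != 0 by rewrite expf_neq0.
by rewrite /bin_approx /= natrD natrM exprS; field.
Qed.

Lemma bin_approx_le b i j : (i <= j)%N ->
  bin_approx b i <= bin_approx b j <= bin_approx b i + (2 ^+ i)^-1 - (2 ^+ j)^-1.
Proof.
move=> /subnK <-; elim: (j - i)%N => [|k /andP[IH1 IH2]].
  by rewrite add0n addrK lexx.
rewrite addSn bin_approxS exprS; set p := 2 ^+ (k + i) in IH1 IH2 *.
have p0 : 0 < p^-1 by rewrite invr_gt0 exprn_gt0.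
rewrite invfM; case: (b _); rewrite ?mul1r ?mul0r; lra.
Qed.

Definition bin b : R := sup (range (bin_approx b)).

Lemma bin_bounds b k : bin_approx b k <= bin b <= bin_approx b k + (2 ^+ k)^-1.
Proof.
have ub : ubound (range (bin_approx b)) (bin_approx b k + (2 ^+ k)^-1).
  move=> _ [j _ <-]; have [kj|/ltnW jk] := leqP k j.
    have /andP[_] := bin_approx_le b kj.
    have : 0 < ((2 : R) ^+ j)^-1 by rewrite invr_gt0 exprn_gt0.
    lra.
  have /andP[+ _] := bin_approx_le b jk.
  have : 0 < ((2 : R) ^+ k)^-1 by rewrite invr_gt0 exprn_gt0.
  lra.
apply/andP; split; first by apply: sup_ubound; [exists (bin_approx b k + (2 ^+ k)^-1)|exists k].
by apply: sup_le_ub => //; exists (bin_approx b 0); exists 0%N.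
Qed.

(** Greedy digits: a digit is 1 whenever the approximation then still stays below [v]. *)
Lemma bin_surj v : 0 <= v < 1 -> exists b, bin b = v.
Proof.
move=> /andP[v0 v1].
pose fix ap k : R := if k is k'.+1 then
  ap k' + (ap k' + (2 ^+ k)^-1 <= v)%R%:R / 2 ^+ k else 0.
pose b k := ap k + (2 ^+ k.+1)^-1 <= v.
have apE k : ap k = bin_approx b k.
  elim: k => [|k IH]; first by rewrite /bin_approx/= mul0r.
  by rewrite bin_approxS -IH.
have h k : ap k <= v < ap k + (2 ^+ k)^-1.
  elim: k => [|k IH]; first by rewrite /= add0r expr0 invr1 v0.
  rewrite apE bin_approxS -apE; case/andP: IH => IH1 IH2.
  rewrite /b exprS invfM; case: (leP (ap k + 2^-1 * (2 ^+ k)^-1) v) => h1 /=;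
    rewrite ?mul1r ?mul0r; apply/andP; split; lra.
exists b; apply/eqP; rewrite -subr_eq0 -normr_le0.
apply/ler_addgt0Pr => e e0; rewrite add0r.
have [k ke] : exists k : nat, (2 ^+ k)^-1 < e.
  have [k _ /(_ k (leqnn k)) ke] := near_infty_natSinv_lt (PosNum e0).
  exists k; apply: le_lt_trans ke; rewrite lef_pV2 ?posrE ?exprn_gt0//.
  by rewrite -natrX ler_nat ltn_expl.
have := h k; have := bin_bounds b k; rewrite -apE ler_norml; lra.
Qed.

End binary.

Section expansion.
Context {R : realType} {n : nat}.
Implicit Types (z u : 'rV[R]_n) (b : nat -> bool).

(** The coordinates share one sequence in turn, so that its first k * n letters determine a cube of
    side 2^-k. *)
Definition digits b (i : 'I_n) : nat -> bool := fun k => b (k * n + i)%N.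

Definition expand z b : 'rV[R]_n := \row_i (z 0 i + bin (digits b i)).

Lemma agree_digits b b' k i : agree (k * n) b b' -> agree k (digits b i) (digits b' i).
Proof.
move=> h j jk; apply: h; apply: (@leq_trans (j.+1 * n)); last by rewrite leq_mul2r jk orbT.
by rewrite mulSn addnC ltn_add2r.
Qed.

Lemma digits_agree b b' k : (forall i, agree k (digits b i) (digits b' i)) ->
  agree (k * n) b b'.
Proof.
move=> h j jk; have n0 : (0 < n)%N by case: n jk => //; rewrite muln0.
have := h (Ordinal (ltn_pmod j n0)) (j %/ n)%N.
by rewrite /digits/= -divn_eq; apply; rewrite ltn_divLR.
Qed.

Lemma expand_continuous z (U : set 'rV[R]_n) b : open U -> U (expand z b) ->
  exists k, forall b', agree k b b' -> U (expand z b').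
Proof.
move=> oU Ub; have /nbhs_ballP[e /= e0 eU] : nbhs (expand z b) U by exact: open_nbhs_nbhs.
have [k ke] : exists k : nat, (2 ^+ k)^-1 < e.
  have [k _ /(_ k (leqnn k)) ke] := near_infty_natSinv_lt (PosNum e0).
  exists k; apply: le_lt_trans ke; rewrite lef_pV2 ?posrE ?exprn_gt0//.
  by rewrite -natrX ler_nat ltn_expl.
exists (k * n)%N => b' bb'; apply: eU; split=> // i j; rewrite !mxE.
rewrite /ball/= opprD addrACA subrr add0r.
have := @bin_bounds R (digits b j) k; have := @bin_bounds R (digits b' j) k.
rewrite /bin_approx (eq_bin_trunc (agree_digits j bb')) ltr_norml.
by move=> /andP[? ?] /andP[? ?]; apply/andP; split; lra.
Qed.

Lemma cvg_bin_approx b : @bin_approx R b @ \oo --> (bin b : R).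
Proof.
apply: (@squeeze_cvgr _ _ _ _ (fun k => bin b - (2^-1) ^+ k) (fun=> bin b)).
- near=> k; have := @bin_bounds R b k; rewrite exprVn; lra.
- rewrite -[X in _ --> X]subr0; apply: cvgB; first exact: cvg_cst.
  by apply: cvg_expr; rewrite ger0_norm; lra.
- exact: cvg_cst.
Unshelve. all: by end_near.
Qed.

(** The cells are closed: a coordinate with two expansions lies in the cells of both. *)
Definition in_cell k z (q : {ffun 'I_n -> 'I_(2 ^ k)}) u :=
  forall i, z 0 i + (q i)%:R / 2 ^+ k <= u 0 i <= z 0 i + (q i).+1%:R / 2 ^+ k.

Definition cell_index k b : {ffun 'I_n -> 'I_(2 ^ k)} :=
  [ffun i => Ordinal (bin_trunc_lt (digits b i) k)].

Lemma expand_in_cell k z b : in_cell z (cell_index k b) (expand z b).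
Proof.
move=> i; have := @bin_bounds R (digits b i) k; rewrite /bin_approx ffunE mxE/=.
rewrite -(natr1 (bin_trunc _ _)) mulrDl mul1r => /andP[? ?]; apply/andP; split; lra.
Qed.

Lemma cell_index_inj k b b' : cell_index k b = cell_index k b' -> agree (k * n) b b'.
Proof.
move=> E; apply: digits_agree => i; apply: bin_trunc_inj.
by have /(congr1 val) := congr1 (fun f : {ffun _ -> _} => f i) E; rewrite !ffunE.
Qed.

(** A continuous image of a compact set: preimages of points close to [y] accumulate at a point of
    [K], by [konig]. *)
Lemma closed_cantor_image m (g : (nat -> bool) -> 'rV[R]_m) (K : set (nat -> bool)) :
  (forall (U : set 'rV[R]_m) b, open U -> U (g b) ->
    exists k, forall b', agree k b b' -> U (g b')) ->
  seq_closed K -> closed (g @` K).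
Proof.
move=> gC Kcl y yK.
have /choice[b hb] : forall k : nat, exists b, K b /\ ball y k.+1%:R^-1 (g b).
  move=> k; have k0 : (0 : R) < k.+1%:R^-1 by rewrite invr_gt0.
  have [_ [[b Kb <-] yb]] := yK _ (nbhsx_ballx y _ k0).
  by exists b.
have [|f hf] := @konig bool b (fun=> [:: true; false]).
  by move=> k i _; rewrite !inE; case: (b k i).
exists f.
  by apply: Kcl => k; have [j _ fj] := hf k 0%N; exists (b j) => //; have [] := hb j.
apply/rowP => i; apply/eqP; rewrite -subr_eq0 -normr_le0.
apply/ler_addgt0Pr => e e0; rewrite add0r.
have e20 : 0 < e / 2 by rewrite divr_gt0.
have [k hk] := gC (ball (g f) (e / 2))° f (open_interior _) (nbhsx_ballx _ _ e20).
have [N _ /(_ N (leqnn N)) Ne] := near_infty_natSinv_lt (PosNum e20).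
have [j Nj fj] := hf k N.
have /interior_subset h1 := hk _ fj; have [_ h2] := hb j.
have h3 : ball y (e / 2) (g (b j)).
  apply: le_ball h2; apply: le_trans (ltW Ne).
  by rewrite lef_pV2 ?posrE// ler_nat ltnS.
have [_ /(_ 0 i)] := ball_splitr (ball_sym h1) (ball_sym h3).
by rewrite /ball/= => /ltW.
Qed.

(** The last clause is the Frostman condition, mass at most rho^(k n) for each cell, in integrated
    form: a kernel that varies little over a cell is bounded there by a constant. Faces shared by
    closed cells then do no harm. *)
Lemma frostman_measure (rho : R) z (E : set 'rV[R]_n) :
  0 < rho -> 1 / 2 <= rho -> rho <= 1 ->
  measurable (E : set (borel_mx R 1 n)) -> 0 < content rho (expand z @^-1` E) ->
  exists mu : {finite_measure set (borel_mx R 1 n) -> \bar R},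
    [/\ (0 < mu setT)%E,
      exists K, [/\ seq_closed K, expand z @` K `<=` E & mu (~` (expand z @` K)) = 0%E] &
    forall k (g : borel_mx R 1 n -> \bar R) (M : {ffun 'I_n -> 'I_(2 ^ k)} -> R),
      measurable_fun setT g -> (forall u, 0 <= g u)%E -> (forall q, 0 <= M q) ->
      (forall q u, in_cell z q u -> g u <= (M q)%:E)%E ->
      (\int[mu]_u g u <= (rho ^+ (k * n) * \sum_q M q)%:E)%E].
Proof.
move=> rho0 rho2 rho1 mE cE.
have anE : analytic (expand z @^-1` E).
  by apply: analytic_borel_preimage mE => U x oU; exact: expand_continuous.
have c2 : content rho (expand z @^-1` E) / 2 < content rho (expand z @^-1` E) by lra.
have [K [Kcl KE tK]] := analytic_inner_closed rho0 rho2 anE c2.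
have m0 : 0 < content rho K by lra.
have [f [fK fm fmass]] := frostman_branch rho0 rho2 rho1 Kcl.
set m := content rho K in m0 fK fmass.
have md i : forall k, measurable_fun setT
    (fun t : measurableTypeR R => (bin_trunc (digits (f t) i) k)%:R : R).
  elim=> [|k IH] /=; first exact: measurable_cst.
  under eq_fun do rewrite natrD natrM.
  apply: measurable_funD; first exact: measurable_funM.
  rewrite (_ : (fun _ => _) = (fun b : bool => b%:R : R) \o (fun t => f t (k * n + i)%N)) //.
  exact: measurableT_comp.
have mPhi : measurable_fun setT
    ((fun t => expand z (f t)) : measurableTypeR R -> borel_mx R 1 n).
  apply: measurable_fun_mx => i j; rewrite (ord1 i).
  under eq_fun do rewrite mxE.
  apply: measurable_funD => //.
  apply: (measurable_fun_cvg (h := fun k t => bin_approx (digits (f t) j) k)).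
    by move=> k; apply: measurable_funM => //; exact: md.
  by move=> t _; exact: cvg_bin_approx.
have mI : measurable (`[0, m[%classic : set (measurableTypeR R)) by exact: measurable_itv.
have Ilty : (@lebesgue_measure R `[0%R, m[%classic < +oo)%E.
  by rewrite lebesgue_measure_itv/=; case: ifP => _; rewrite ltry.
have [nu [nuE nuI]] := exists_restr mI Ilty.
have [mu [muE muI]] := exists_pushforward nu mPhi.
exists mu; split.
- rewrite muE preimage_setT nuE// setTI => /=; by rewrite lebesgue_measure_itv/= lte_fin m0 sube0 lte_fin.
- exists K; split=> //; first by move=> _ [b /KE Eb <-].
  have mD : measurable (~` (expand z @` K) : set (borel_mx R 1 n)).
    apply: sub_sigma_algebra; apply: closed_openC.
    by apply: closed_cantor_image => // U b; exact: expand_continuous.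
  rewrite muE nuE.
    rewrite (_ : _ `&` _ = set0) ?measure0//; apply/seteqP; split=> // t [/= nE].
    by rewrite in_itv/= => /fK Kt; apply: nE; exists (f t).
  by rewrite -[_ @^-1` _]setTI; apply: mPhi.
move=> k g M mg g0 M0 gM.
(* Each [t] is charged to the cell named by its digits, so no mass is counted twice. *)
pose q t := cell_index k (f t).
have mq q0 : measurable ([set t | q t = q0] : set (measurableTypeR R)).
  rewrite (_ : [set _ | _] = \bigcap_(i : 'I_n) ((fun t : measurableTypeR R =>
     (bin_trunc (digits (f t) i) k)%:R : R) @^-1` [set (q0 i)%:R])).
    apply: fin_bigcap_measurable => // i _; rewrite -[_ @^-1` _]setTI.
    exact: (md i k).
  apply/seteqP; split=> t /=.
    by move=> <- i _ /=; rewrite ffunE.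
  move=> h; apply/ffunP => i; apply/val_inj; rewrite ffunE/=.
  by have /= /eqP := h i I; rewrite eqr_nat => /eqP.
rewrite muI// nuI//; last first.
  by apply: measurableT_comp mPhi.
apply: (@le_trans _ _ (\int[@lebesgue_measure R]_(t in `[0%R, m[)
   \sum_q0 (M q0)%:E * (\1_[set t | q t = q0] t)%:E)%E).
  apply: ge0_le_integral => //.
  - exact: measurable_funTS (measurableT_comp mg mPhi).
  - apply: emeasurable_sum => q0; apply: measurable_funTS.
    exact/measurable_funeM/measurable_EFinP/measurable_indic.
  - move=> t tm; rewrite (bigD1 (q t))//= indicE mem_set// mule1 -[leLHS]adde0.
    apply: leeD; first by apply: gM; exact: expand_in_cell.
    by apply: sume_ge0 => i _; rewrite mule_ge0// lee_fin.
rewrite ge0_integral_sum//; last 2 first.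
- move=> q0; apply: measurable_funTS.
  exact/measurable_funeM/measurable_EFinP/measurable_indic.
- by move=> i t _; rewrite mule_ge0// lee_fin.
rewrite EFinM -sumEFin ge0_sume_distrr; last by move=> i _; rewrite lee_fin.
apply: lee_sum => q0 _; rewrite ge0_integralZl//; last 2 first.
- apply: measurable_funTS; exact/measurable_EFinP/measurable_indic.
- by rewrite lee_fin.
rewrite muleC lee_wpmul2r ?lee_fin// integral_indic//.
have [->|/set0P[t0 [t0q t0m]]] := eqVneq ([set t | q t = q0] `&` `[0, m[%classic) set0.
  by rewrite measure0 lee_fin exprn_ge0// ltW.
have := fmass (mkseq (f t0) (k * n)); rewrite size_mkseq; apply: le_trans.
apply: le_measure; rewrite ?inE.
- exact: measurableI.
- rewrite (_ : [set t | _] = `[0, m[%classic `&` \bigcap_(j in `I_(k * n))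
      ((fun t : measurableTypeR R => f t j) @^-1` [set f t0 j])).
    apply: measurableI => //; apply: fin_bigcap_measurable => [|j _]; first exact: finite_II.
    by rewrite -[_ @^-1` _]setTI; exact: fm.
  apply/seteqP; split=> t /=; rewrite in_itv/=.
    by move=> [tm /agree_mkseq h]; split=> // j jk /=; exact: h.
  by move=> [tm h]; split=> //; apply/agree_mkseq => j jk; exact: h.
- move=> t [/= tq]; rewrite in_itv/= => tm; split=> //.
  by apply/agree_mkseq/cell_index_inj; rewrite -/(q t) tq.
Qed.

End expansion.

(** * Hausdorff measure and the binary content *)

Section hausdorff_null.
Context {R : realType} {n : nat}.
Implicit Types (u x z : 'rV[R]_n) (A : set 'rV[R]_n).

Lemma sqr_coord_le_edot u i : u 0 i ^+ 2 <= edot u u.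
Proof.
rewrite /edot (bigD1 i)//= -expr2 lerDl; apply: sumr_ge0 => j _.
by rewrite -expr2 sqr_ge0.
Qed.

Lemma coord_le_enorm u i : `|u 0 i| <= enorm u.
Proof. by rewrite -sqrtr_sqr ler_wsqrtr// sqr_coord_le_edot. Qed.

Lemma enorm_le_sum u : enorm u <= \sum_i `|u 0 i|.
Proof.
rewrite -(ger0_norm (sumr_ge0 _ (fun i _ => normr_ge0 (u 0 i)))) -sqrtr_sqr.
apply: ler_wsqrtr; rewrite expr2 mulr_suml; apply: ler_sum => i _.
rewrite -expr2 -real_normK ?num_real// expr2 ler_wpM2l//.
by rewrite (bigD1 i)//= lerDl sumr_ge0.
Qed.

Lemma enorm_le u (M : R) : (forall i, `|u 0 i| <= M) -> enorm u <= n%:R * M.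
Proof.
move=> uM; apply: le_trans (enorm_le_sum u) _.
apply: (@le_trans _ _ (\sum_(i < n) M)); first exact: ler_sum.
by rewrite sumr_const card_ord mulr_natl.
Qed.

Lemma hausdorff_premeasure_ge0 s delta A : (0 <= hausdorff_premeasure s delta A)%E.
Proof.
apply: le_ereal_inf_tmp => _ [U _ <-]; apply: nneseries_ge0 => k _ _.
by rewrite /diam_pow; case: ifP => // _; exact: poweR_ge0.
Qed.

Variables (s rho : R).
Hypotheses (s_gt0 : 0 < s) (rho_gt0 : 0 < rho) (rho_le1 : rho <= 1).
Hypotheses (n_gt0 : (0 < n)%N) (rhoE : rho ^+ n = 2 `^ (- s)).

Let halfpow k : ((2 : R) ^+ k)^-1 `^ s = rho ^+ (n * k).
Proof.
rewrite exprM rhoE -powR_invn// -powRrM mulNr -mulrN mulrC powRrM.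
by rewrite powR_mulrn// powR_ge0.
Qed.

(** The diameter of a cube is bounded by n times its side, which gives n^s. The factor rho^-n pays
    for words whose length is not a multiple of n. *)
Let C : R := n%:R `^ s * (rho ^+ n)^-1.

Lemma diameter_expand_cylinder z w :
  (diameter (expand z @` cylinder w) <= (n%:R / 2 ^+ (size w %/ n))%:E)%E.
Proof.
apply: ge_ereal_sup => _ [->|[_ [b bw <-] [_ [b' b'w <-] <-]]].
  by rewrite lee_fin divr_ge0// exprn_ge0.
rewrite lee_fin; apply: enorm_le => i; rewrite !mxE.
have bb' : agree (size w) b b' by apply/agree_mkseq; rewrite bw b'w.
have {}bb' := agree_digits i (agreeW (leq_trunc_div _ _) bb').
have := @bin_bounds R (digits b i) (size w %/ n).
have := @bin_bounds R (digits b' i) (size w %/ n).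
rewrite /bin_approx (eq_bin_trunc bb') => /andP[? ?] /andP[? ?].
by rewrite ler_norml; apply/andP; split; lra.
Qed.

Let cell_pow k : (n%:R / 2 ^+ (k %/ n)) `^ s <= C * rho ^+ k :> R.
Proof.
rewrite powRM// ?invr_ge0 ?exprn_ge0// halfpow /C -mulrA ler_wpM2l ?powR_ge0//.
rewrite mulrC ler_pdivlMr ?exprn_gt0// -exprD ler_wiXn2l?(ltW rho_gt0)//.
by rewrite [X in (X <= _)%N](divn_eq k n) mulnC leq_add2l ltnW// ltn_pmod.
Qed.

(* Countably many translated binary cubes cover R^n, so content zero in each
   of them is enough. *)
Lemma hausdorff_null A :
  (forall z e, 0 < e -> exists V : set (seq bool),
    expand z @^-1` A `<=` \bigcup_(w in V) cylinder w /\
    forall ws : seq (seq bool), uniq ws -> (forall w, w \in ws -> V w) ->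
      \sum_(w <- ws) rho ^+ size w <= e) ->
  hausdorff_measure s A = 0%E.
Proof.
move=> hA.
have C0 : 0 < C.
  by rewrite /C divr_gt0 ?exprn_gt0// powR_gt0 ?ltr0n.
suff pre0 delta : 0 < delta -> hausdorff_premeasure s delta A = 0%E.
  rewrite /hausdorff_measure.
  rewrite (_ : [set _ | _ in _] = [set 0%E]) ?ereal_sup1//.
  apply/seteqP; split=> [_ [d /= d0 <-]|_ ->]; first exact: pre0.
  by exists 1; [exact: ltr01|exact: pre0].
move=> d0; apply/eqP; rewrite eq_le hausdorff_premeasure_ge0 andbT.
apply/lee_addgt0Pr => e e0; rewrite add0e.
(* Each piece of the cover will have cost at most [e']; the bound delta^s then forces its diameter
   below [delta]. *)
pose e' := Num.min e (delta `^ s).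
have e'0 : 0 < e' by rewrite lt_min e0 powR_gt0.
pose zz m : 'rV[R]_n := if unpickle m is Some q
  then map_mx intr (q : 'rV[int]_n) else 0.
pose ee m : R := e' / C / 2 ^+ m.+1.
have ee0 m : 0 < ee m.
  by apply: divr_gt0; [exact: divr_gt0|exact: exprn_gt0].
have /choice[V hV] : forall m, exists V : set (seq bool),
    expand (zz m) @^-1` A `<=` \bigcup_(w in V) cylinder w /\
    forall ws : seq (seq bool), uniq ws -> (forall w, w \in ws -> V w) ->
      \sum_(w <- ws) rho ^+ size w <= ee m.
  by move=> m; exact: hA.
(* Pairs (translate, word) are enumerated by their codes. All other indices receive the empty set,
   which contributes 0 even to the sum. *)
pose U k : set 'rV[R]_n := if pickle_inv k is Some (m, w) then
  (if `[< V m w >] then expand (zz m) @` cylinder w else set0) else set0.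
pose a (p : nat * seq bool) : R := if `[< V p.1 p.2 >] then C * rho ^+ size p.2 else 0.
have a0 p : 0 <= a p.
  by rewrite /a; case: ifP => // _; rewrite mulr_ge0 ?(ltW C0)// exprn_ge0// ltW.
have UV m w : V m w -> C * rho ^+ size w <= e'.
  move=> Vw; have := (hV m).2 [:: w] isT; rewrite big_seq1 => h.
  have {}h : rho ^+ size w <= ee m by apply: h => v; rewrite inE => /eqP ->.
  rewrite mulrC -ler_pdivlMr//; apply: le_trans h _.
  rewrite ler_pdivrMr ?exprn_gt0// ler_peMr ?exprn_ege1 ?ler1n//.
  exact/ltW/divr_gt0.
apply: (@le_trans _ _ (\sum_(0 <= k <oo) diam_pow s (U k))%E).
  apply: ereal_inf_lbound; exists U => //; split.
    move=> k; rewrite /U; case: pickle_inv => [[m w]|]; last first.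
      by rewrite /diameter; apply: ge_ereal_sup => _ [->|[x []]//]; rewrite lee_fin ltW.
    case: asboolP => [Vw|_]; last first.
      by rewrite /diameter; apply: ge_ereal_sup => _ [->|[x []]//]; rewrite lee_fin ltW.
    apply: le_trans (diameter_expand_cylinder _ _) _; rewrite lee_fin.
    rewrite leNgt; apply/negP => h.
    have := cell_pow (size w); apply/negP; rewrite -ltNge.
    apply: le_lt_trans (UV _ _ Vw) _; apply: (@le_lt_trans _ _ (delta `^ s)).
      by rewrite ge_min lexx orbT.
    by apply: gt0_ltr_powR => //; rewrite nnegrE ?ltW// (lt_trans d0 h).
  move=> x Ax.
  (* The integer parts select the translate, and the digits of the fractional parts are interleaved
     into [B]. *)
  pose q : 'rV[int]_n := \row_i Num.floor (x 0 i).
  have /choice[b hb] : forall i : 'I_n, exists b, bin b = x 0 i - (q 0 i)%:~R :> R.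
    move=> i; apply: bin_surj; rewrite mxE subr_ge0 ltrBlDl.
    by rewrite floor_le/= -[X in _ + X]/(1%:~R) -intrD floorD1_gt.
  pose B j := if insub (j %% n)%N is Some i then b i (j %/ n)%N else false.
  have xE : expand (zz (pickle q)) B = x.
    apply/rowP => i; rewrite !mxE /zz pickleK mxE.
    suff -> : digits B i = b i by rewrite hb addrC subrK.
    apply/funext => k; rewrite /digits /B modnMDl modn_small// valK.
    by rewrite divnMDl// divn_small// addn0.
  have [w Vw Bw] : (\bigcup_(w in V (pickle q)) cylinder w) B.
    by apply: (hV _).1; rewrite /preimage/= xE.
  exists (pickle (pickle q, w)) => //; rewrite /U pickleK_inv asboolT//.
  by exists B.
apply: lime_le; first by apply: is_cvg_nneseries => k _ _;
  rewrite /diam_pow; case: ifP => // _; exact: poweR_ge0.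
apply: nearW => N.
pose ps := pmap pickle_inv (iota 0 N) : seq (nat * seq bool).
have ups : uniq ps.
  by apply: (pmap_uniq (@pickle_invK _)); exact: iota_uniq.
apply: (@le_trans _ _ (\sum_(p <- ps) a p)%:E).
  rewrite -sumEFin big_pmap /index_iota subn0.
  apply: lee_sum => k _; rewrite /U.
  case: pickle_inv => [[m w]|]; last by rewrite /diam_pow eqxx.
  rewrite /a/=; case: asboolP => [Vw|_]; last by rewrite /diam_pow eqxx.
  rewrite /diam_pow; case: ifP => _.
    by rewrite lee_fin mulr_ge0 ?(ltW C0)// exprn_ge0// ltW.
  apply: (@le_trans _ _ (poweR (n%:R / 2 ^+ (size w %/ n))%:E s)).
    apply: gt0_ler_poweR; rewrite ?(ltW s_gt0) ?in_itv/= ?leey//.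
    - by rewrite andbT; apply: ereal_sup_ubound; left.
    - by rewrite andbT lee_fin divr_ge0// exprn_ge0.
    - exact: diameter_expand_cylinder.
  by rewrite poweR_EFin lee_fin.
rewrite lee_fin; pose L := \max_(p <- ps) p.1.+1.
apply: (@le_trans _ _ (\sum_(m < L) e' / 2 ^+ m.+1)); last first.
  apply: (@le_trans _ _ (e' * (1 - (2 ^+ L)^-1))).
    elim: (L) => [|k IH]; first by rewrite big_ord0 expr0 invr1 subrr mulr0.
    rewrite big_ord_recr/=; apply: le_trans (lerD IH (lexx _)) _.
    by rewrite exprS invfM; lra.
  have : e' <= e by rewrite ge_min lexx.
  have : 0 < e' * (2 ^+ L)^-1 by rewrite divr_gt0// exprn_gt0.
  by lra.
have -> : \sum_(p <- ps) a p =
    \sum_(p <- ps) \sum_(m < L | p.1 == m :> nat) a p.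
  rewrite big_seq [RHS]big_seq; apply: eq_bigr => p pps.
  have pL : (p.1 < L)%N.
    exact: (@leq_bigmax_seq _ ps (fun=> true) (fun p => p.1.+1)).
  by rewrite (big_pred1 (Ordinal pL)).
rewrite (exchange_big_dep xpredT)//=; apply: ler_sum => m _.
pose ws := [seq p.2 | p <- ps & (p.1 == m :> nat) && `[< V p.1 p.2 >]].
have uws : uniq ws.
  rewrite map_inj_in_uniq ?filter_uniq// => -[m1 w1] [m2 w2].
  rewrite !mem_filter /= => /andP[/andP[/eqP-> _] _] /andP[/andP[/eqP-> _] _].
  by move=> ->.
have Vws w : w \in ws -> V m w.
  move=> /mapP[[m' w'] /=]; rewrite mem_filter/= => /andP[/andP[/eqP-> /asboolP]].
  by move=> + _ ->.
have := (hV m).2 ws uws Vws; rewrite big_map big_filter.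
rewrite -(ler_pM2l C0) mulr_sumr => h.
rewrite (_ : e' / 2 ^+ m.+1 = C * ee m); last first.
  by rewrite /ee mulrA mulrCA mulfV ?mulr1// gt_eqF.
apply: le_trans h; rewrite big_mkcondr.
by apply: ler_sum => p _; rewrite /a.
Qed.

End hausdorff_null.

Section frostman.
Context {R : realType} {n : nat}.
Hypothesis n_gt0 : (0 < n)%N.
Implicit Types (s : R) (E : set 'rV[R]_n).

(** With this price, n letters, one for each coordinate, cost 2^-s: the effect of halving the side
    on its s-th power. *)
Let ratio s : R := 2 `^ (- s / n%:R).

Let ratioE s : ratio s ^+ n = 2 `^ (- s).
Proof.
rewrite /ratio -powR_mulrn ?powR_ge0// -powRrM divfK//.
by rewrite pnatr_eq0 -lt0n.
Qed.

Let ratio_gt0 s : 0 < ratio s.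
Proof. by rewrite powR_gt0. Qed.

Let ratio_le1 s : 0 < s -> ratio s <= 1.
Proof.
move=> s0; rewrite -(powRr0 2) ler_powR ?ler1n//.
by rewrite mulNr oppr_le0 divr_ge0// ltW.
Qed.

Lemma size_uniq_words (ws : seq (seq bool)) j :
  uniq ws -> (forall w, w \in ws -> size w = j) -> (size ws <= 2 ^ j)%N.
Proof.
move=> uws sws.
have -> : (2 ^ j = size [seq val t | t <- enum {: j.-tuple bool}])%N.
  by rewrite size_map -cardE card_tuple card_bool.
apply: uniq_leq_size => // w /sws/eqP sw.
by apply/mapP; exists (Tuple sw) => //; rewrite mem_enum.
Qed.

(** The 2^j words of length j cost (2 * ratio s)^j in all, which tends to 0 when s exceeds n. *)
Lemma hausdorff_measure_gt_dim s E : n%:R < s -> hausdorff_measure s E = 0%E.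
Proof.
move=> ns; have s0 : 0 < s by apply: le_lt_trans ns; rewrite ler0n.
apply: (hausdorff_null s0 (ratio_gt0 s) (ratio_le1 s0) n_gt0 (ratioE s)) => z e e0.
have r1 : 0 <= 2 * ratio s < 1.
  rewrite mulr_ge0 ?(ltW (ratio_gt0 _))//=.
  rewrite -[X in X * _](powRr1 (ler0n _ _)) -powRD; last by rewrite pnatr_eq0 implybT.
  rewrite -[X in _ < X](powRr0 2) /powR pnatr_eq0/= ltr_expR ltr_pM2r ?ln_gt0 ?ltr1n//.
  by rewrite mulNr -ltrBrDr sub0r opprK ltr_pdivlMr ?ltr0n// mul1r.
have [j je] : exists j, (2 * ratio s) ^+ j <= e.
  have /cvgrPdist_le/(_ _ e0)[j _ /(_ j (leqnn j))] :
      (fun k => (2 * ratio s) ^+ k) @ \oo --> (0 : R).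
    by apply: cvg_expr; case/andP: r1 => r1 ?; rewrite ger0_norm.
  rewrite sub0r normrN => /(le_trans (ler_norm _)) h; by exists j.
exists [set w | size w = j]; split.
  move=> x _; exists (mkseq x j); first by rewrite /= size_mkseq.
  by rewrite /cylinder/= size_mkseq.
move=> ws uws sws; apply: le_trans je.
rewrite exprMn big_seq (eq_bigr (fun=> ratio s ^+ j)); last by move=> w /sws ->.
rewrite -big_seq big_const_seq count_predT iter_addr_0 -(mulr_natl (ratio s ^+ j)).
rewrite ler_wpM2r ?exprn_ge0 ?(ltW (ratio_gt0 _))// -natrX ler_nat.
exact: size_uniq_words.
Qed.

Lemma hausdorff_measure_neq0 s E : 0 <= s -> (s%:E < hausdorff_dim E)%E ->
  hausdorff_measure s E != 0%E.
Proof.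
move=> s0 sE; apply/eqP => h; move: sE; apply/negP; rewrite -leNgt.
by apply: ereal_inf_lbound; exists s.
Qed.

Lemma frostman s E : 0 < s -> (s%:E < hausdorff_dim E)%E ->
  measurable (E : set (borel_mx R 1 n)) ->
  [/\ s <= n%:R &
  exists (z : 'rV[R]_n) (mu : {finite_measure set (borel_mx R 1 n) -> \bar R}),
    [/\ (0 < mu setT)%E,
      exists K, [/\ seq_closed K, expand z @` K `<=` E & mu (~` (expand z @` K)) = 0%E] &
    forall k (g : borel_mx R 1 n -> \bar R) (M : {ffun 'I_n -> 'I_(2 ^ k)} -> R),
      measurable_fun setT g -> (forall u, 0 <= g u)%E -> (forall q, 0 <= M q) ->
      (forall q u, in_cell z q u -> g u <= (M q)%:E)%E ->
      (\int[mu]_u g u <= (2 `^ (- s) ^+ k * \sum_q M q)%:E)%E]].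
Proof.
move=> s0 sE mE; have sn : s <= n%:R.
  rewrite leNgt; apply/negP => ns; have /eqP := hausdorff_measure_gt_dim E ns.
  by apply/negP/hausdorff_measure_neq0 => //; exact: ltW.
split=> //.
(* This is s <= n, in the form in which the content requires it. *)
have r2 : 1 / 2 <= ratio s.
  rewrite mul1r -(powR_inv1 (ler0n _ _)) ler_powR ?ler1n//.
  by rewrite mulNr lerN2 ler_pdivrMr ?mul1r// ltr0n.
(* If the content vanished for every [z], [content_lt_cover] would give covers of arbitrarily small
   cost, and [hausdorff_null] would give measure zero. *)
suff [z cz] : exists z, 0 < content (ratio s) (expand z @^-1` E).
  have [mu [mu0 muE muI]] := frostman_measure (ratio_gt0 _) r2 (ratio_le1 s0) mE cz.
  exists z, mu; split=> // k g M mg g0 M0 gM.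
  by rewrite -ratioE -exprM mulnC; exact: muI.
apply/not_existsP => h.
have /eqP := hausdorff_measure_neq0 (ltW s0) sE; apply.
apply: (hausdorff_null s0 (ratio_gt0 s) (ratio_le1 s0) n_gt0 (ratioE s)) => z e e0.
apply: (content_lt_cover (ratio_gt0 s) r2 (ratio_le1 s0)); apply: (le_lt_trans _ e0).
by rewrite leNgt; exact/negP.
Qed.

End frostman.

(** * Slicing and translation invariance of Lebesgue measure *)

Section lebesgue.
Context {R : realType}.

Lemma ge0_integral_lebesgue_rVS l (f : borel_mx R 1 l.+1 -> \bar R) :
  measurable_fun setT f -> (forall x, 0 <= f x)%E ->
  (\int[lebesgue_rV R l.+1]_u f u =
   \int[@lebesgue_measure R]_x \int[lebesgue_rV R l]_v f (cons_row (x, v)))%E.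
Proof.
move=> mf f0 /=.
have mc := @measurable_cons_row R l.
rewrite (ge0_integral_pushforward mc) //.
rewrite preimage_setT fubini_tonelli1//.
- exact: measurableT_comp mf mc.
- by move=> x; exact: f0.
Qed.

Lemma lebesgue_measure_shift (b : R) (A : set (measurableTypeR R)) : measurable A ->
  pushforward (@lebesgue_measure R) (fun x : measurableTypeR R => (x + b)%R : measurableTypeR R) A =
  lebesgue_measure A.
Proof.
move=> mA; have mb : measurable_fun setT (fun x : measurableTypeR R => (x + b)%R : measurableTypeR R).
  exact: measurable_funD.
apply/esym/(@lebesgue_measure_unique R (pushforward (@lebesgue_measure R) _ : {measure set (measurableTypeR R) -> \bar R})) => //= _ [[a c]] _ <-.
rewrite /pushforward/=.
rewrite (_ : _ @^-1` _ = `]a - b, c - b]%classic); last first.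
  apply/seteqP; split=> x /=; rewrite !in_itv/= => /andP[? ?]; apply/andP; split; lra.
rewrite !lebesgue_measure_itv/= !lte_fin ltrD2r.
by case: ifP => // _; rewrite -!EFinB; congr EFin; lra.
Qed.

Lemma ge0_integral_shift (b : R) (f : R -> \bar R) : measurable_fun setT f ->
  (forall x, 0 <= f x)%E ->
  (\int[@lebesgue_measure R]_x f (x + b)%R = \int[@lebesgue_measure R]_x f x)%E.
Proof.
move=> mf f0.
have mb : measurable_fun setT (fun x : measurableTypeR R => (x + b)%R : measurableTypeR R).
  exact: measurable_funD.
transitivity (\int[pushforward (@lebesgue_measure R) (fun x : measurableTypeR R => (x + b)%R : measurableTypeR R)]_x f x)%E.
  by rewrite (ge0_integral_pushforward mb).
apply: eq_measure_integral => A mA _; exact: lebesgue_measure_shift.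
Qed.

Lemma measurable_cons_row_snd l (x : R) :
  measurable_fun setT (fun v : borel_mx R 1 l => cons_row (x, v) : borel_mx R 1 l.+1).
Proof.
exact: measurableT_comp (@measurable_cons_row R l) (pair1_measurable _).
Qed.

Lemma ge0_integral_rV_shift l (b : 'rV[R]_l) (f : borel_mx R 1 l -> \bar R) :
  measurable_fun setT f -> (forall x, 0 <= f x)%E ->
  (\int[lebesgue_rV R l]_u f ((u : 'rV[R]_l) + b)%R = \int[lebesgue_rV R l]_u f u)%E.
Proof.
elim: l b f => [|l IH] b f mf f0.
  by apply: eq_integral => u _; congr f; apply/rowP => -[].
have ms : measurable_fun setT (fun u : borel_mx R 1 l.+1 => ((u : 'rV[R]_l.+1) + b) : borel_mx R 1 l.+1).
  apply: measurable_fun_mx => i j.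
  under eq_fun do rewrite mxE.
  by apply: measurable_funD => //; exact: measurable_coord.
rewrite !ge0_integral_lebesgue_rVS//; last exact: measurableT_comp ms.
pose b' : 'rV[R]_l := \row_j b 0 (lift ord0 j).
pose F x := (\int[lebesgue_rV R l]_v f (cons_row (x, v)))%E.
transitivity (\int[@lebesgue_measure R]_x F (x + b 0 ord0)%R)%E.
  apply: eq_integral => x _; rewrite /F -[RHS](IH b'); last 2 first.
  - exact: measurableT_comp mf (measurable_cons_row_snd _).
  - by [].
  apply: eq_integral => v _; congr f; apply/rowP => j.
  rewrite !mxE; case: (unliftP ord0 j) => [k|] ->; rewrite ?liftK ?unlift_none/=.
    by rewrite !mxE.
  by [].
apply: ge0_integral_shift.
  apply: (measurable_fun_fubini_tonelli_F (fun p : measurableTypeR R * borel_mx R 1 l => f (cons_row p))) => //.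
  exact: measurableT_comp mf (@measurable_cons_row R l).
by move=> x; apply: integral_ge0.
Qed.

End lebesgue.

(** * Energy estimates *)

Section trig.
Context {R : realType}.
Implicit Types (N v A B D th : R).

(* A bound for the squared Fourier transform of the indicator of [[0, N]]. *)
Definition fejer N v : R := if N * `|v| <= 1 then 2 * N ^+ 2 else (v ^+ 2)^-1.

(** [c] and [s] are the cosine and sine integrals of frequency [v] over [0, N]. The phase [th] is
    carried along because the remaining coordinates appear as a phase when one coordinate is
    integrated. *)
Lemma integral_trig1 N v : 0 < N -> exists c s,
  (v != 0 -> c ^+ 2 + s ^+ 2 <= (v ^+ 2)^-1) /\ forall A B D th,
  (\int[@lebesgue_measure R]_(x in `[0%R, N])
     (A + B * cos (th + 2 * pi * (x * v)) + D * sin (th + 2 * pi * (x * v)))%:E =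
   (A * N + B * (c * cos th - s * sin th) + D * (c * sin th + s * cos th))%:E)%E.
Proof.
move=> N0; have [->|v0] := eqVneq v 0.
  exists N, 0; split=> [|A B D th]; first by [].
  under eq_integral do rewrite mulr0 mulr0 addr0.
  rewrite integral_cst//= lebesgue_measure_itv/= lte_fin N0 -EFinD -EFinM.
  congr EFin; ring.
set w := 2 * pi * v.
have w0 : w != 0 by rewrite !mulf_neq0// gt_eqF// pi_gt0.
(* The sum of the squares is (2 - 2 cos (w N)) / w^2, at most 4 / (2 pi v)^2. *)
exists (sin (w * N) / w), ((1 - cos (w * N)) / w); split=> [_|A B D th].
  have pi1 : 1 <= pi :> R by have := pi_ge2 R; lra.
  rewrite !exprMn -mulrDl exprVn ler_pdivrMr ?exprn_even_gt0//.
  have sc := cos2Dsin2 (w * N); have c1 := cos_geN1 (w * N).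
  have v20 : 0 < v ^+ 2 by rewrite exprn_even_gt0.
  rewrite /w !exprMn [leRHS]mulrC mulfK ?gt_eqF//.
  have : 1 <= pi ^+ 2 :> R by rewrite exprn_ege1.
  nra.
have e x : 2 * pi * (x * v) = w * x by rewrite /w; ring.
under eq_integral do rewrite e.
pose F x := A * x + B * (sin (th + w * x) / w) - D * (cos (th + w * x) / w).
have dl (x : R) : is_derive x (1 : R) (fun y : R => th + w * y : R) w.
  have -> : (fun y : R => th + w * y) = cst th + w *: id by apply/funext.
  have := is_deriveD (is_derive_cst th x (1 : R)) (is_deriveZ w (is_derive_id x (1 : R))).
  by rewrite add0r scaler1.
have dF (x : R) : is_derive x (1 : R) F (A + B * cos (th + w * x) + D * sin (th + w * x)).
  have ds := is_derive1_comp (is_derive_sin _) (dl x).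
  have dc := is_derive1_comp (is_derive_cos _) (dl x).
  have -> : F = A *: id + (B / w) *: (sin \o (fun y : R => th + w * y))
      - (D / w) *: (cos \o (fun y : R => th + w * y)).
    by apply/funext => y; rewrite /F !fctE /= /GRing.scale/=; ring.
  have := is_deriveB (is_deriveD (is_deriveZ A (is_derive_id x (1 : R)))
    (is_deriveZ (B / w) ds)) (is_deriveZ (D / w) dc).
  congr is_derive; rewrite /GRing.scale/=; field.
  exact: w0.
have cF (x : R) : {for x, continuous F}.
  by apply/differentiable_continuous/derivable1_diffP; have [] := dF x.
rewrite (@continuous_FTC2 _ _ F)//.
- rewrite -EFinB /F; congr EFin.
  rewrite !mulr0 !addr0 sinD cosD; field.
  exact: w0.
- apply: continuous_subspaceT => x.
  have cl : {for x, continuous (fun y : R => th + w * y)}.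
    by apply/differentiable_continuous/derivable1_diffP; have [] := dl x.
  apply: cvgD; [apply: cvgD; [exact: cvg_cst|]|]; apply: cvgM; try exact: cvg_cst.
    exact: (cvg_comp _ _ cl (@continuous_cos R _)).
  exact: (cvg_comp _ _ cl (@continuous_sin R _)).
- split.
  + by move=> x _; have [] := dF x.
  + by apply: cvg_at_right_filter; exact: cF.
  + by apply: cvg_at_left_filter; exact: cF.
- by move=> x _; rewrite derive1E; have [_ ->] := dF x.
Qed.

Lemma fejer_ge0 N v : 0 <= fejer N v.
Proof.
by rewrite /fejer; case: ifP => _; [rewrite mulr_ge0// sqr_ge0|rewrite invr_ge0 sqr_ge0].
Qed.

Lemma trig_le1 (B t : R) : `|B * cos t| <= `|B|.
Proof. by rewrite normrM ler_piMr// ler_norml cos_geN1 cos_le1. Qed.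

(** For small frequencies [c] and [s] need not be computed: integrating the nonnegative functions 1
    +- cos and 1 +- sin bounds both by [N] in absolute value. *)
Lemma integral_trig1_fejer N v : 0 < N -> exists c s,
  c ^+ 2 + s ^+ 2 <= fejer N v /\ forall A B D th,
  (\int[@lebesgue_measure R]_(x in `[0%R, N])
     (A + B * cos (th + 2 * pi * (x * v)) + D * sin (th + 2 * pi * (x * v)))%:E =
   (A * N + B * (c * cos th - s * sin th) + D * (c * sin th + s * cos th))%:E)%E.
Proof.
move=> N0; have [c [s [csv h]]] := integral_trig1 v N0.
exists c, s; split=> //; rewrite /fejer; case: ifPn => [_|]; last first.
  by rewrite -ltNge => Nv; apply: csv; apply: contraTneq Nv => ->; rewrite normr0 mulr0 ltr10.
have pos A B D : (forall t, 0 <= A + B * cos t + D * sin t) ->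
    0 <= A * N + B * c + D * s.
  move=> p; rewrite -lee_fin.
  have := h A B D 0; rewrite cos0 sin0 !mulr1 !mulr0 subr0 add0r => <-.
  by apply: integral_ge0 => x _; rewrite lee_fin.
have h1 : 0 <= 1 * N + 1 * c + 0 * s.
  by apply: pos => t; have := cos_geN1 t; lra.
have h2 : 0 <= 1 * N + (-1) * c + 0 * s.
  by apply: pos => t; have := cos_le1 t; lra.
have h3 : 0 <= 1 * N + 0 * c + 1 * s.
  by apply: pos => t; have := sin_geN1 t; lra.
have h4 : 0 <= 1 * N + 0 * c + (-1) * s.
  by apply: pos => t; have := sin_le1 t; lra.
nra.
Qed.

Definition box l N : set 'rV[R]_l := [set u | forall i, 0 <= u 0 i <= N].

Lemma measurable_box l N : measurable (box N : set (borel_mx R 1 l)).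
Proof.
rewrite (_ : box N = \bigcap_(i : 'I_l)
    ((fun v : borel_mx R 1 l => (v : 'rV[R]_l) 0 i) @^-1` `[0, N]%classic)).
  apply: fin_bigcap_measurable => // i _; rewrite -[_ @^-1` _]setTI.
  exact: measurable_coord.
apply/seteqP; split=> v h; first by move=> i _; rewrite /= in_itv; exact: h.
by move=> i; have := h i I; rewrite /= in_itv.
Qed.

Lemma measurable_cos : measurable_fun setT (@cos R).
Proof. by apply: continuous_measurable_fun; exact: continuous_cos. Qed.

Lemma measurable_sin : measurable_fun setT (@sin R).
Proof. by apply: continuous_measurable_fun; exact: continuous_sin. Qed.

Lemma measurable_edot l d (T : measurableType d) (f g : T -> borel_mx R 1 l) :
  measurable_fun setT f -> measurable_fun setT g ->
  measurable_fun setT (fun t => edot (f t : 'rV[R]_l) (g t : 'rV[R]_l)).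
Proof.
move=> mf mg; apply: measurable_sum => i; apply: measurable_funM.
  exact: (measurableT_comp (@measurable_coord R 1 l 0 i) mf).
exact: (measurableT_comp (@measurable_coord R 1 l 0 i) mg).
Qed.

(** The number c + i s is the product of its one-dimensional analogues, and the squared modulus is
    multiplicative. The condition on [A] and [B] makes the integrand nonnegative, as Tonelli's
    theorem demands. *)
Lemma integral_trig l N (v : 'rV[R]_l) : 0 < N -> exists c s,
  c ^+ 2 + s ^+ 2 <= \prod_i fejer N (v 0 i) /\ forall A B th, `|B| <= A ->
  (\int[lebesgue_rV R l]_u
     ((\1_(box N) u)%:E * (A + B * cos (th + 2 * pi * edot u v))%:E) =
   (A * N ^+ l + B * (c * cos th - s * sin th))%:E)%E.
Proof.
move=> N0; elim: l v => [|l IH] v.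
  exists 1, 0; split=> [|A B th AB]; first by rewrite big_ord0 expr0n/= addr0 expr1n.
  rewrite (eq_integral (cst ((A + B * cos th)%:E))); last first.
    move=> u _; rewrite indicE mem_set; last by move=> -[].
    by rewrite mul1e /edot big_ord0 mulr0 addr0.
  rewrite integral_cst//= diracE mem_set// mule1 expr0; congr EFin; ring.
pose v' : 'rV[R]_l := \row_j v 0 (lift ord0 j).
have [c [s [cs h]]] := IH v'.
have [c1 [s1 [cs1 h1]]] := integral_trig1_fejer (v 0 ord0) N0.
exists (c * c1 - s * s1), (c * s1 + s * c1); split.
  have -> : (c * c1 - s * s1) ^+ 2 + (c * s1 + s * c1) ^+ 2 =
      (c1 ^+ 2 + s1 ^+ 2) * (c ^+ 2 + s ^+ 2) by ring.
  rewrite big_ord_recl; apply: ler_pM; rewrite ?addr_ge0 ?sqr_ge0//.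
  by apply: le_trans cs _; under eq_bigr do rewrite mxE.
move=> A B th AB.
have p0 (u : 'rV[R]_l.+1) : (0 <= (\1_(box N) u)%:E * (A + B * cos (th + 2 * pi * edot u v))%:E)%E.
  rewrite mule_ge0 ?lee_fin//.
  by have := trig_le1 B (th + 2 * pi * edot u v); rewrite ler_norml; lra.
rewrite ge0_integral_lebesgue_rVS//; last first.
  apply: emeasurable_funM; apply/measurable_EFinP.
    by apply: measurable_indic; exact: measurable_box.
  apply: measurable_funD => //; apply: measurable_funM => //.
  apply: (measurableT_comp measurable_cos); apply: measurable_funD => //.
  by apply: measurable_funM => //; exact: measurable_edot.
transitivity (\int[@lebesgue_measure R]_(x in `[0%R, N])
    (A * N ^+ l + (B * c) * cos (th + 2 * pi * (x * v 0 ord0)) +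
      (- (B * s)) * sin (th + 2 * pi * (x * v 0 ord0)))%:E)%E; last first.
  by rewrite h1 exprS; congr EFin; ring.
rewrite [RHS]integral_mkcond; apply: eq_integral => x _; rewrite patchE.
have boxE (w : 'rV[R]_l) : \1_(box N) (cons_row (x, w)) = (x \in `[0, N]%classic)%:R * \1_(box N) w :> R.
  rewrite !indicE -natrM mulnb; congr (nat_of_bool _)%:R.
  apply/idP/andP; rewrite !inE /box /= in_itv/=.
    move=> hb; split=> [|i]; first by have := hb ord0; rewrite cons_row0.
    by have := hb (lift ord0 i); rewrite cons_rowS.
  move=> [h0 h1'] i.
  by case: (unliftP ord0 i) => [j|] ->; rewrite ?cons_rowS ?cons_row0.
have edE (w : 'rV[R]_l) : edot (cons_row (x, w)) v = x * v 0 ord0 + edot w v'.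
  rewrite /edot big_ord_recl cons_row0; congr (_ + _).
  by apply: eq_bigr => i _; rewrite cons_rowS mxE.
under eq_integral do rewrite boxE edE mulrDr addrA.
case: ifPn => xN /=.
  under eq_integral do rewrite mul1r.
  rewrite h//; congr EFin; ring.
under eq_integral do rewrite mul0r mul0e.
by rewrite integral0.
Qed.

End trig.

(** * Squared transforms as integrals over pairs of points *)

Section power.
Context {R : realType} {n : nat}.
Implicit Types (x y u v w : 'rV[R]_n) (m : {finite_measure set (borel_mx R 1 n) -> \bar R}).

Lemma edotC x y : edot x y = edot y x.
Proof. by apply: eq_bigr => i _; rewrite mulrC. Qed.

Lemma edotDr x y u : edot x (y + u) = edot x y + edot x u.
Proof. by rewrite -big_split; apply: eq_bigr => i _; rewrite mxE mulrDr. Qed.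

Lemma edotBr x y u : edot x (y - u) = edot x y - edot x u.
Proof. by rewrite -sumrB; apply: eq_bigr => i _; rewrite !mxE mulrBr. Qed.

Lemma measurable_rV_sub d (T : measurableType d) (f g : T -> borel_mx R 1 n) :
  measurable_fun setT f -> measurable_fun setT g ->
  measurable_fun setT (fun t => ((f t : 'rV[R]_n) - (g t : 'rV[R]_n)) : borel_mx R 1 n).
Proof.
move=> mf mg; apply: measurable_fun_mx => i j; under eq_fun do rewrite !mxE.
apply: measurable_funB.
  exact: (measurableT_comp (@measurable_coord R 1 n i j) mf).
exact: (measurableT_comp (@measurable_coord R 1 n i j) mg).
Qed.

Lemma measurable_rV_add d (T : measurableType d) (f g : T -> borel_mx R 1 n) :
  measurable_fun setT f -> measurable_fun setT g ->
  measurable_fun setT (fun t => ((f t : 'rV[R]_n) + (g t : 'rV[R]_n)) : borel_mx R 1 n).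
Proof.
move=> mf mg; apply: measurable_fun_mx => i j; under eq_fun do rewrite !mxE.
apply: measurable_funD.
  exact: (measurableT_comp (@measurable_coord R 1 n i j) mf).
exact: (measurableT_comp (@measurable_coord R 1 n i j) mg).
Qed.

Lemma measurable_cos_edot d (T : measurableType d) (f g : T -> borel_mx R 1 n) :
  measurable_fun setT f -> measurable_fun setT g ->
  measurable_fun setT (fun t => cos (2 * pi * edot (f t : 'rV[R]_n) (g t : 'rV[R]_n))).
Proof.
move=> mf mg; apply: (measurableT_comp measurable_cos); apply: measurable_funM => //.
exact: measurable_edot.
Qed.

Lemma measurable_sin_edot d (T : measurableType d) (f g : T -> borel_mx R 1 n) :
  measurable_fun setT f -> measurable_fun setT g ->
  measurable_fun setT (fun t => sin (2 * pi * edot (f t : 'rV[R]_n) (g t : 'rV[R]_n))).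
Proof.
move=> mf mg; apply: (measurableT_comp measurable_sin); apply: measurable_funM => //.
exact: measurable_edot.
Qed.

Lemma normr_cos_le1 (t : R) : `|cos t| <= 1.
Proof. by rewrite ler_norml cos_geN1 cos_le1. Qed.

Lemma normr_sin_le1 (t : R) : `|sin t| <= 1.
Proof. by rewrite ler_norml sin_geN1 sin_le1. Qed.

Definition cos_transform m x : R := \int[m]_u cos (2 * pi * edot x (u : 'rV[R]_n)).
Definition sin_transform m x : R := \int[m]_u sin (2 * pi * edot x (u : 'rV[R]_n)).
(* The squared modulus of the Fourier transform of [m]. *)
Definition power m x : R := cos_transform m x ^+ 2 + sin_transform m x ^+ 2.

Lemma power_ge0 m x : 0 <= power m x.
Proof. by rewrite addr_ge0// sqr_ge0. Qed.

Lemma measurable_cos_transform m :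
  measurable_fun setT (cos_transform m : borel_mx R 1 n -> R).
Proof.
apply: (@measurable_Rintegral2 R _ _ _ _ m m
  (fun z => cos (2 * pi * edot (z.1 : 'rV[R]_n) (z.2 : 'rV[R]_n))) 1).
  exact: measurable_cos_edot.
by move=> z; exact: normr_cos_le1.
Qed.

Lemma measurable_sin_transform m :
  measurable_fun setT (sin_transform m : borel_mx R 1 n -> R).
Proof.
apply: (@measurable_Rintegral2 R _ _ _ _ m m
  (fun z => sin (2 * pi * edot (z.1 : 'rV[R]_n) (z.2 : 'rV[R]_n))) 1).
  exact: measurable_sin_edot.
by move=> z; exact: normr_sin_le1.
Qed.

Lemma measurable_power m : measurable_fun setT (power m : borel_mx R 1 n -> R).
Proof.
apply: measurable_funD; apply: measurable_funX.
  exact: measurable_cos_transform.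
exact: measurable_sin_transform.
Qed.

Lemma cos_transform_le m x : `|cos_transform m x| <= fine (m setT).
Proof.
rewrite -[leRHS]mul1r.
apply: bounded_Rintegral; first exact: (@measurable_cos_edot _ _ (cst x)).
by move=> u; exact: normr_cos_le1.
Qed.

Lemma sin_transform_le m x : `|sin_transform m x| <= fine (m setT).
Proof.
rewrite -[leRHS]mul1r.
apply: bounded_Rintegral; first exact: (@measurable_sin_edot _ _ (cst x)).
by move=> u; exact: normr_sin_le1.
Qed.

Lemma power_le m x : power m x <= 2 * fine (m setT) ^+ 2.
Proof.
rewrite /power -(real_normK (num_real (cos_transform m x))).
rewrite -(real_normK (num_real (sin_transform m x))).
have := normr_ge0 (cos_transform m x); have := normr_ge0 (sin_transform m x).
by have := cos_transform_le m x; have := sin_transform_le m x; nra.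
Qed.

Lemma Rintegral_fprod (R' : realType) d1 d2 (T1 : measurableType d1)
    (T2 : measurableType d2) (m1 : {finite_measure set T1 -> \bar R'})
    (m2 : {finite_measure set T2 -> \bar R'}) (f : T1 * T2 -> R') M :
  measurable_fun setT f -> (forall z, `|f z| <= M) ->
  \int[fprod m1 m2]_z f z = \int[m1]_x \int[m2]_y f (x, y).
Proof.
move=> mf fM; have fi := bounded_integrable (fprod m1 m2) mf fM.
rewrite /Rintegral; congr fine.
under [RHS]eq_integral => x _.
  rewrite fineK; last first.
    apply: integrable_fin_num => //; apply: bounded_integrable => //.
    exact: measurableT_comp (pair1_measurable _).
  over.
by rewrite (integral12_prod_meas1 fi).
Qed.

(** The differences of two independent points are symmetrically distributed, so their transform is
    real, equal to [power m x], and the phase factors out. *)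
Lemma power_pair_phase m x a :
  \int[fprod m m]_p cos (a + 2 * pi * edot x ((p.1 : 'rV[R]_n) - (p.2 : 'rV[R]_n))) =
  cos a * power m x.
Proof.
pose C (u : borel_mx R 1 n) := cos (2 * pi * edot x (u : 'rV[R]_n)).
pose S (u : borel_mx R 1 n) := sin (2 * pi * edot x (u : 'rV[R]_n)).
have mC : measurable_fun setT C by exact: (@measurable_cos_edot _ _ (cst x)).
have mS : measurable_fun setT S by exact: (@measurable_sin_edot _ _ (cst x)).
have C1 u : `|C u| <= 1 by exact: normr_cos_le1.
have S1 u : `|S u| <= 1 by exact: normr_sin_le1.
have lin b c : \int[m]_u (b * C u + c * S u) =
    b * cos_transform m x + c * sin_transform m x.
  rewrite RintegralD//; last 2 first.
  - by apply: (@bounded_integrable _ _ _ _ _ `|b|);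
      [exact: measurable_funM|move=> u; rewrite normrM ler_piMr].
  - by apply: (@bounded_integrable _ _ _ _ _ `|c|);
      [exact: measurable_funM|move=> u; rewrite normrM ler_piMr].
  by rewrite !RintegralZl//; exact: (@bounded_integrable _ _ _ _ _ 1).
rewrite (@Rintegral_fprod _ _ _ _ _ _ _ _ 1); last 2 first.
- apply: (measurableT_comp measurable_cos); apply: measurable_funD => //.
  apply: measurable_funM => //; apply: (@measurable_edot _ _ _ _ (cst x)) => //.
  by apply: measurable_rV_sub.
- by move=> z; exact: normr_cos_le1.
pose c := cos_transform m x; pose s := sin_transform m x.
transitivity (\int[m]_u ((cos a * c + sin a * s) * C u + (cos a * s - sin a * c) * S u)).
  apply: eq_Rintegral => u _ /=.
  transitivity (\int[m]_v ((cos a * C u - sin a * S u) * C v +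
      (sin a * C u + cos a * S u) * S v)).
    apply: eq_Rintegral => v _; rewrite edotBr mulrBr addrA cosB cosD sinD.
    by rewrite /C /S; ring.
  by rewrite lin /c /s; ring.
by rewrite lin /power -/c -/s; ring.
Qed.

Lemma power_pair m x : power m x =
  \int[fprod m m]_p cos (2 * pi * edot x ((p.1 : 'rV[R]_n) - (p.2 : 'rV[R]_n))).
Proof.
have := power_pair_phase m x 0; rewrite cos0 mul1r => <-.
by under eq_Rintegral do rewrite add0r.
Qed.

Lemma power_pair_phase_sin m x a :
  \int[fprod m m]_p sin (a + 2 * pi * edot x ((p.1 : 'rV[R]_n) - (p.2 : 'rV[R]_n))) =
  sin a * power m x.
Proof.
have sinE (t : R) : sin t = cos (t - pi / 2).
  by rewrite cosB cos_pihalf sin_pihalf mulr0 mulr1 add0r.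
rewrite sinE -power_pair_phase; apply: eq_Rintegral => p _.
by rewrite sinE addrAC.
Qed.

Lemma Rintegral_sqr_le d (T : measurableType d)
    (P : {finite_measure set T -> \bar R}) (g : T -> R) M :
  measurable_fun setT g -> (forall t, `|g t| <= M) ->
  (\int[P]_t g t) ^+ 2 <= fine (P setT) * \int[P]_t (g t ^+ 2).
Proof.
move=> mg gM; set I := \int[P]_t g t; set T0 := fine (P setT).
have ig : P.-integrable setT (EFin \o g) by exact: bounded_integrable gM.
have ig2 : P.-integrable setT (EFin \o (fun t => g t ^+ 2)).
  apply: (@bounded_integrable _ _ _ _ _ (M ^+ 2)); first exact: measurable_funX.
  move=> t; rewrite normrX lerXn2r ?nnegrE//.
  exact: le_trans (gM t).
have q0 c : 0 <= \int[P]_t (g t ^+ 2) - 2 * c * I + c ^+ 2 * T0.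
  have : 0 <= \int[P]_t ((g t - c) ^+ 2).
    by apply: Rintegral_ge0 => t _; exact: sqr_ge0.
  rewrite (_ : \int[P]_t ((g t - c) ^+ 2) =
    \int[P]_t (g t ^+ 2 + ((- (2 * c)) * g t + c ^+ 2))); last first.
    by apply: eq_Rintegral => t _; ring.
  have i1 : P.-integrable setT (EFin \o (fun t => (- (2 * c)) * g t)).
    apply: (@bounded_integrable _ _ _ _ _ (`|2 * c| * M)); first exact: measurable_funM.
    by move=> t; rewrite normrM normrN ler_wpM2l.
  have i2 : P.-integrable setT (EFin \o (fun=> c ^+ 2)).
    exact: (@bounded_integrable _ _ _ _ _ `|c ^+ 2|).
  have i3 : P.-integrable setT (EFin \o (fun t => (- (2 * c)) * g t + c ^+ 2)).
    exact: (integrableD measurableT i1 i2).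
  rewrite RintegralD// RintegralD// RintegralZl// Rintegral_cst//.
  by rewrite -/I -/T0; lra.
have T00 : 0 <= T0 by rewrite fine_ge0.
have [T0E|T0n] := eqVneq T0 0.
  have : `|I| <= M * T0 by exact: bounded_Rintegral.
  by rewrite T0E mulr0 normr_le0 => /eqP ->; rewrite expr0n/= mul0r.
have Tp : 0 < T0 by rewrite lt_def T0n.
(* The mean is the optimal constant in [q0]; it exists only for positive mass. *)
have := q0 (I / T0); set G := \int[P]_t _ => h.
have : 0 <= T0 * (G - 2 * (I / T0) * I + (I / T0) ^+ 2 * T0) by rewrite mulr_ge0.
rewrite (_ : T0 * _ = T0 * G - I ^+ 2); first by rewrite subr_ge0.
by field.
Qed.

End power.

Section box.
Context {R : realType}.
Implicit Types (N t : R) (n : nat).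

Lemma lebesgue_rV_itv n (a b : 'I_n -> R) : (forall i, a i <= b i) ->
  lebesgue_rV R n [set u : 'rV[R]_n | forall i, a i <= u 0 i <= b i] =
  (\prod_i (b i - a i))%:E.
Proof.
move=> ab; have := @lebesgue_rV_box R n (fun i => `[a i, b i]%classic).
rewrite (_ : [set v : 'rV[R]_n | _] = [set u : 'rV[R]_n | forall i, a i <= u 0 i <= b i]).
  move=> ->; last by move=> i; exact: measurable_itv.
  rewrite -prodEFin; apply: eq_bigr => i _; rewrite lebesgue_measure_itv/= lte_fin.
  by case: ltgtP (ab i) => // ->; rewrite subrr.
by apply/seteqP; split=> v h i; have := h i; rewrite /= in_itv.
Qed.

Lemma measurable_rV_itv n (a b : 'I_n -> R) :
  measurable ([set u : 'rV[R]_n | forall i, a i <= u 0 i <= b i] : set (borel_mx R 1 n)).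
Proof.
rewrite (_ : [set _ | _] = \bigcap_(i : 'I_n)
    ((fun v : borel_mx R 1 n => (v : 'rV[R]_n) 0 i) @^-1` `[a i, b i]%classic)).
  apply: fin_bigcap_measurable => // i _; rewrite -[_ @^-1` _]setTI.
  exact: measurable_coord.
apply/seteqP; split=> v h; first by move=> i _; rewrite /= in_itv; exact: h.
by move=> i; have := h i I; rewrite /= in_itv.
Qed.

Lemma box_measure n N : 0 < N ->
  exists kappa : {finite_measure set (borel_mx R 1 n) -> \bar R},
  [/\ kappa setT = (N ^+ n)%:E,
      forall g : borel_mx R 1 n -> \bar R, measurable_fun setT g ->
        (forall x, 0 <= g x)%E ->
        (\int[kappa]_u g u = \int[lebesgue_rV R n]_u ((\1_(box N) u)%:E * g u))%E &
      forall w, power kappa w <= \prod_i fejer N (w 0 i)].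
Proof.
move=> N0; have mB := @measurable_box R n N.
have bE : lebesgue_rV R n (box N) = (N ^+ n)%:E.
  rewrite /box lebesgue_rV_itv; last by move=> i; exact: ltW.
  by rewrite prodr_const subr0 card_ord.
have bfin : (lebesgue_rV R n (box N) < +oo)%E by rewrite bE ltry.
have [kappa [kE kI]] := exists_restr mB bfin.
have kT : kappa setT = (N ^+ n)%:E by rewrite kE// setTI.
have kI' (g : borel_mx R 1 n -> \bar R) : measurable_fun setT g -> (forall x, 0 <= g x)%E ->
    (\int[kappa]_u g u = \int[lebesgue_rV R n]_u ((\1_(box N) u)%:E * g u))%E.
  move=> mg g0; rewrite kI// integral_mkcond; apply: eq_integral => x _.
  by rewrite patchE indicE; case: (x \in box N); rewrite ?mul1e ?mul0e.
exists kappa; split=> // w.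
have [c [s [cs h]]] := integral_trig w N0.
have key th : \int[kappa]_u cos (th + 2 * pi * edot w (u : 'rV[R]_n)) =
    c * cos th - s * sin th.
  have mc : measurable_fun setT (fun u : borel_mx R 1 n => cos (th + 2 * pi * edot w (u : 'rV[R]_n))).
    apply: (measurableT_comp measurable_cos); apply: measurable_funD => //.
    by apply: measurable_funM => //; exact: (@measurable_edot _ _ _ _ (cst w)).
  have ic : kappa.-integrable setT (EFin \o (fun u : borel_mx R 1 n => cos (th + 2 * pi * edot w (u : 'rV[R]_n)))).
    by apply: (@bounded_integrable _ _ _ _ _ 1) => // u; exact: normr_cos_le1.
  (* [kI'] applies to nonnegative functions, so 1 is added to the cosine and its integral is
     subtracted afterwards. *)
  have : \int[kappa]_u (1 + cos (th + 2 * pi * edot w (u : 'rV[R]_n))) =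
     N ^+ n + (c * cos th - s * sin th).
    rewrite /Rintegral kI'; last 2 first.
    - by apply/measurable_EFinP; exact: measurable_funD.
    - by move=> u; rewrite lee_fin; have := cos_geN1 (th + 2 * pi * edot w (u : 'rV[R]_n)); lra.
    have := h 1 1 th; rewrite !mul1r normr1 => /(_ (lexx _)) hh.
    rewrite -[RHS]/(fine (_%:E)) -hh.
    by congr fine; apply: eq_integral => u _; rewrite mul1r edotC.
  rewrite RintegralD//; last first.
    by apply: (@bounded_integrable _ _ _ _ _ 1) => // u; rewrite normr1.
  rewrite Rintegral_cst// mul1r [X in fine X]kT/=; lra.
have cE : cos_transform kappa w = c.
  by have := key 0; under eq_Rintegral do rewrite add0r; rewrite cos0 sin0 mulr0 mulr1 subr0.
have sE : sin_transform kappa w = s.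
  (* A quarter turn of the phase changes the cosine integral into the sine integral. *)
  have := key (- (pi / 2)); rewrite cosN sinN cos_pihalf sin_pihalf mulr0 sub0r mulrN1 opprK => <-.
  apply: eq_Rintegral => u _; rewrite addrC.
  by rewrite -[RHS]cosN opprB cosB cos_pihalf sin_pihalf mul0r mul1r add0r.
by rewrite /power cE sE.
Qed.

(** A majorant for [fejer] after rescaling by N: it changes by a bounded factor over a unit interval
    and has bounded sums over the integers. *)
Definition spread t : R := ((1 + `|t|) ^+ 2)^-1.

(** N * (x - v) is within 1 of the argument y of [spread], so 1 + |y| <= 2 + N |x - v|. In both
    cases of [fejer] the loss is at most a factor 9, and 18 = 2 * 9 because of the 2 in the first
    case. *)
Lemma fejer_cell N (q : nat) x z v : 0 < N ->
  z + q%:R / N <= x <= z + q.+1%:R / N ->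
  fejer N (x - v) <= 18 * N ^+ 2 * spread (q%:R - N * (v - z)).
Proof.
move=> N0 /andP[h1 h2]; set t := N * (v - z).
have l1 : q%:R - t <= N * (x - v).
  have : N * (z + q%:R / N) <= N * x by rewrite ler_pM2l.
  by rewrite mulrDr [N * (_ / _)]mulrC divfK ?gt_eqF// /t; lra.
have l2 : N * (x - v) <= q%:R - t + 1.
  have : N * x <= N * (z + q.+1%:R / N) by rewrite ler_pM2l.
  by rewrite mulrDr [N * (_ / _)]mulrC divfK ?gt_eqF// -natr1 /t; lra.
move: (q%:R - t) l1 l2 => y l1 l2.
have y1 : 0 < (1 + `|y|) ^+ 2 by rewrite exprn_gt0// ltr_wpDr.
rewrite /spread ler_pdivlMr// /fejer.
have yD : 1 + `|y| <= 2 + N * `|x - v|.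
  rewrite -[X in X * `|_|](gtr0_norm N0) -normrM.
  have := ler_norm (N * (x - v)); have := ler_norm (- (N * (x - v))).
  by rewrite normrN; case: (ger0P y) => ?; lra.
have D0 := normr_ge0 (x - v); have N20 : 0 < N ^+ 2 by rewrite exprn_gt0.
have yy := normr_ge0 y.
case: (leP (N * `|x - v|) 1) => D1.
  have : 0 <= (2 - `|y|) * (`|y| + 4) by apply: mulr_ge0; lra.
  by nra.
have d0 : 0 < `|x - v| by rewrite lt_def D0 andbT; apply: contraTneq D1 => ->; rewrite mulr0 ltr10.
rewrite mulrC -(real_normK (num_real (x - v))) ler_pdivrMr ?exprn_gt0//.
have : (1 + `|y|) ^+ 2 <= 9 * (N * `|x - v|) ^+ 2.
  move: (N * `|x - v|) yD D1 => M yD D1.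
  have : 0 <= (3 * M - 1 - `|y|) * (3 * M + 1 + `|y|) by apply: mulr_ge0; lra.
  by lra.
have : 0 <= (N * `|x - v|) ^+ 2 by rewrite sqr_ge0.
by rewrite !exprMn; lra.
Qed.

Lemma sum_spread K t : \sum_(q < K) spread (q%:R - t) <= 4.
Proof.
(* A primitive of [spread] with values in [-1, 1]. Twice its increments dominate [spread], and the
   telescoping sum is at most 2 * 2. *)
pose Phi (x : R) := x / (1 + `|x|).
have Phi1 x : -1 <= Phi x <= 1.
  have x1 : 0 < 1 + `|x| by rewrite ltr_wpDr.
  rewrite /Phi ler_pdivrMr// ler_pdivlMr// mulN1r mul1r.
  have := ler_norm x; have := ler_norm (- x); rewrite normrN => ? ?.
  by apply/andP; split; lra.
have h x : spread x <= 2 * (Phi (x + 1) - Phi x).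
  rewrite /spread /Phi.
  have [x0|x0] := leP 0 x.
    rewrite !ger0_norm ?addr_ge0//.
    have -> : 2 * ((x + 1) / (1 + (x + 1)) - x / (1 + x)) =
        ((1 + x) ^+ 2)^-1 + x / ((2 + x) * (1 + x) ^+ 2).
      by field; rewrite !gt_eqF//; lra.
    by rewrite lerDl divr_ge0// mulr_ge0 ?sqr_ge0//; lra.
  rewrite (ltr0_norm x0).
  have [x1|x1] := leP x (- 1).
    rewrite ler0_norm; last by lra.
    have -> : 2 * ((x + 1) / (1 + - (x + 1)) - x / (1 + - x)) =
        ((1 + - x) ^+ 2)^-1 + (2 - x) / ((- x) * (1 + - x) ^+ 2).
      by field; rewrite ?(lt_eqF x0) ?gt_eqF//; lra.
    by rewrite lerDl divr_ge0// ?mulr_ge0 ?sqr_ge0//; lra.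
  rewrite ger0_norm; last by lra.
  have -> : 2 * ((x + 1) / (1 + (x + 1)) - x / (1 + - x)) =
      ((1 + - x) ^+ 2)^-1 + (- x) * (7 - 4 * x ^+ 2) / ((2 + x) * (1 + - x) ^+ 2).
    by field; rewrite !gt_eqF//; lra.
  rewrite lerDl divr_ge0// ?mulr_ge0 ?sqr_ge0//; nra.
move: Phi Phi1 h => Phi Phi1 h.
apply: (@le_trans _ _ (2 * (Phi (K%:R - t) - Phi (- t)))); last first.
  by move: (Phi1 (K%:R - t)) (Phi1 (- t)) => /andP[_ h1] /andP[h2 _]; lra.
elim: K => [|K IH]; first by rewrite big_ord0 sub0r subrr mulr0.
rewrite big_ord_recr/=; apply: le_trans (lerD IH (h _)) _.
have -> : K.+1%:R - t = K%:R - t + 1 by rewrite -natr1; ring.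
by lra.
Qed.

End box.

Section energy.
Context {R : realType} {n : nat}.
Variables (z : 'rV[R]_n) (mu : {finite_measure set (borel_mx R 1 n) -> \bar R}) (r : R).
Hypothesis r_ge0 : 0 <= r.
Hypothesis mu_frostman :
  forall k (g : borel_mx R 1 n -> \bar R) (M : {ffun 'I_n -> 'I_(2 ^ k)} -> R),
    measurable_fun setT g -> (forall u, 0 <= g u)%E -> (forall q, 0 <= M q) ->
    (forall q u, in_cell z q u -> g u <= (M q)%:E)%E ->
    (\int[mu]_u g u <= (r ^+ k * \sum_q M q)%:E)%E.

Lemma spread_ge0 (t : R) : 0 <= spread t.
Proof. by rewrite invr_ge0 sqr_ge0. Qed.

(** By [power_pair], both sides integrate cos (2 pi (x - y).(u - v)) over the same four points. *)
Lemma power_swap (m1 m2 : {finite_measure set (borel_mx R 1 n) -> \bar R}) :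
  \int[fprod m1 m1]_p power m2 ((p.1 : 'rV[R]_n) - (p.2 : 'rV[R]_n)) =
  \int[fprod m2 m2]_q power m1 ((q.1 : 'rV[R]_n) - (q.2 : 'rV[R]_n)).
Proof.
under eq_Rintegral do rewrite power_pair.
under [RHS]eq_Rintegral do rewrite power_pair.
rewrite (@Rfubini _ _ _ _ _ (fprod m1 m1) (fprod m2 m2) (fun pq => cos (2 * pi *
  edot ((pq.1.1 : 'rV[R]_n) - (pq.1.2 : 'rV[R]_n)) ((pq.2.1 : 'rV[R]_n) - (pq.2.2 : 'rV[R]_n)))) 1).
- by apply: eq_Rintegral => q _; apply: eq_Rintegral => p _; rewrite edotC.
- apply: measurable_cos_edot; apply: measurable_rV_sub.
  + exact: (measurableT_comp measurable_fst measurable_fst).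
  + exact: (measurableT_comp measurable_snd measurable_fst).
  + exact: (measurableT_comp measurable_fst measurable_snd).
  + exact: (measurableT_comp measurable_snd measurable_snd).
- by move=> pq; exact: normr_cos_le1.
Qed.

Lemma measurable_power_sub (m : {finite_measure set (borel_mx R 1 n) -> \bar R}) :
  measurable_fun setT (fun q : borel_mx R 1 n * borel_mx R 1 n =>
    power m ((q.1 : 'rV[R]_n) - (q.2 : 'rV[R]_n))).
Proof.
by apply: (measurableT_comp (measurable_power m)); exact: measurable_rV_sub.
Qed.

Lemma energy_upper k (kappa : {finite_measure set (borel_mx R 1 n) -> \bar R}) :
  (forall w, power kappa w <= \prod_i fejer (2 ^+ k) (w 0 i)) ->
  \int[fprod kappa kappa]_p power mu ((p.1 : 'rV[R]_n) - (p.2 : 'rV[R]_n)) <=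
  r ^+ k * (72 * (2 ^+ k) ^+ 2) ^+ n * fine (mu setT).
Proof.
move=> hk; set N : R := 2 ^+ k; have N0 : 0 < N by rewrite exprn_gt0.
rewrite power_swap -lee_fin /Rintegral fineK; last first.
  apply: integrable_fin_num => //; apply: (@bounded_integrable _ _ _ _ _ (2 * fine (kappa setT) ^+ 2)).
    exact: measurable_power_sub.
  by move=> q; rewrite ger0_norm ?power_ge0 ?power_le.
have mE : measurable_fun setT (fun q : borel_mx R 1 n * borel_mx R 1 n =>
    (power kappa ((q.1 : 'rV[R]_n) - (q.2 : 'rV[R]_n)))%:E).
  by apply/measurable_EFinP; exact: measurable_power_sub.
rewrite (fubini_tonelli2 _ mE); last by move=> q; rewrite lee_fin power_ge0.
apply: (@le_trans _ _ (\int[mu]_v (r ^+ k * (72 * N ^+ 2) ^+ n)%:E)%E); last first.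
  by rewrite integral_cst//= [in leRHS]EFinM fineK// fin_num_measure.
apply: ge0_le_integral => //.
- by move=> v _; apply: integral_ge0 => u _; rewrite lee_fin power_ge0.
- by apply: (measurable_fun_fubini_tonelli_G _ mE) => q; rewrite lee_fin power_ge0.
move=> v _.
have T0 t : 0 <= 18 * N ^+ 2 * spread t.
  by apply: mulr_ge0; [apply: mulr_ge0 => //; exact: sqr_ge0|exact: spread_ge0].
(* The cells form a product, so the sum of [M] over them is a product of n sums, each at most 4 * 18
   * N^2 by [sum_spread]. *)
pose M (q : {ffun 'I_n -> 'I_(2 ^ k)}) : R :=
  \prod_i (18 * N ^+ 2 * spread ((q i)%:R - N * ((v : 'rV[R]_n) 0 i - z 0 i))).
have M0 q : 0 <= M q.
  by apply: prodr_ge0 => i _.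
apply: le_trans (mu_frostman (M := M) _ _ _ _) _ => //.
- by apply/measurable_EFinP; apply: (measurableT_comp (measurable_power kappa)); exact: (measurable_rV_sub (f := idfun) (g := cst v) (@measurable_id _ _ _) (measurable_cst _)).
- by move=> u; rewrite lee_fin power_ge0.
- move=> q u qu; rewrite lee_fin; apply: le_trans (hk _) _.
  apply: ler_prod => i _; rewrite fejer_ge0/= !mxE; apply: fejer_cell => //.
rewrite lee_fin ler_wpM2l ?exprn_ge0//.
rewrite -(bigA_distr_bigA (fun (i : 'I_n) (j : 'I_(2 ^ k)) => 18 * N ^+ 2 * spread (j%:R - N * ((v : 'rV[R]_n) 0 i - z 0 i)))).
rewrite -[n in leRHS]card_ord -prodr_const; apply: ler_prod => i _.
rewrite sumr_ge0//=.
rewrite -mulr_sumr.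
have := sum_spread (2 ^ k) (N * ((v : 'rV[R]_n) 0 i - z 0 i)).
have : 0 < N ^+ 2 by rewrite exprn_gt0.
nra.
Qed.

Definition cube (a : R) : set 'rV[R]_n := [set u | forall i, - a <= u 0 i <= a].

(* By Fubini, |hat mu (x - y)|^2 has the same integral over the box [[0, 2 ^+ k]^n]
   in x and y as the squared transform of the box has over mu (x) mu; the latter
   decays like a product of Fejer kernels, which is summed over the cells. *)
Lemma energy k :
  (\int[lebesgue_rV R n]_x ((\1_(cube (2 ^+ k / 4)) x)%:E * (power mu x)%:E) <=
   (144 ^+ n * fine (mu setT) * ((2 ^+ k) ^+ n * r ^+ k))%:E)%E.
Proof.
set N : R := 2 ^+ k; have N0 : 0 < N by rewrite exprn_gt0.
have [kappa [kT kI hk]] := @box_measure R n N N0.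
have mE : measurable_fun setT (fun q : borel_mx R 1 n * borel_mx R 1 n =>
    (power mu ((q.1 : 'rV[R]_n) - (q.2 : 'rV[R]_n)))%:E).
  by apply/measurable_EFinP; exact: measurable_power_sub.
have mc : measurable (cube (N / 4) : set (borel_mx R 1 n)) by exact: measurable_rV_itv.
pose J : \bar R := (\int[lebesgue_rV R n]_x ((\1_(cube (N / 4)) x)%:E * (power mu x)%:E))%E.
(* For y in this middle part, of volume (N/2)^n, the box translated by -y still contains the cube of
   half-side N/4. *)
pose mid : set 'rV[R]_n := [set u | forall i, N / 4 <= u 0 i <= 3 * N / 4].
have mmid : measurable (mid : set (borel_mx R 1 n)) by exact: measurable_rV_itv.
have up := energy_upper hk.
have : (((N / 2) ^+ n)%:E * J <=
    (\int[fprod kappa kappa]_p power mu ((p.1 : 'rV[R]_n) - (p.2 : 'rV[R]_n)))%:E)%E.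
  rewrite /Rintegral fineK; last first.
    apply: integrable_fin_num => //; apply: (@bounded_integrable _ _ _ _ _ (2 * fine (mu setT) ^+ 2)).
      exact: measurable_power_sub.
    by move=> q; rewrite ger0_norm ?power_ge0 ?power_le.
  rewrite (fubini_tonelli2 _ mE); last by move=> q; rewrite lee_fin power_ge0.
  pose G y := (\int[kappa]_x (power mu ((x : 'rV[R]_n) - (y : 'rV[R]_n)))%:E)%E.
  have mG : measurable_fun setT (G : borel_mx R 1 n -> \bar R).
    by apply: (measurable_fun_fubini_tonelli_G _ mE) => q; rewrite lee_fin power_ge0.
  have G0 y : (0 <= G y)%E.
    by apply: integral_ge0 => x _; rewrite lee_fin power_ge0.
  have mb : measurable_fun setT (fun x : borel_mx R 1 n => (\1_(box N) x)%:E : \bar R).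
    by apply/measurable_EFinP/measurable_indic; exact: measurable_box.
  have mm : measurable_fun setT (fun x : borel_mx R 1 n => (\1_mid x)%:E : \bar R).
    exact/measurable_EFinP/measurable_indic.
  have GJ (y : 'rV[R]_n) : mid y -> (J <= G y)%E.
    move=> my; have mp : measurable_fun setT (fun x : borel_mx R 1 n =>
        (power mu ((x : 'rV[R]_n) - y))%:E).
      apply/measurable_EFinP; apply: (measurableT_comp (measurable_power mu)).
      exact: (measurable_rV_sub (f := idfun) (g := cst y) (@measurable_id _ _ _) (measurable_cst _)).
    rewrite /G kI//; last by move=> x; rewrite lee_fin power_ge0.
    rewrite -(@ge0_integral_rV_shift _ _ y); last 2 first.
    - exact: emeasurable_funM.
    - by move=> x; rewrite mule_ge0 ?lee_fin// power_ge0.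
    rewrite /J; apply: ge0_le_integral => //.
    - by move=> x _; rewrite mule_ge0 ?lee_fin// power_ge0.
    - apply: emeasurable_funM; first exact/measurable_EFinP/measurable_indic.
      by apply/measurable_EFinP; exact: measurable_power.
    - have ms : measurable_fun setT (fun x : borel_mx R 1 n => ((x : 'rV[R]_n) + y)%R : borel_mx R 1 n).
        exact: (measurable_rV_add (f := idfun) (g := cst y) (@measurable_id _ _ _) (measurable_cst _)).
      apply: emeasurable_funM; first exact: (measurableT_comp mb ms).
      exact: (measurableT_comp mp ms).
    move=> x _; rewrite addrK lee_wpmul2r ?lee_fin ?power_ge0// !indicE.
    rewrite ler_nat; case: (boolP (x \in cube _)) => //; rewrite inE => xc.
    rewrite mem_set// => i; rewrite mxE.
    by have /andP[? ?] := xc i; have /andP[? ?] := my i; apply/andP; split; lra.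
  rewrite kI//; apply: (@le_trans _ _ (\int[lebesgue_rV R n]_y ((\1_mid y)%:E * J))%E).
    rewrite ge0_integralZr//; last first.
      by apply: integral_ge0 => x _; rewrite mule_ge0 ?lee_fin// power_ge0.
    rewrite integral_indic// setIT.
    rewrite [X in (_ <= X * _)%E](_ : _ = ((N / 2) ^+ n)%:E)//.
    apply: etrans (@lebesgue_rV_itv _ n (fun=> N / 4) (fun=> 3 * N / 4) _) _; first by move=> i; lra.
    by rewrite prodr_const card_ord; congr ((_ ^+ n)%:E); lra.
  apply: ge0_le_integral => //.
  - move=> y _; rewrite mule_ge0 ?lee_fin//; apply: integral_ge0 => x _.
    by rewrite mule_ge0 ?lee_fin// power_ge0.
  - exact: emeasurable_funM.
  - exact: emeasurable_funM.
  move=> y _; rewrite !indicE; case: (boolP (y \in mid)); rewrite ?mul0e ?inE.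
    move=> my; rewrite mul1e mem_set ?mul1e; first exact: GJ.
    by move=> i; have /andP[? ?] := my i; apply/andP; split; lra.
  by move=> _; rewrite mule_ge0// lee_fin.
move=> /le_trans /(_ _); rewrite -/J => h.
have {}h := h _ _; have {}h : (((N / 2) ^+ n)%:E * J <=
    (r ^+ k * (72 * N ^+ 2) ^+ n * fine (mu setT))%:E)%E by apply: h; rewrite lee_fin.
have p0 : 0 < (N / 2) ^+ n by rewrite exprn_gt0// divr_gt0.
move: h; rewrite -lee_pdivlMl// => /le_trans; apply; rewrite -EFinM lee_fin.
(* Dividing by the volume (N/2)^n of the middle part turns 72 N^2 into 144 N in each coordinate. *)
have -> : (72 * N ^+ 2) ^+ n = (N / 2) ^+ n * (144 ^+ n * N ^+ n).
  by rewrite -!exprMn; congr (_ ^+ n); field.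
move: ((N / 2) ^+ n) p0 => P p0; rewrite le_eqVlt; apply/orP; left; apply/eqP.
by field; rewrite gt_eqF.
Qed.

End energy.

(** * Domination of a transform by its local averages *)

Lemma exists_bounded_density d (T : measurableType d) (R : realType)
    (mu : {finite_measure set T -> \bar R}) (f : T -> R) B :
  measurable_fun setT f -> (forall x, 0 <= f x <= B) ->
  exists nu : {finite_measure set T -> \bar R},
    (forall A, nu A = \int[mu]_(x in A) (f x)%:E)%E /\
    forall (g : T -> R) M, measurable_fun setT g -> (forall x, `|g x| <= M) ->
      \int[nu]_x g x = \int[mu]_x (g x * f x).
Proof.
move=> mf fB; have f0 x : 0 <= f x by case/andP: (fB x).
have fi : mu.-integrable setT (EFin \o f).
  by apply: (@bounded_integrable _ _ _ _ _ B) => // x; rewrite ger0_norm//; case/andP: (fB x).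
have foo : (\int[mu]_x (f x)%:E < +oo)%E.
  rewrite -ge0_fin_numE; first exact: (integrable_fin_num measurableT fi).
  by apply: integral_ge0 => x _; rewrite lee_fin.
have [nu [nuE nuI]] := exists_density mf f0 foo.
have nuR (g : T -> R) : measurable_fun setT g -> (forall x, 0 <= g x) ->
    \int[nu]_x g x = \int[mu]_x (g x * f x).
  move=> mg g0; rewrite /Rintegral nuI//; last exact/measurable_EFinP.
exists nu; split=> // g M mg gM.
(* Signed integrands are reduced to nonnegative ones by adding the constant [M], whose own integral
   is then removed. *)
have M0 x : 0 <= g x + M.
  by have := gM x; rewrite ler_norml; lra.
have gi m : (m : {finite_measure set T -> \bar R}).-integrable setT (EFin \o g).
  exact: bounded_integrable gM.
have gfi : mu.-integrable setT (EFin \o (fun x => g x * f x)).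
  apply: (@bounded_integrable _ _ _ _ _ (M * B)); first exact: measurable_funM.
  move=> x; rewrite normrM ler_pM// ger0_norm//; by case/andP: (fB x).
have h1 : \int[nu]_x (g x + M) = \int[mu]_x ((g x + M) * f x).
  by apply: nuR => //; exact: measurable_funD.
have h2 : \int[nu]_x 1 = \int[mu]_x (1 * f x) by exact: nuR.
have Mi m : (m : {finite_measure set T -> \bar R}).-integrable setT (EFin \o (fun=> M)).
  exact: (@bounded_integrable _ _ _ _ _ `|M|).
have Mfi : mu.-integrable setT (EFin \o (fun x => M * f x)).
  apply: (@bounded_integrable _ _ _ _ _ (`|M| * B)); first exact: measurable_funM.
  by move=> x; rewrite normrM ler_pM// ger0_norm//; case/andP: (fB x).
move: h1; rewrite (RintegralD measurableT (gi nu) (Mi nu)).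
rewrite (_ : \int[mu]_x _ = \int[mu]_x (g x * f x + M * f x)); last first.
  by apply: eq_Rintegral => x _; rewrite mulrDl.
rewrite RintegralD//.
suff -> : \int[nu]_x M = \int[mu]_x (M * f x) by move/addIr.
rewrite RintegralZl//.
have -> : \int[nu]_x M = M * \int[nu]_x 1 by rewrite !Rintegral_cst// mul1r.
by rewrite h2; congr (_ * _); apply: eq_Rintegral => x _; rewrite mul1r.
Qed.

Section smoothing.
Context {R : realType} {n : nat}.

Lemma cos_near0 : exists2 e : R, 0 < e & forall t, `|t| < e -> 1 / 2 <= cos t.
Proof.
have /cvgrPdist_le/(_ (1 / 2)) [|e /= e0 he] := @continuous_cos R 0; first by lra.
exists e => // t te; have := he t; rewrite /ball/= sub0r normrN cos0 => /(_ te).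
by rewrite ler_norml; lra.
Qed.

(** For a fixed second point, translation takes the box [0, N]^n into the cube [-N, N]^n;
    integrating over the second point contributes the total mass. *)
Lemma convolve_box (N : R) (kappa : {finite_measure set (borel_mx R 1 n) -> \bar R})
    (f : borel_mx R 1 n -> \bar R) :
  (forall g : borel_mx R 1 n -> \bar R, measurable_fun setT g -> (forall x, 0 <= g x)%E ->
    (\int[kappa]_u g u = \int[lebesgue_rV R n]_u ((\1_(box N) u)%:E * g u))%E) ->
  measurable_fun setT f -> (forall x, 0 <= f x)%E ->
  (\int[fprod kappa kappa]_p f ((p.1 : 'rV[R]_n) - (p.2 : 'rV[R]_n))%R <=
   kappa setT * \int[lebesgue_rV R n]_x ((\1_(cube N) x)%:E * f x))%E.
Proof.
move=> kI mf f0.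
have ms : measurable_fun setT (fun p : borel_mx R 1 n * borel_mx R 1 n =>
    f ((p.1 : 'rV[R]_n) - (p.2 : 'rV[R]_n))).
  by apply: (measurableT_comp mf); exact: measurable_rV_sub.
have mb : measurable_fun setT (fun x : borel_mx R 1 n => (\1_(box N) x)%:E : \bar R).
  by apply/measurable_EFinP/measurable_indic; exact: measurable_box.
have mcu : measurable_fun setT (fun x : borel_mx R 1 n => (\1_(cube N) x)%:E : \bar R).
  by apply/measurable_EFinP/measurable_indic; exact: measurable_rV_itv.
rewrite (fubini_tonelli2 _ ms)//.
set J := (\int[lebesgue_rV R n]_x _)%E.
have J0 : (0 <= J)%E by apply: integral_ge0 => x _; rewrite mule_ge0 ?lee_fin.
have mG : measurable_fun setT (fun y : borel_mx R 1 n =>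
    \int[kappa]_x f ((x : 'rV[R]_n) - (y : 'rV[R]_n))%R)%E.
  by apply: (measurable_fun_fubini_tonelli_G _ ms).
rewrite /fubini_G /= kI//; last by move=> y; exact: integral_ge0.
apply: (@le_trans _ _ (\int[lebesgue_rV R n]_y ((\1_(box N) y)%:E * J))%E); last first.
  have <- := kI (fun=> J) (measurable_cst _) (fun=> J0).
  by rewrite integral_cst// muleC.
apply: ge0_le_integral => //.
- by move=> y _; rewrite mule_ge0 ?lee_fin// integral_ge0.
- exact: emeasurable_funM.
- exact: emeasurable_funM.
move=> y _; rewrite !indicE; case: (boolP (y \in box N)); rewrite ?mul0e//.
rewrite !mul1e inE => yb.
have my : measurable_fun setT (fun x : borel_mx R 1 n => f ((x : 'rV[R]_n) - (y : 'rV[R]_n))%R).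
  apply: (measurableT_comp mf).
  exact: (measurable_rV_sub (f := idfun) (g := cst y) (@measurable_id _ _ _) (measurable_cst _)).
rewrite kI//.
rewrite -(@ge0_integral_rV_shift _ _ (y : 'rV[R]_n)); last 2 first.
- exact: emeasurable_funM.
- by move=> x; rewrite mule_ge0 ?lee_fin.
have ma : measurable_fun setT (fun x : borel_mx R 1 n => ((x : 'rV[R]_n) + (y : 'rV[R]_n))%R : borel_mx R 1 n).
  exact: (measurable_rV_add (f := idfun) (g := cst y) (@measurable_id _ _ _) (measurable_cst _)).
rewrite /J; apply: ge0_le_integral => //.
- by move=> x _; rewrite mule_ge0 ?lee_fin.
- apply: emeasurable_funM; first exact: (measurableT_comp mb ma).
  exact: (measurableT_comp my ma).
- exact: emeasurable_funM.
move=> x _; rewrite addrK lee_wpmul2r// lee_fin !indicE ler_nat.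
case: (boolP (_ \in box N)) => //; rewrite inE => xb; rewrite mem_set// => i.
have := xb i; rewrite mxE => /andP[? ?]; have /andP[? ?] := yb i.
by apply/andP; split; lra.
Qed.

(* [nu] has density |hat kappa|^2 with respect to [mu], where [kappa] is Lebesgue
   measure on a small box. So hat nu is an average of translates of hat mu. *)
Lemma smoothing (z : 'rV[R]_n) (mu : {finite_measure set (borel_mx R 1 n) -> \bar R}) :
  mu (~` [set u : 'rV[R]_n | forall i, z 0 i <= u 0 i <= z 0 i + 1]) = 0%E ->
  (0 < mu setT)%E ->
  exists (delta C : R) (nu : {finite_measure set (borel_mx R 1 n) -> \bar R}),
  [/\ 0 < delta, 0 <= C, (0 < nu setT)%E,
      (forall A, measurable A -> mu A = 0%E -> nu A = 0%E) &
      forall eta : 'rV[R]_n, ((power nu eta)%:E <= C%:E *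
        \int[lebesgue_rV R n]_x ((\1_(cube delta) ((x : 'rV[R]_n) - eta)%R)%:E *
          (power mu x)%:E))%E].
Proof.
set Q := [set u : 'rV[R]_n | _] => muQ mu0.
have [e e0 he] := cos_near0.
pose S : R := \sum_i (`|z 0 i| + 1).
have S0 : 0 <= S by apply: sumr_ge0 => i _; rewrite addr_ge0.
have pi0 : 0 < pi :> R by exact: pi_gt0.
(* [S] bounds the sum of the |u_i| over the unit cube at [z]; the choice makes 2 pi |u.y| < e there
   for y in the box of side [delta]. *)
pose delta := e / (2 * pi * (S + 1)).
have d0 : 0 < delta by rewrite divr_gt0// !mulr_gt0// ltr_wpDl.
have [kappa [kT kI _]] := @box_measure R n _ d0.
set T := delta ^+ n in kT; have T0 : 0 < T by rewrite exprn_gt0.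
pose f u := power kappa u.
have mf : measurable_fun setT (f : borel_mx R 1 n -> R) by exact: measurable_power.
have fB u : 0 <= f u <= 2 * fine (kappa setT) ^+ 2 by rewrite power_ge0 power_le.
have [nu [nuE nuI]] := exists_bounded_density mu mf fB.
(* T^2 comes from the Cauchy-Schwarz inequality on pairs of points of the box, one more T from
   [convolve_box]. *)
exists delta, (T ^+ 3), nu; split=> //.
- by rewrite exprn_ge0// ltW.
(* The cosine is at least 1/2 at all phases concerned, so the density is at least (T/2)^2 on the
   unit cube that carries [mu]: [nu] does not vanish. *)
- have cT u : Q u -> T / 2 <= cos_transform kappa u.
    move=> uQ; have uy (y : 'rV[R]_n) : box delta y -> 1 / 2 <= cos (2 * pi * edot u y).
      move=> yb; apply: he.
      have h : `|edot u y| <= S * delta.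
        apply: le_trans (ler_norm_sum _ _ _) _; rewrite mulr_suml.
        apply: ler_sum => i _; rewrite normrM; apply: ler_pM => //.
          have := uQ i; have := ler_norm (z 0 i); have := ler_norm (- z 0 i).
          by rewrite normrN ler_norml => ? ? /andP[? ?]; apply/andP; split; lra.
        by have /andP[? ?] := yb i; rewrite ger0_norm.
      rewrite normrM ger0_norm ?mulr_ge0 ?(ltW pi0)//.
      apply: (@le_lt_trans _ _ (2 * pi * (S * delta))); first by rewrite ler_wpM2l ?mulr_ge0 ?(ltW pi0).
      apply: (@lt_le_trans _ _ (2 * pi * ((S + 1) * delta))).
        by rewrite ltr_pM2l ?mulr_gt0// ltr_pM2r// ltrDl.
      have S10 : 0 < S + 1 by rewrite ltr_wpDl.
      by rewrite /delta mulrA mulrC divfK// gt_eqF// !mulr_gt0.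
    have mc : measurable_fun setT (fun y : borel_mx R 1 n => cos (2 * pi * edot u (y : 'rV[R]_n))).
      exact: (@measurable_cos_edot _ _ _ _ (cst u)).
    have m1c : measurable_fun setT (fun y : borel_mx R 1 n => (1 + cos (2 * pi * edot u (y : 'rV[R]_n)))%:E).
      by apply/measurable_EFinP; exact: measurable_funD.
    have c0 y : (0 <= (1 + cos (2 * pi * edot u (y : 'rV[R]_n)))%:E)%E.
      by rewrite lee_fin; have := cos_geN1 (2 * pi * edot u y); lra.
    have ic : kappa.-integrable setT (EFin \o (fun y : borel_mx R 1 n => cos (2 * pi * edot u (y : 'rV[R]_n)))).
      by apply: (@bounded_integrable _ _ _ _ _ 1) => // y; exact: normr_cos_le1.
    have i1 : kappa.-integrable setT (EFin \o (fun=> 1)).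
      by apply: (@bounded_integrable _ _ _ _ _ 1) => // y; rewrite normr1.
    have : 3 / 2 * T <= \int[kappa]_y (1 + cos (2 * pi * edot u (y : 'rV[R]_n))).
      rewrite -lee_fin /Rintegral fineK; last first.
        apply: (integrable_fin_num measurableT).
        apply: (@bounded_integrable _ _ _ _ _ 2); first exact: measurable_funD.
        by move=> y; have := normr_cos_le1 (2 * pi * edot u y); rewrite !ler_norml; lra.
      rewrite kI// EFinM -kT.
      have <- : (\int[kappa]_y (3 / 2)%:E = (3 / 2)%:E * kappa setT)%E by rewrite integral_cst.
      rewrite kI//; apply: ge0_le_integral => //.
      - apply: emeasurable_funM => //.
        by apply/measurable_EFinP/measurable_indic; exact: measurable_box.
      - apply: emeasurable_funM => //.
        by apply/measurable_EFinP/measurable_indic; exact: measurable_box.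
      move=> y _; rewrite indicE; case: (boolP (y \in box _)); rewrite ?mul0e// !mul1e inE.
      by move=> /uy; rewrite lee_fin; lra.
    rewrite RintegralD// Rintegral_cst// mul1r [X in fine X]kT /= /cos_transform.
    by lra.
  have mQ : measurable (Q : set (borel_mx R 1 n)).
    exact: (@measurable_rV_itv R n (fun i => z 0 i) (fun i => z 0 i + 1)).
  have Q0 : (0 < mu Q)%E.
    rewrite lt0e measure_ge0 andbT; apply: contraTN mu0 => /eqP Q0.
    rewrite -leNgt -(setvU Q); apply: le_trans (measureU2 _ _ _) _ => //.
      exact: measurableC.
    by rewrite [X in (X + _)%E]muQ [X in (_ + X)%E]Q0 adde0.
  rewrite nuE; apply: (@lt_le_trans _ _ (((T / 2) ^+ 2)%:E * mu Q)%E).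
    by rewrite mule_gt0// lte_fin exprn_gt0// divr_gt0.
  rewrite -integral_cst//; apply: (@le_trans _ _ (\int[mu]_(u in Q) (f u)%:E)%E).
    apply: ge0_le_integral => //.
    - by move=> u _; rewrite lee_fin sqr_ge0.
    - by apply: measurable_funTS; exact/measurable_EFinP.
    move=> u uQ; rewrite lee_fin /f /power; apply: (@le_trans _ _ (cos_transform kappa u ^+ 2)).
      by rewrite lerXn2r ?nnegrE ?cT ?(le_trans _ (cT _ uQ))// divr_ge0// ltW.
    by rewrite lerDl sqr_ge0.
  apply: ge0_subset_integral => //; first exact/measurable_EFinP.
  by move=> u _; rewrite lee_fin power_ge0.
- move=> A mA A0; rewrite nuE null_set_integral//.
  by apply: measurable_funTS; exact/measurable_EFinP.
move=> eta.
have ms : measurable_fun setT (fun p : borel_mx R 1 n * borel_mx R 1 n =>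
    eta + ((p.1 : 'rV[R]_n) - (p.2 : 'rV[R]_n)) : borel_mx R 1 n).
  by apply: (measurable_rV_add (f := cst eta)) => //; exact: measurable_rV_sub.
have mh : measurable_fun setT (fun up : borel_mx R 1 n * (borel_mx R 1 n * borel_mx R 1 n) =>
    2 * pi * edot eta (up.1 : 'rV[R]_n) +
    2 * pi * edot (up.1 : 'rV[R]_n) ((up.2.1 : 'rV[R]_n) - (up.2.2 : 'rV[R]_n))).
  apply: measurable_funD; apply: measurable_funM => //.
    exact: (@measurable_edot _ _ _ _ (cst eta)).
  apply: measurable_edot => //; apply: measurable_rV_sub.
    exact: (measurableT_comp measurable_fst measurable_snd).
  exact: (measurableT_comp measurable_snd measurable_snd).
have edE (u : 'rV[R]_n) p : 2 * pi * edot eta u + 2 * pi * edot u p = 2 * pi * edot (eta + p) u.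
  by rewrite (edotC (eta + p)) edotDr (edotC u eta); ring.
have cE : cos_transform nu eta =
   \int[fprod kappa kappa]_p cos_transform mu (eta + ((p.1 : 'rV[R]_n) - (p.2 : 'rV[R]_n))).
  rewrite /cos_transform (nuI _ 1); last 2 first.
  - exact: (@measurable_cos_edot _ _ _ _ (cst eta)).
  - by move=> u; exact: normr_cos_le1.
  under eq_Rintegral do rewrite -power_pair_phase.
  rewrite (@Rfubini _ _ _ _ _ mu (fprod kappa kappa) (fun up => cos (2 * pi * edot eta (up.1 : 'rV[R]_n) +
    2 * pi * edot (up.1 : 'rV[R]_n) ((up.2.1 : 'rV[R]_n) - (up.2.2 : 'rV[R]_n)))) 1); last 2 first.
  - exact: (measurableT_comp measurable_cos mh).
  - by move=> up; exact: normr_cos_le1.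
  by apply: eq_Rintegral => p _; apply: eq_Rintegral => u _; rewrite edE.
have sE : sin_transform nu eta =
   \int[fprod kappa kappa]_p sin_transform mu (eta + ((p.1 : 'rV[R]_n) - (p.2 : 'rV[R]_n))).
  rewrite /sin_transform (nuI _ 1); last 2 first.
  - exact: (@measurable_sin_edot _ _ _ _ (cst eta)).
  - by move=> u; exact: normr_sin_le1.
  under eq_Rintegral do rewrite -power_pair_phase_sin.
  rewrite (@Rfubini _ _ _ _ _ mu (fprod kappa kappa) (fun up => sin (2 * pi * edot eta (up.1 : 'rV[R]_n) +
    2 * pi * edot (up.1 : 'rV[R]_n) ((up.2.1 : 'rV[R]_n) - (up.2.2 : 'rV[R]_n)))) 1); last 2 first.
  - exact: (measurableT_comp measurable_sin mh).
  - by move=> up; exact: normr_sin_le1.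
  by apply: eq_Rintegral => p _; apply: eq_Rintegral => u _; rewrite edE.
have PT : fine (fprod kappa kappa setT) = T ^+ 2.
  by rewrite /fprod -setXTT product_measure1E// [X in (X * _)%E]kT [X in (_ * X)%E]kT.
have mC := measurableT_comp (measurable_cos_transform mu) ms.
have mS := measurableT_comp (measurable_sin_transform mu) ms.
have le1 : power nu eta <= T ^+ 2 * \int[fprod kappa kappa]_p
    power mu (eta + ((p.1 : 'rV[R]_n) - (p.2 : 'rV[R]_n))).
  rewrite /power cE sE RintegralD//; last 2 first.
  - apply: (@bounded_integrable _ _ _ _ _ (fine (mu setT) ^+ 2)).
      exact: measurable_funX.
    by move=> p; rewrite normrX lerXn2r ?nnegrE ?fine_ge0 ?cos_transform_le.
  - apply: (@bounded_integrable _ _ _ _ _ (fine (mu setT) ^+ 2)).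
      exact: measurable_funX.
    by move=> p; rewrite normrX lerXn2r ?nnegrE ?fine_ge0 ?sin_transform_le.
  rewrite mulrDr -PT; apply: lerD.
    by apply: Rintegral_sqr_le => //; move=> p; exact: cos_transform_le.
  by apply: Rintegral_sqr_le => //; move=> p; exact: sin_transform_le.
have mf' : measurable_fun setT (fun x : borel_mx R 1 n => (power mu (eta + (x : 'rV[R]_n)))%:E).
  apply/measurable_EFinP; apply: (measurableT_comp (measurable_power mu)).
  exact: (measurable_rV_add (f := cst eta) (g := idfun) (measurable_cst _) (@measurable_id _ _ _)).
have f0' x : (0 <= (power mu (eta + (x : 'rV[R]_n)))%:E)%E by rewrite lee_fin power_ge0.
have := convolve_box kI mf' f0'.
rewrite -(@ge0_integral_rV_shift _ _ (- eta)); last 2 first.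
- apply: emeasurable_funM => //; apply/measurable_EFinP/measurable_indic.
  exact: measurable_rV_itv.
- by move=> x; rewrite mule_ge0 ?lee_fin ?power_ge0.
have -> : (\int[lebesgue_rV R n]_x ((\1_(cube delta) ((x : 'rV[R]_n) - eta)%R)%:E *
      (power mu (eta + ((x : 'rV[R]_n) - eta)))%:E) =
    \int[lebesgue_rV R n]_x ((\1_(cube delta) ((x : 'rV[R]_n) - eta)%R)%:E *
      (power mu x)%:E))%E.
  by apply: eq_integral => x _; rewrite (addrC eta) subrK.
move=> h; apply: (@le_trans _ _ ((T ^+ 2)%:E * (\int[fprod kappa kappa]_p
    (power mu (eta + ((p.1 : 'rV[R]_n) - (p.2 : 'rV[R]_n))))%:E))%E).
  move: le1; rewrite -lee_fin EFinM /Rintegral fineK//.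
  apply: (integrable_fin_num measurableT).
  apply: (@bounded_integrable _ _ _ _ _ (2 * fine (mu setT) ^+ 2)).
    exact: (measurableT_comp (measurable_power mu) ms).
  by move=> p; rewrite ger0_norm ?power_ge0 ?power_le.
apply: (@le_trans _ _ ((T ^+ 2)%:E * (kappa setT * \int[lebesgue_rV R n]_x
  ((\1_(cube delta) ((x : 'rV[R]_n) - eta)%R)%:E * (power mu x)%:E)))%E).
  by rewrite lee_wpmul2l// lee_fin sqr_ge0.
by rewrite [X in (_ * (X * _))%E]kT muleA -EFinM -exprSr.
Qed.

End smoothing.

Section finite_probability.
Context d (T : measurableType d) (R : realType).
Variable mu : {finite_measure set T -> \bar R}.
Hypothesis mu1 : mu setT = 1%E.

Definition finite_probability of mu setT = 1%E : set T -> \bar R := mu.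

HB.instance Definition _ := Measure.on (finite_probability mu1).
HB.instance Definition _ :=
  Measure_isProbability.Build _ _ _ (finite_probability mu1) mu1.

End finite_probability.

Lemma exists_normalized_pushforward d d' (T : measurableType d) (T' : measurableType d')
    (R : realType) (mu : {finite_measure set T -> \bar R}) (f : T -> T') :
  measurable_fun setT f -> (0 < mu setT)%E ->
  exists nu : probability T' R,
    (forall A, measurable A -> mu (f @^-1` A) = 0%E -> nu A = 0%E) /\
    forall (g : T' -> R) M, measurable_fun setT g -> (forall x, `|g x| <= M) ->
      \int[nu]_x g x = (fine (mu setT))^-1 * \int[mu]_x g (f x).
Proof.
move=> mf mu0; pose m := fpushforward mu mf.
have muf : mu setT \is a fin_num by exact: fin_num_measure.
have c0 : 0 < fine (mu setT) by rewrite fine_gt0// mu0 -ge0_fin_numE.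
pose c := (fine (mu setT))^-1.
have [||nu [nuE nuI]] := @exists_bounded_density _ _ _ m (fun=> c) c.
- exact: measurable_cst.
- by move=> x; rewrite lexx andbT invr_ge0 ltW.
have nu1 : nu setT = 1%E.
  rewrite nuE integral_cst//= /fpushforward /pushforward preimage_setT -(fineK muf) -EFinM.
  by rewrite mulVf// gt_eqF.
exists (finite_probability nu1); split=> [A mA A0|g M mg gM].
  rewrite /finite_probability/= nuE integral_cst//= /fpushforward /pushforward.
  by rewrite [X in (_ * X)%E]A0 mule0.
rewrite [LHS](nuI g M)// mulrC.
have gi : mu.-integrable setT (EFin \o (g \o f)).
  apply: (@bounded_integrable _ _ _ _ _ M); first exact: (measurableT_comp mg mf).
  by move=> x; exact: gM.
rewrite -[RHS]RintegralZr//.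
rewrite /Rintegral; congr fine.
apply: (integral_pushforward mf (f := fun x => (g x * c)%:E)) => //.
  by apply/measurable_EFinP; exact: measurable_funM.
rewrite preimage_setT.
apply: (@bounded_integrable _ _ _ _ (fun x => g (f x) * c) (M * `|c|)).
  by apply: measurable_funM => //; exact: (measurableT_comp mg mf).
by move=> x; rewrite normrM ler_wpM2r.
Qed.

Section lift.
Context {R : realType} {n l : nat} (ln : (l <= n)%N).
Implicit Types (x : 'M[R]_(l, n - l)) (xi : 'rV[R]_l) (p zeta : 'rV[R]_n).

(* The frequency (xi, T_x xi). *)
Definition lift_freq x xi : 'rV[R]_n := \row_k
  match fintype.split (cast_ord (esym (subnKC ln)) k) with
  | inl i => xi 0 i
  | inr j => Tmap x xi 0 j
  end.

Definition head_ord (i : 'I_l) : 'I_n := widen_ord ln i.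
Definition tail_ord (j : 'I_(n - l)) : 'I_n := cast_ord (subnKC ln) (rshift l j).

Lemma lift_freq_head x xi i : lift_freq x xi 0 (head_ord i) = xi 0 i.
Proof.
rewrite mxE (_ : cast_ord _ _ = lshift (n - l) i); last exact: val_inj.
by rewrite (unsplitK (inl i)).
Qed.

Lemma lift_freq_tail x xi j : lift_freq x xi 0 (tail_ord j) = Tmap x xi 0 j.
Proof. by rewrite mxE cast_ordK (unsplitK (inr j)). Qed.

Lemma ord_head_tail (k : 'I_n) : (exists i, k = head_ord i) \/ (exists j, k = tail_ord j).
Proof.
have := splitK (cast_ord (esym (subnKC ln)) k).
case: fintype.split => [i|j] E; [left; exists i|right; exists j].
- apply/val_inj; have := congr1 val E; by [].
- apply/val_inj; have := congr1 val E; by [].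
Qed.

(** The vector (xi, T_x xi) is the transpose of P_x applied to xi. *)
Lemma edot_lift_freq x xi p : edot (lift_freq x xi) p = edot xi (Pmap ln x p).
Proof.
rewrite /edot (reindex (cast_ord (subnKC ln))); last first.
  exists (cast_ord (esym (subnKC ln))) => k _; [exact: cast_ordK|exact: cast_ordKV].
rewrite big_split_ord/=.
under eq_bigr => i _.
  rewrite (_ : cast_ord _ _ = head_ord i); last exact: val_inj.
  rewrite lift_freq_head; over.
under [X in _ + X]eq_bigr => j _.
  rewrite -/(tail_ord j) lift_freq_tail mxE mulr_suml; over.
rewrite exchange_big -big_split/=; apply: eq_bigr => i _.
rewrite mxE mulrDr mulr_sumr; congr (_ + _); apply: eq_bigr => j _.
by rewrite /tail_ord; ring.
Qed.

Lemma measurable_Pmap x :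
  measurable_fun setT (fun p : borel_mx R 1 n => Pmap ln x p : borel_mx R 1 l).
Proof.
apply: measurable_fun_mx => i j; under eq_fun do rewrite mxE.
apply: measurable_funD; first exact: measurable_coord.
by apply: measurable_sum => k; apply: measurable_funM => //; exact: measurable_coord.
Qed.

Lemma measurable_lift_freq : measurable_fun setT
  (fun q : borel_mx R l (n - l) * borel_mx R 1 l => lift_freq q.1 q.2 : borel_mx R 1 n).
Proof.
have m2 i : measurable_fun setT (fun q : borel_mx R l (n - l) * borel_mx R 1 l => (q.2 : 'rV[R]_l) 0 i).
  exact: (measurableT_comp (@measurable_coord R 1 l 0 i) measurable_snd).
apply: measurable_fun_mx => a k; rewrite (ord1 a).
case: (ord_head_tail k) => -[i ->].
  under eq_fun do rewrite lift_freq_head.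
  exact: m2.
under eq_fun do rewrite lift_freq_tail mxE.
apply: measurable_sum => j; apply: measurable_funM => //.
exact: (measurableT_comp (@measurable_coord R l (n - l) j i) measurable_fst).
Qed.

Lemma Pmap_continuous x (U : set 'rV[R]_l) : open U -> open (Pmap ln x @^-1` U).
Proof.
rewrite !openE => oU p /= /oU /nbhs_ballP[e /= e0 eU].
pose S : R := 1 + \sum_i \sum_j `|x i j|.
have S0 : 0 < S by rewrite ltr_pwDl// sumr_ge0// => i _; exact: sumr_ge0.
apply/nbhs_ballP; exists (e / S); first by rewrite /= divr_gt0.
move=> p' [_ pp']; apply: eU; split=> // a i; rewrite (ord1 a) !mxE /ball/=.
rewrite opprD addrACA -sumrB.
have h k : `|p 0 k - p' 0 k| < e / S by exact: pp'.
apply: le_lt_trans (ler_normD _ _) _.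
apply: (@lt_le_trans _ _ (e / S + \sum_j `|x i j| * (e / S))).
  apply: ltr_leD; first exact: h.
  apply: le_trans (ler_norm_sum _ _ _) _; apply: ler_sum => j _.
  by rewrite -mulrBr normrM ler_wpM2l// ltW.
rewrite -mulr_suml -[X in X + _]mul1r -mulrDl mulrA ler_pdivrMr// mulrC ler_wpM2l ?(ltW e0)//.
by rewrite lerD2l (bigD1 i)//= lerDl sumr_ge0// => k _; exact: sumr_ge0.
Qed.

End lift.

(** * Averages over the projections *)

Section shell.
Context {R : realType} {n l : nat} (ln : (l < n)%N).
Variable lam : {finite_measure set (borel_mx R l (n - l)) -> \bar R}.
Variables (c beta X : R).
Hypothesis X_ge0 : 0 <= X.
Hypothesis lam_bounded : lam (~` [set x : 'M[R]_(l, n - l) | forall i j, `|x i j| <= X]) = 0%E.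
Hypothesis c_gt0 : 0 < c.
Hypothesis lam_frostman : forall (xi : 'rV[R]_l) (p2 : 'rV[R]_(n - l)) (r : R),
  enorm xi = 1 -> 0 < r ->
  (lam [set x : 'M[R]_(l, n - l) | (enorm (Tmap x xi - p2) <= r)%R] <= (c * r `^ beta)%:E)%E.
Variable delta : R.
Hypothesis delta_gt0 : 0 < delta.

Local Notation lift_freq := (lift_freq (ltnW ln)).
Local Notation head_ord := (head_ord (ltnW ln)).
Local Notation tail_ord := (tail_ord (ltnW ln)).

Let subE m (u v : 'rV[R]_m) k : (u - v) 0 k = u 0 k - v 0 k.
Proof. by rewrite !mxE. Qed.

Definition head (zeta : 'rV[R]_n) : 'rV[R]_l := \row_i zeta 0 (head_ord i).
Definition tail (zeta : 'rV[R]_n) : 'rV[R]_(n - l) := \row_j zeta 0 (tail_ord j).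

Lemma measurable_enorm m d (T : measurableType d) (f : T -> borel_mx R 1 m) :
  measurable_fun setT f -> measurable_fun setT (fun t => enorm (f t : 'rV[R]_m)).
Proof.
move=> mf; apply: (@measurableT_comp _ _ _ _ _ _ (@Num.sqrt R)).
  by apply: continuous_measurable_fun; exact: sqrt_continuous.
exact: measurable_edot.
Qed.

Lemma measurable_slab (xi : 'rV[R]_l) p2 r :
  measurable ([set x : 'M[R]_(l, n - l) | (enorm (Tmap x xi - p2) <= r)%R] : set (borel_mx R l (n - l))).
Proof.
rewrite (_ : [set x | _] = (fun x : borel_mx R l (n - l) =>
  enorm (Tmap (x : 'M[R]_(l, n - l)) xi - p2)) @^-1` `]-oo, r]%classic); last first.
  by apply/seteqP; split=> x /=; rewrite in_itv.
rewrite -[_ @^-1` _]setTI; apply: measurable_enorm => //.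
apply: measurable_fun_mx => a j; under eq_fun do rewrite !mxE.
apply: measurable_funB => //; apply: measurable_sum => i; apply: measurable_funM => //.
exact: measurable_coord.
Qed.

Lemma measurable_lift_freq_l xi :
  measurable_fun setT (fun x : borel_mx R l (n - l) => lift_freq x xi : borel_mx R 1 n).
Proof.
exact: (measurableT_comp (@measurable_lift_freq R n l (ltnW ln)) (pair2_measurable (xi : borel_mx R 1 l))).
Qed.

Lemma measurable_cube (m : nat) (a : R) : measurable (cube a : set (borel_mx R 1 m)).
Proof. exact: measurable_rV_itv. Qed.

Let hit (zeta : 'rV[R]_n) (xi : 'rV[R]_l) : set (borel_mx R l (n - l)) :=
  [set x | cube delta (zeta - lift_freq x xi)].

Let measurable_hit zeta xi : measurable (hit zeta xi).
Proof.
rewrite -[hit _ _]setTI.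
apply: (measurable_rV_sub (f := cst (zeta : borel_mx R 1 n)) (measurable_cst _) (measurable_lift_freq_l xi)) => //.
exact: measurable_cube.
Qed.

Lemma measurable_mx_box p q (a : R) :
  measurable ([set x : 'M[R]_(p, q) | forall i j, `|x i j| <= a] : set (borel_mx R p q)).
Proof.
rewrite (_ : [set _ | _] = \bigcap_(ij : 'I_p * 'I_q)
    ((fun x : borel_mx R p q => (x : 'M[R]_(p, q)) ij.1 ij.2) @^-1` `[- a, a]%classic)).
  apply: fin_bigcap_measurable => // ij _; rewrite -[_ @^-1` _]setTI.
  exact: measurable_coord.
apply/seteqP; split=> x h; first by move=> ij _; rewrite /= in_itv/= -ler_norml; exact: h.
by move=> i j; have := h (i, j) I; rewrite /= in_itv/= -ler_norml.
Qed.

Lemma enormZ m (a : R) (u : 'rV[R]_m) : enorm (a *: u) = `|a| * enorm u.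
Proof.
rewrite /enorm -sqrtr_sqr -sqrtrM ?sqr_ge0//; congr Num.sqrt.
by rewrite /edot mulr_sumr; apply: eq_bigr => i _; rewrite !mxE; ring.
Qed.

Lemma TmapZ (x : 'M[R]_(l, n - l)) (a : R) xi : Tmap x (a *: xi) = a *: Tmap x xi.
Proof.
by apply/rowP => j; rewrite !mxE mulr_sumr; apply: eq_bigr => i _; rewrite mxE mulrCA.
Qed.

(** The bound for the slab of width (n - l) delta / |xi| is adapted from |xi| to a; the factor 1 +
    2^beta covers both signs of beta when |xi| lies in [a/2, a]. *)
Definition slab_const : R := c * ((n - l)%:R * delta) `^ beta * (1 + 2 `^ beta).
(** For entries bounded by [X], the coordinates of (xi, T_x xi) are at most (1 + X l) a; since a >=
    1, the margin delta is at most delta * a. *)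
Definition slab_radius : R := 1 + X * l%:R + delta.

Lemma slab_const_ge0 : 0 <= slab_const.
Proof.
by rewrite /slab_const mulr_ge0 ?mulr_ge0 ?powR_ge0 ?(ltW c_gt0)// addr_ge0// powR_ge0.
Qed.

(** The first l coordinates of the lifted frequency are xi whatever x is, so they restrict zeta; the
    other coordinates restrict x to a slab. *)
Lemma hit_measure a zeta xi : 1 <= a -> a / 2 <= enorm xi <= a ->
  (lam (hit zeta xi) <= (slab_const * a `^ (- beta) *
     (\1_(cube delta) (head zeta - xi) * \1_(cube (slab_radius * a)) zeta))%:E)%E.
Proof.
move=> a1 /andP[xa1 xa2].
have xi0 : 0 < enorm xi by lra.
have B0 : 0 <= slab_const * a `^ (- beta) *
     (\1_(cube delta) (head zeta - xi) * \1_(cube (slab_radius * a)) zeta).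
  by apply: mulr_ge0; [apply: mulr_ge0; [exact: slab_const_ge0|exact: powR_ge0]|exact: mulr_ge0].
have [hc|hc] := boolP (head zeta - xi \in cube delta); last first.
  rewrite (_ : hit zeta xi = set0).
    by rewrite measure0 lee_fin.
  apply/seteqP; split=> // x hx; move/negP: hc; apply; rewrite inE => i.
  by have := hx (head_ord i); rewrite !subE lift_freq_head mxE.
have [zc|zc] := boolP (zeta \in cube (slab_radius * a)); last first.
  apply: (@le_trans _ _ 0%E); last first.
    by rewrite lee_fin.
  (* A zeta outside the large cube can be hit only by matrices with an entry exceeding [X], which
     form a null set. *)
  rewrite -lam_bounded; apply: le_measure; rewrite ?inE//.
    by apply: measurableC; exact: (@measurable_mx_box l (n - l) X).
  move=> x hx /= xX; move/negP: zc; apply; rewrite inE => k.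
  have lb : `|lift_freq x xi 0 k| <= (1 + X * l%:R) * a.
    case: (ord_head_tail (ltnW ln) k) => -[i ->].
      rewrite lift_freq_head; apply: le_trans (coord_le_enorm xi i) _.
      apply: le_trans xa2 _; rewrite ler_peMl//; first lra.
      by rewrite lerDl mulr_ge0.
    rewrite lift_freq_tail mxE; apply: le_trans (ler_norm_sum _ _ _) _.
    apply: (@le_trans _ _ (\sum_(j < l) X * a)).
      apply: ler_sum => j _; rewrite normrM; apply: ler_pM => //.
      exact: le_trans (coord_le_enorm xi j) xa2.
    by rewrite sumr_const card_ord -mulr_natl; lra.
  have := hx k; rewrite subE => /andP[h1 h2].
  move: lb; rewrite ler_norml => /andP[h3 h4].
  have h5 : delta <= delta * a by rewrite ler_peMr// ltW.
  by rewrite /slab_radius; apply/andP; split; lra.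
have nl0 : 0 < (n - l)%:R :> R by rewrite ltr0n subn_gt0.
have nd0 : 0 < (n - l)%:R * delta by rewrite mulr_gt0.
set e := enorm xi in xi0 xa1 xa2 *.
have ex : enorm (e^-1 *: xi) = 1.
  by rewrite enormZ gtr0_norm ?invr_gt0// mulVf// gt_eqF.
(* The hypothesis concerns unit vectors, so everything is divided by |xi|; the factor n - l compares
   the Euclidean norm with the coordinates. *)
have := lam_frostman (e^-1 *: tail zeta) ex (divr_gt0 nd0 xi0).
rewrite !indicE hc zc !mulr1 => h.
apply: (@le_trans _ _ (lam [set x : 'M[R]_(l, n - l) |
   enorm (Tmap x (e^-1 *: xi) - e^-1 *: tail zeta) <= (n - l)%:R * delta / e])).
  apply: le_measure; rewrite ?inE//; first exact: measurable_slab.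
  move=> x hx /=.
  rewrite TmapZ -scalerBr enormZ gtr0_norm ?invr_gt0// mulrC ler_pM2r ?invr_gt0//.
  apply: enorm_le => j; have := hx (tail_ord j).
  by rewrite !subE lift_freq_tail [tail _ _ _]mxE ler_norml; lra.
apply: le_trans h _; rewrite lee_fin /slab_const -!mulrA ler_pM2l//.
rewrite [(n - l)%:R * (delta / e)]mulrA powRM ?invr_ge0 ?(ltW nd0) ?(ltW xi0)// ler_pM2l ?powR_gt0//.
rewrite -powR_inv1 ?(ltW xi0)// -powRrM mulN1r.
have a0 : 0 < a by lra.
have a20 : 0 < a / 2 by lra.
have [b0|b0] := leP 0 beta.
  apply: (@le_trans _ _ ((a / 2) `^ (- beta))).
    rewrite !powRN lef_pV2 ?posrE ?powR_gt0//.
    by rewrite ge0_ler_powR ?nnegrE// ltW.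
  rewrite powRM ?invr_ge0 ?(ltW a0)// -powR_inv1// -powRrM mulN1r opprK mulrC.
  by rewrite ler_wpM2r ?powR_ge0// lerDr.
apply: (@le_trans _ _ (a `^ (- beta))).
  by rewrite ge0_ler_powR ?nnegrE ?oppr_ge0 ?(ltW b0) ?(ltW xi0) ?(ltW a0).
by rewrite ler_peMl ?powR_ge0// lerDl powR_ge0.
Qed.

Variables (mu nu : {finite_measure set (borel_mx R 1 n) -> \bar R}) (C1 : R).
Hypothesis C1_ge0 : 0 <= C1.
Hypothesis nu_smooth : forall eta : 'rV[R]_n, ((power nu eta)%:E <= C1%:E *
  \int[lebesgue_rV R n]_x ((\1_(cube delta) ((x : 'rV[R]_n) - eta)%R)%:E *
    (power mu x)%:E))%E.

Let lin_meas (m : nat) (A : set (borel_mx R 1 m)) d (T : measurableType d) (f : T -> borel_mx R 1 m) :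
  measurable A -> measurable_fun setT f -> measurable_fun setT (fun t => \1_A (f t) : R).
Proof. by move=> mA mf; apply: (measurableT_comp _ mf); exact: measurable_indic. Qed.

Let measurable_powerE (m : {finite_measure set (borel_mx R 1 n) -> \bar R}) d
  (T : measurableType d) (f : T -> borel_mx R 1 n) :
  measurable_fun setT f -> measurable_fun setT (fun t => (power m (f t))%:E).
Proof.
by move=> mf; apply/measurable_EFinP; exact: (measurableT_comp (measurable_power m) mf).
Qed.

Lemma measurable_head : measurable_fun setT (head : borel_mx R 1 n -> borel_mx R 1 l).
Proof.
apply: measurable_fun_mx => i j; under eq_fun do rewrite mxE; exact: measurable_coord.
Qed.

Let slab_kernel (K L : R) (q : borel_mx R 1 l * borel_mx R 1 n) : \bar R :=
  ((K * (\1_(cube delta) ((head q.2 : 'rV[R]_l) - (q.1 : 'rV[R]_l)) *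
     \1_(cube L) q.2))%:E * (power mu q.2)%:E)%E.

Let measurable_slab_kernel K L : measurable_fun setT (slab_kernel K L).
Proof.
apply: emeasurable_funM; last by apply: measurable_powerE.
apply/measurable_EFinP; apply: measurable_funM => //; apply: measurable_funM.
  apply: lin_meas; first exact: measurable_cube.
  by apply: measurable_rV_sub => //; exact: (measurableT_comp measurable_head measurable_snd).
by apply: lin_meas => //; exact: measurable_cube.
Qed.

(** Tonelli's theorem turns the mean over x of the local averages into an integral over zeta, with
    weight the measure of [hit zeta xi]. *)
Lemma mean_power a xi : 1 <= a -> a / 2 <= enorm xi <= a ->
  (\int[lam]_x (power nu (lift_freq x xi))%:E <=
   C1%:E * \int[lebesgue_rV R n]_zeta ((slab_const * a `^ (- beta) *
     (\1_(cube delta) (head zeta - xi) * \1_(cube (slab_radius * a)) zeta))%:E *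
     (power mu zeta)%:E))%E.
Proof.
move=> a1 xia.
have mc := @measurable_cube n delta.
pose g (q : borel_mx R l (n - l) * borel_mx R 1 n) : \bar R :=
  ((\1_(cube delta) ((q.2 : 'rV[R]_n) - lift_freq q.1 xi)%R)%:E * (power mu q.2)%:E)%E.
have g0 q : (0 <= g q)%E by rewrite mule_ge0 ?lee_fin ?power_ge0.
have mg : measurable_fun setT g.
  apply: emeasurable_funM; last by apply: measurable_powerE.
  apply/measurable_EFinP; apply: lin_meas => //; apply: measurable_rV_sub => //.
  exact: (measurableT_comp (measurable_lift_freq_l xi) measurable_fst).
apply: (@le_trans _ _ (\int[lam]_x (C1%:E * \int[lebesgue_rV R n]_zeta g (x, zeta)))%E).
  apply: ge0_le_integral => //.
  - by move=> x _; rewrite lee_fin power_ge0.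
  - by apply: measurable_powerE; exact: measurable_lift_freq_l.
  - by apply: measurable_funeM; exact: (measurable_fun_fubini_tonelli_F _ mg).
rewrite ge0_integralZl//; last 2 first.
- exact: (measurable_fun_fubini_tonelli_F _ mg).
- by move=> x _; apply: integral_ge0.
rewrite lee_wpmul2l ?lee_fin// (fubini_tonelli _ mg)//.
apply: ge0_le_integral => //.
- by move=> zeta _; apply: integral_ge0.
- exact: (measurable_fun_fubini_tonelli_G _ mg).
- exact: (measurableT_comp (measurable_slab_kernel (slab_const * a `^ (- beta)) (slab_radius * a))
    (pair1_measurable (xi : borel_mx R 1 l))).
move=> zeta _; rewrite /g/= ge0_integralZr//; last 2 first.
- apply/measurable_EFinP; apply: lin_meas => //.
  exact: (measurable_rV_sub (f := cst (zeta : borel_mx R 1 n)) (measurable_cst _) (measurable_lift_freq_l xi)).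
- by rewrite lee_fin power_ge0.
rewrite lee_wpmul2r ?lee_fin ?power_ge0//.
apply: le_trans (hit_measure zeta a1 xia).
rewrite (_ : (fun x => _) = (fun x => (\1_(hit zeta xi) x)%:E)); last first.
  by apply/funext => x; rewrite !indicE.
by rewrite integral_indic// setIT.
Qed.

(** After another exchange of integrals, the xi compatible with a given zeta fill a cube of side 2
    delta around its head; hence the power (2 delta)^l. *)
Lemma shell_energy a (S : set (borel_mx R 1 l)) : 1 <= a -> measurable S ->
  (forall xi : 'rV[R]_l, S xi -> a / 2 <= enorm xi <= a) ->
  (\int[lebesgue_rV R l]_xi ((\1_S xi)%:E * \int[lam]_x (power nu (lift_freq x xi))%:E) <=
   (C1 * (slab_const * a `^ (- beta)) * (2 * delta) ^+ l)%:E *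
   \int[lebesgue_rV R n]_zeta ((\1_(cube (slab_radius * a)) zeta)%:E * (power mu zeta)%:E))%E.
Proof.
move=> a1 mS Sa; set K := slab_const * a `^ (- beta).
have K0 : 0 <= K by rewrite /K; apply: mulr_ge0; [exact: slab_const_ge0|exact: powR_ge0].
pose g := slab_kernel K (slab_radius * a).
have g0 q : (0 <= g q)%E by rewrite mule_ge0 ?lee_fin ?power_ge0// mulr_ge0.
have mg : measurable_fun setT g by exact: measurable_slab_kernel.
have mI : measurable_fun setT (fun xi : borel_mx R 1 l => \int[lam]_x (power nu (lift_freq x xi))%:E)%E.
  apply: (measurable_fun_fubini_tonelli_G (fun q : borel_mx R l (n - l) * borel_mx R 1 l =>
    (power nu (lift_freq q.1 q.2))%:E)).
  - by apply: measurable_powerE; exact: measurable_lift_freq.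
  - by move=> q; rewrite lee_fin power_ge0.
have I0 xi : (0 <= \int[lam]_x (power nu (lift_freq x xi))%:E)%E.
  by apply: integral_ge0 => x _; rewrite lee_fin power_ge0.
apply: (@le_trans _ _ (\int[lebesgue_rV R l]_xi (C1%:E * \int[lebesgue_rV R n]_zeta g (xi, zeta)))%E).
  apply: ge0_le_integral => //.
  - by move=> xi _; rewrite mule_ge0 ?lee_fin.
  - apply: emeasurable_funM => //; exact/measurable_EFinP/measurable_indic.
  - by apply: measurable_funeM; exact: (measurable_fun_fubini_tonelli_F _ mg).
  move=> xi _; rewrite indicE; case: (boolP (xi \in S)); last first.
    by rewrite mul0e mule_ge0 ?lee_fin// integral_ge0.
  by rewrite inE mul1e => /Sa xia; exact: mean_power.
rewrite ge0_integralZl//; last 2 first.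
- exact: (measurable_fun_fubini_tonelli_F _ mg).
- by move=> x _; apply: integral_ge0.
rewrite -mulrA EFinM -muleA lee_wpmul2l ?lee_fin// (fubini_tonelli _ mg)//.
rewrite -ge0_integralZl//; last 3 first.
- apply: emeasurable_funM; last exact: measurable_powerE.
  by apply/measurable_EFinP; apply: lin_meas => //; exact: measurable_cube.
- by move=> zeta _; rewrite mule_ge0 ?lee_fin ?power_ge0.
- by rewrite lee_fin mulr_ge0// exprn_ge0// mulr_ge0// ltW.
rewrite le_eqVlt; apply/orP; left; apply/eqP; apply: eq_integral => zeta _.
set B := \1_(cube (slab_radius * a)) zeta : R; set P := power mu zeta.
pose A : set (borel_mx R 1 l) := [set xi | cube delta (head zeta - xi)].
have AE : A = [set xi : 'rV[R]_l | forall i, head zeta 0 i - delta <= xi 0 i <= head zeta 0 i + delta].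
  by apply/seteqP; split=> xi h i; have := h i; rewrite ?subE => /andP[? ?]; apply/andP; split; lra.
have mA : measurable A by rewrite AE; exact: measurable_rV_itv.
transitivity (\int[lebesgue_rV R l]_xi ((K * B * P)%:E * (\1_A xi)%:E))%E.
  apply: eq_integral => xi _; rewrite /g /slab_kernel/= -/B -/P -!EFinM; congr EFin.
  have -> : \1_(cube delta) (head zeta - xi) = \1_A xi :> R by rewrite !indicE.
  by ring.
have B0 : 0 <= B by [].
rewrite ge0_integralZl//; last 2 first.
- exact/measurable_EFinP/measurable_indic.
- by rewrite lee_fin; apply: mulr_ge0; [exact: mulr_ge0|exact: power_ge0].
rewrite integral_indic// setIT [X in (_ * X)%E](_ : _ = ((2 * delta) ^+ l)%:E).
  by rewrite -!EFinM; congr EFin; ring.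
rewrite AE; apply: etrans (@lebesgue_rV_itv _ l (fun i => head zeta 0 i - delta) (fun i => head zeta 0 i + delta) _) _; first by move=> i; have := delta_gt0; lra.
rewrite (eq_bigr (fun=> 2 * delta)) ?prodr_const ?card_ord// => i _; ring.
Qed.

End shell.

(** * Summation over dyadic shells *)

Section powers.
Context {R : realType}.
Implicit Types (a t y : R).

Lemma powR_expn_comm k t : ((2 : R) ^+ k) `^ t = (2 `^ t) ^+ k.
Proof. by rewrite -[2 ^+ k]powR_mulrn// -powRrM mulrC powRrM powR_mulrn// powR_ge0. Qed.

Lemma powR_comparable a y t : 0 < a -> a / 2 <= y <= 2 * a ->
  y `^ t <= (2 `^ t + 2 `^ (- t)) * a `^ t.
Proof.
move=> a0 /andP[y1 y2]; have y0 : 0 < y by lra.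
have [t0|t0] := leP 0 t.
  apply: (@le_trans _ _ ((2 * a) `^ t)).
    by rewrite ge0_ler_powR ?nnegrE//; lra.
  by rewrite powRM ?(ltW a0)// ler_wpM2r ?powR_ge0// lerDl powR_ge0.
apply: (@le_trans _ _ ((a / 2) `^ t)).
  rewrite -[t]opprK !(powRN _ (- t)) lef_pV2 ?posrE ?powR_gt0//; last by lra.
  by rewrite ge0_ler_powR ?nnegrE//; lra.
rewrite powRM ?invr_ge0 ?(ltW a0)// -powR_inv1// -powRrM mulN1r mulrC.
by rewrite ler_wpM2r ?powR_ge0// lerDr powR_ge0.
Qed.

Lemma nneseries_geometric_lty (B q : R) : 0 <= B -> 0 <= q < 1 ->
  (\sum_(0 <= k <oo) (B * q ^+ k)%:E < +oo)%E.
Proof.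
move=> B0 /andP[q0 q1].
have pos k : (0 <= (B * q ^+ k)%:E)%E by rewrite lee_fin mulr_ge0// exprn_ge0.
apply: (@le_lt_trans _ _ (B / (1 - q))%:E); last by rewrite ltry.
apply: lime_le; first by apply: is_cvg_nneseries => k _ _.
apply: nearW => N; rewrite sumEFin lee_fin -mulr_sumr ler_wpM2l//.
rewrite -[leRHS]mul1r ler_pdivlMr ?subr_gt0//.
have -> : (\sum_(0 <= i < N) q ^+ i) * (1 - q) = 1 - q ^+ N.
  elim: N => [|N IH]; first by rewrite big_nil mul0r expr0 subrr.
  by rewrite big_nat_recr//= mulrDl IH exprSr; ring.
by rewrite gerBl exprn_ge0.
Qed.

End powers.

(** On the shell of radius 2^k the weight is comparable to 2^(t k), so the contributions form a
    geometric series of ratio 2^t * q. The uniform bound [C0] serves for the unit ball. *)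
Lemma dyadic_shells {R : realType} {l : nat} (I : borel_mx R 1 l -> \bar R) (t q B C0 : R) :
  measurable_fun setT I -> (forall xi, 0 <= I xi)%E -> (forall xi, I xi <= C0%:E)%E ->
  0 <= C0 -> 0 <= B -> 0 <= q -> 2 `^ t * q < 1 ->
  (forall k (S : set (borel_mx R 1 l)), measurable S ->
    (forall xi : 'rV[R]_l, S xi -> 2 ^+ k / 2 <= enorm xi <= 2 ^+ k) ->
    (\int[lebesgue_rV R l]_xi ((\1_S xi)%:E * I xi) <= (B * q ^+ k)%:E)%E) ->
  (\int[lebesgue_rV R l]_xi (((1 + enorm (xi : 'rV[R]_l)) `^ t)%:E * I xi) < +oo)%E.
Proof.
move=> mI I0 IC C00 B0 q0 tq1 shell.
pose w (xi : borel_mx R 1 l) := (1 + enorm (xi : 'rV[R]_l)) `^ t.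
have mN : measurable_fun setT (fun xi : borel_mx R 1 l => enorm (xi : 'rV[R]_l)).
  by apply: measurable_enorm; exact: measurable_id.
have mw : measurable_fun setT w.
  apply: (@measurableT_comp _ _ _ _ _ _ (fun y : R => y `^ t)); first exact: measurable_powR.
  exact: measurable_funD.
(* The shells overlap on spheres; as the integrand is nonnegative, covering is enough. *)
pose S k : set (borel_mx R 1 l) := [set xi | enorm (xi : 'rV[R]_l) \in
  (if k is 0%N then `]-oo, 1] else `[2 ^+ k / 2, 2 ^+ k])].
have mS k : measurable (S k).
  rewrite (_ : S k = (fun xi : borel_mx R 1 l => enorm (xi : 'rV[R]_l)) @^-1`
    [set` (if k is 0%N then `]-oo, 1] else `[2 ^+ k / 2, 2 ^+ k])]); last by [].
  by rewrite -[_ @^-1` _]setTI; apply: mN => //; case: k => [|k]; exact: measurable_itv.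
have wI0 xi : (0 <= (w xi)%:E * I xi)%E by rewrite mule_ge0// lee_fin powR_ge0.
have mwI : measurable_fun setT (fun xi => ((w xi)%:E * I xi)%E).
  by apply: emeasurable_funM => //; exact/measurable_EFinP.
pose F k xi : \bar R := ((\1_(S k) xi)%:E * ((w xi)%:E * I xi))%E.
have F0 k xi : (0 <= F k xi)%E by rewrite mule_ge0 ?lee_fin.
have mF k : measurable_fun setT (F k).
  by apply: emeasurable_funM => //; exact/measurable_EFinP/measurable_indic.
have cover (xi : borel_mx R 1 l) : exists k, S k xi.
  have ex : exists k, enorm (xi : 'rV[R]_l) <= (2 : R) ^+ k.
    exists (Num.bound (enorm (xi : 'rV[R]_l))).
    apply: (le_trans (ltW (archi_boundP (sqrtr_ge0 _)))).
    by rewrite -natrX ler_nat ltnW// ltn_expl.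
  case: (ex_minnP ex) => -[|k] xk kmin.
    by exists 0%N; rewrite /S/= in_itv/=.
  exists k.+1; rewrite /S/= in_itv/= xk andbT exprSr mulfK//.
  by rewrite leNgt; apply/negP => /ltW /kmin; rewrite ltnn.
set c2 := 2 `^ t + 2 `^ (- t).
have c20 : 0 <= c2 by rewrite addr_ge0// powR_ge0.
have shellF k : (\int[lebesgue_rV R l]_xi F k xi <=
    (c2 * (C0 * 2 ^+ l + B) * (2 `^ t * q) ^+ k)%:E)%E.
  case: k => [|k].
    apply: (@le_trans _ _ (\int[lebesgue_rV R l]_xi
      ((c2 * C0)%:E * (\1_(cube 1) (xi : 'rV[R]_l))%:E))%E).
      apply: ge0_le_integral => //.
      - apply: emeasurable_funM => //; apply/measurable_EFinP.
        by apply: measurable_indic; exact: measurable_cube.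
      move=> xi _; rewrite /F indicE.
      have [|_] := boolP (xi \in S 0%N); last by rewrite mul0e mule_ge0// lee_fin// mulr_ge0.
      rewrite inE /S/= in_itv/= => x1; rewrite mul1e indicE mem_set; last first.
        by move=> i /=; rewrite -ler_norml (le_trans (coord_le_enorm _ _)).
      rewrite mule1 EFinM; apply: lee_pmul => //; first by rewrite lee_fin powR_ge0.
      have x0 : 0 <= enorm (xi : 'rV[R]_l) by exact: sqrtr_ge0.
      rewrite lee_fin (le_trans (powR_comparable t ltr01 _)) ?powR1 ?mulr1//.
      by apply/andP; split; lra.
    rewrite ge0_integralZl//; last 2 first.
    - by apply/measurable_EFinP/measurable_indic; exact: measurable_cube.
    - by rewrite lee_fin mulr_ge0.
    rewrite integral_indic ?setIT//; last exact: measurable_cube.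
    rewrite [X in (_ * X)%E](_ : _ = (2 ^+ l)%:E); last first.
      apply: etrans (@lebesgue_rV_itv _ l (fun=> -1) (fun=> 1) _) _; first by move=> _; lra.
      by rewrite prodr_const card_ord opprK.
    by rewrite -EFinM lee_fin expr0 mulr1 -mulrA ler_wpM2l// lerDl.
  apply: (@le_trans _ _ (\int[lebesgue_rV R l]_xi
      ((c2 * (2 `^ t) ^+ k.+1)%:E * ((\1_(S k.+1) xi)%:E * I xi)))%E).
    apply: ge0_le_integral => //.
    - by apply: emeasurable_funM => //; apply: emeasurable_funM => //;
        exact/measurable_EFinP/measurable_indic.
    move=> xi _; rewrite /F indicE.
    have [|_] := boolP (xi \in S k.+1); last by rewrite !mul0e mule0.
    rewrite inE /S/= in_itv/= => /andP[x1 x2]; rewrite !mul1e; apply: lee_pmul => //.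
      by rewrite lee_fin powR_ge0.
    rewrite lee_fin -powR_expn_comm; apply: powR_comparable; first exact: exprn_gt0.
    have p1 : (1 : R) <= 2 ^+ k.+1 by rewrite exprn_ege1// ler1n.
    by apply/andP; split; lra.
  have p0 : 0 <= c2 * (2 `^ t) ^+ k.+1 by rewrite mulr_ge0// exprn_ge0// powR_ge0.
  rewrite ge0_integralZl//; last 2 first.
  - by apply: emeasurable_funM => //; exact/measurable_EFinP/measurable_indic.
  - by move=> xi _; rewrite mule_ge0 ?lee_fin.
  apply: le_trans (_ : _ <= (c2 * (2 `^ t) ^+ k.+1)%:E * (B * q ^+ k.+1)%:E)%E _.
    by rewrite lee_wpmul2l ?lee_fin//; exact: shell.
  rewrite -EFinM lee_fin exprMn.
  have -> : c2 * (2 `^ t) ^+ k.+1 * (B * q ^+ k.+1) =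
    c2 * ((2 `^ t) ^+ k.+1 * q ^+ k.+1) * B by ring.
  rewrite [leRHS]mulrAC; apply: ler_wpM2l.
    by rewrite !mulr_ge0// exprn_ge0// powR_ge0.
  by rewrite lerDr mulr_ge0// exprn_ge0.
apply: (@le_lt_trans _ _ (\int[lebesgue_rV R l]_xi (\sum_(0 <= k <oo) F k xi)%E)%E).
  apply: ge0_le_integral => //.
  - by move=> xi _; exact: wI0.
  - exact: ge0_emeasurable_sum.
  move=> xi _; have [k Sk] := cover xi.
  apply: le_trans (nneseries_lim_ge k.+1 _) => //=.
  rewrite big_nat_recr//= -/(w xi) {2}/F indicE mem_set// mul1e.
  by apply: leeDr; exact: sume_ge0.
rewrite integral_nneseries//.
apply: le_lt_trans (@nneseries_geometric_lty R (c2 * (C0 * 2 ^+ l + B)) (2 `^ t * q) _ _).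
- by apply: lee_nneseries => k // _ _; exact: integral_ge0.
- by rewrite mulr_ge0// addr_ge0// mulr_ge0// exprn_ge0.
- by rewrite tq1 mulr_ge0// powR_ge0.
Qed.

Lemma weighted_energy {R : realType} {n l : nat} (ln : (l < n)%N)
    (lam : {finite_measure set (borel_mx R l (n - l)) -> \bar R}) (c beta X : R) :
  0 <= X ->
  lam (~` [set x : 'M[R]_(l, n - l) | forall i j, `|x i j| <= X]) = 0%E ->
  0 < c ->
  (forall (xi : 'rV[R]_l) (p2 : 'rV[R]_(n - l)) (r : R), enorm xi = 1 -> 0 < r ->
    (lam [set x : 'M[R]_(l, n - l) | (enorm (Tmap x xi - p2) <= r)%R] <=
      (c * r `^ beta)%:E)%E) ->
  forall (mu nu : {finite_measure set (borel_mx R 1 n) -> \bar R}) (delta C1 r a C2 : R),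
  0 < delta -> 0 <= C1 ->
  (forall eta : 'rV[R]_n, ((power nu eta)%:E <= C1%:E *
    \int[lebesgue_rV R n]_x ((\1_(cube delta) ((x : 'rV[R]_n) - eta)%R)%:E *
      (power mu x)%:E))%E) ->
  0 <= r -> 0 <= C2 ->
  (forall k, (\int[lebesgue_rV R n]_x ((\1_(cube (2 ^+ k / 4)) x)%:E * (power mu x)%:E) <=
    (C2 * ((2 ^+ k) ^+ n * r ^+ k))%:E)%E) ->
  2 `^ a * (2 `^ (- beta) * 2 ^+ n * r) < 1 ->
  (\int[lebesgue_rV R l]_xi (((1 + enorm (xi : 'rV[R]_l)) `^ a)%:E *
    \int[lam]_x (power nu (lift_freq (ltnW ln) x xi))%:E) < +oo)%E.
Proof.
move=> X0 lamX c0 lamF mu nu delta C1 r a C2 d0 C10 nus r0 C20 en ar1.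
pose P (p : borel_mx R l (n - l) * borel_mx R 1 l) : \bar R :=
  (power nu (lift_freq (ltnW ln) p.1 p.2))%:E.
have P0 p : (0 <= P p)%E by rewrite lee_fin power_ge0.
have mP : measurable_fun setT P.
  apply/measurable_EFinP; apply: (measurableT_comp (measurable_power nu)).
  exact: measurable_lift_freq.
(* The cube met by the shell of radius 2^k must lie in the energy cube of scale k + k0; the shift
   costs a constant factor only. *)
have [k0 hk0] : exists k0 : nat, slab_radius (l := l) X delta <= 2 ^+ k0 / 4.
  have rho0 : 0 <= 4 * slab_radius (l := l) X delta.
    by rewrite mulr_ge0// /slab_radius !addr_ge0 ?mulr_ge0// ltW.
  exists (Num.bound (4 * slab_radius (l := l) X delta)).
  rewrite ler_pdivlMr// mulrC; apply: (le_trans (ltW (archi_boundP rho0))).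
  by rewrite -natrX ler_nat ltnW// ltn_expl.
set K := slab_const (n := n) (l := l) c beta delta.
have dl0 : 0 <= (2 * delta) ^+ l by rewrite exprn_ge0// mulr_ge0// ltW.
have K0 : 0 <= K by exact: slab_const_ge0.
(* The last argument is the trivial bound by total masses. *)
apply: (@dyadic_shells R l _ a (2 `^ (- beta) * 2 ^+ n * r)
  (C1 * K * (2 * delta) ^+ l * (C2 * ((2 ^+ k0) ^+ n * r ^+ k0)))
  (2 * fine (nu setT) ^+ 2 * fine (lam setT))) => //.
- exact: (measurable_fun_fubini_tonelli_G _ mP).
- by move=> xi; apply: integral_ge0 => x _; rewrite lee_fin power_ge0.
- move=> xi; apply: (@le_trans _ _ (\int[lam]_x (2 * fine (nu setT) ^+ 2)%:E)%E).
    apply: ge0_le_integral => //.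
    + by move=> x _; rewrite lee_fin power_ge0.
    + exact: (measurableT_comp mP (pair2_measurable (xi : borel_mx R 1 l))).
    + by move=> x _; rewrite lee_fin power_le.
  by rewrite integral_cst// [leRHS]EFinM fineK// fin_num_measure.
- by rewrite !mulr_ge0// ?sqr_ge0// fine_ge0.
- apply: mulr_ge0; first exact: mulr_ge0 (mulr_ge0 C10 K0) dl0.
  by rewrite mulr_ge0// mulr_ge0// !exprn_ge0.
- by rewrite !mulr_ge0 ?exprn_ge0 ?powR_ge0.
move=> k S mS Sk.
have k1 : (1 : R) <= 2 ^+ k by rewrite exprn_ege1// ler1n.
apply: le_trans (shell_energy ln X0 lamX c0 lamF d0 C10 nus k1 mS Sk) _.
rewrite -/K.
have D0 : 0 <= C1 * (K * (2 ^+ k) `^ (- beta)) * (2 * delta) ^+ l.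
  exact: mulr_ge0 (mulr_ge0 C10 (mulr_ge0 K0 (powR_ge0 _ _))) dl0.
apply: (@le_trans _ _ ((C1 * (K * (2 ^+ k) `^ (- beta)) * (2 * delta) ^+ l)%:E *
   (C2 * ((2 ^+ (k + k0)) ^+ n * r ^+ (k + k0)))%:E)%E).
  rewrite lee_wpmul2l ?lee_fin//; apply: le_trans (en (k + k0)%N).
  apply: ge0_le_integral => //.
  - by move=> x _; rewrite mule_ge0 ?lee_fin// power_ge0.
  - apply: emeasurable_funM; apply/measurable_EFinP; last exact: measurable_power.
    by apply: measurable_indic; exact: measurable_cube.
  - apply: emeasurable_funM; apply/measurable_EFinP; last exact: measurable_power.
    by apply: measurable_indic; exact: measurable_cube.
  move=> x _; rewrite lee_wpmul2r ?lee_fin ?power_ge0// !indicE.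
  have [|_] := boolP (x \in cube (slab_radius X delta * 2 ^+ k)); last exact: ler0n.
  rewrite inE => xc; rewrite mem_set// => i.
  have := xc i; rewrite exprD => /andP[y1 y2].
  have h : slab_radius (l := l) X delta * 2 ^+ k <= 2 ^+ k * 2 ^+ k0 / 4.
    by rewrite mulrC -mulrA ler_wpM2l// exprn_ge0.
  by apply/andP; split; lra.
rewrite -EFinM lee_fin powR_expn_comm !exprD !exprMn -!exprM (mulnC n k).
by rewrite le_eqVlt; apply/orP; left; apply/eqP; ring.
Qed.

(** * From finite averages to the Sobolev dimension *)

Lemma borel_mx_closed {R : realType} {m n : nat} (A : set 'M[R]_(m, n)) :
  closed A -> measurable (A : set (borel_mx R m n)).
Proof.
move=> cA; rewrite -[A]setCK; apply: measurableC; apply: sub_sigma_algebra.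
exact: closed_openC.
Qed.

Lemma compact_entries_bounded {R : realType} {m n : nat} (K : set 'M[R]_(m, n)) :
  compact K -> exists2 X : R, 0 <= X & forall x, K x -> forall i j, `|x i j| <= X.
Proof.
move=> /compact_bounded[M [_ hM]]; exists (`|M| + 1) => [|x Kx i j]; first by rewrite addr_ge0.
have := hM (`|M| + 1) _ _ Kx; rewrite (le_lt_trans (ler_norm M)) ?ltrDl// => /(_ isT) /=.
apply: le_trans; rewrite /Num.norm/= mx_normrE.
exact: (le_bigmax _ (fun ij : 'I_m * 'I_n => `|x ij.1 ij.2|) (i, j)).
Qed.

Section concentrated.
Context {R : realType} {n : nat}.

Lemma expand_unit_cube (z : 'rV[R]_n) b :
  forall i, z 0 i <= expand z b 0 i <= z 0 i + 1.
Proof.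
move=> i; have := expand_in_cell 0 z b i.
by rewrite expr0 !divr1 (_ : nat_of_ord _ = 0%N) ?addr0//; case: (cell_index _ _ _) => -[].
Qed.

Lemma closed_expand (z : 'rV[R]_n) K : seq_closed K -> closed (expand z @` K).
Proof. by apply: closed_cantor_image => U b; exact: expand_continuous. Qed.

End concentrated.

Section projection.
Context {R : realType} {n l : nat} (ln : (l <= n)%N).
Variables (nu : {finite_measure set (borel_mx R 1 n) -> \bar R}) (x : 'M[R]_(l, n - l)).
Implicit Type P : probability (borel_mx R 1 l) R.

Lemma normc_fourier_pushforward P :
  (forall (g : borel_mx R 1 l -> R) M, measurable_fun setT g -> (forall u, `|g u| <= M) ->
    \int[P]_u g u = (fine (nu setT))^-1 * \int[nu]_p g (Pmap ln x p)) ->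
  forall xi, complex.ComplexField.Normc.normc (fourier P xi) ^+ 2 =
    (fine (nu setT))^-1 ^+ 2 * power nu (lift_freq ln x xi).
Proof.
move=> PI xi; rewrite /fourier /integralC /= sqr_sqrtr ?addr_ge0 ?sqr_ge0//.
have -> : \int[P]_u cos (- (2 * pi * edot xi (u : 'rV[R]_l))) =
    (fine (nu setT))^-1 * cos_transform nu (lift_freq ln x xi).
  under eq_Rintegral do rewrite cosN.
  rewrite (PI (fun u => cos (2 * pi * edot xi (u : 'rV[R]_l))) 1).
  - by congr (_ * _); apply: eq_Rintegral => p _; rewrite edot_lift_freq.
  - exact: (@measurable_cos_edot _ _ _ _ (cst xi)).
  - by move=> u; exact: normr_cos_le1.
have -> : \int[P]_u sin (- (2 * pi * edot xi (u : 'rV[R]_l))) =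
    - ((fine (nu setT))^-1 * sin_transform nu (lift_freq ln x xi)).
  under eq_Rintegral do rewrite sinN -mulN1r.
  rewrite (PI (fun u => -1 * sin (2 * pi * edot xi (u : 'rV[R]_l))) 1).
  - rewrite -mulrN; congr (_ * _); rewrite -[RHS]mulN1r -RintegralZl//.
      by apply: eq_Rintegral => p _; rewrite edot_lift_freq.
    apply: (@bounded_integrable _ _ _ _ _ 1).
      exact: (@measurable_sin_edot _ _ _ _ (cst (lift_freq ln x xi))).
    by move=> u; exact: normr_sin_le1.
  - apply: measurable_funM => //; exact: (@measurable_sin_edot _ _ _ _ (cst xi)).
  - by move=> u; rewrite mulN1r normrN; exact: normr_sin_le1.
by rewrite sqrrN !exprMn -mulrDr.
Qed.

(** The image of [E] need not be Borel; the closed image of [D] inside it is a measurable carrier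
    for the image measure. *)
Lemma sobolev_projection (E D : set 'rV[R]_n) (sigma : R) :
  (0 < nu setT)%E -> D `<=` E -> closed D -> closed (Pmap ln x @` D) -> nu (~` D) = 0%E ->
  (\int[lebesgue_rV R l]_xi (((1 + enorm (xi : 'rV[R]_l)) `^ (sigma - l%:R))%:E *
    (power nu (lift_freq ln x xi))%:E) < +oo)%E ->
  sobolev_dim_ge (Pmap ln x @` E) sigma.
Proof.
move=> nu0 DE cD cPD nuD oo.
have [P [P0 PI]] := exists_normalized_pushforward (measurable_Pmap ln x) nu0.
have mPD : measurable (~` (Pmap ln x @` D) : set (borel_mx R 1 l)).
  by apply: measurableC; exact: borel_mx_closed.
exists P; split.
  exists (~` (Pmap ln x @` D)); split=> //.
    apply: P0 => //; apply/eqP; rewrite eq_le measure_ge0 andbT -nuD.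
    apply: le_measure; rewrite ?inE.
    - by rewrite -[_ @^-1` _]setTI; exact: measurable_Pmap.
    - by apply: measurableC; exact: borel_mx_closed.
    - by move=> p /= hp Dp; apply: hp; exists p.
  by apply: subsetC => y [p Dp <-]; exists p => //; exact: DE.
have mN : measurable_fun setT (fun xi : borel_mx R 1 l => enorm (xi : 'rV[R]_l)).
  by apply: measurable_enorm; exact: measurable_id.
have mw : measurable_fun setT
    (fun xi : borel_mx R 1 l => (1 + enorm (xi : 'rV[R]_l)) `^ (sigma - l%:R)).
  apply: (@measurableT_comp _ _ _ _ _ _ (fun y : R => y `^ _)); first exact: measurable_powR.
  exact: measurable_funD.
have mp : measurable_fun setT (fun xi : borel_mx R 1 l => power nu (lift_freq ln x xi)).
  apply: (measurableT_comp (measurable_power nu)).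
  exact: (measurableT_comp (@measurable_lift_freq R n l ln)
    (pair1_measurable (x : borel_mx R l (n - l)))).
rewrite (eq_integral (fun xi : borel_mx R 1 l =>
  (((fine (nu setT))^-1 ^+ 2)%:E * (((1 + enorm (xi : 'rV[R]_l)) `^ (sigma - l%:R))%:E *
    (power nu (lift_freq ln x xi))%:E))%E)); last first.
  move=> xi _; rewrite (normc_fourier_pushforward PI) -!EFinM; congr EFin.
  by rewrite -(opprB sigma) powRN invrK; ring.
rewrite ge0_integralZl//; last 3 first.
- by apply: emeasurable_funM; exact/measurable_EFinP.
- by move=> xi _; rewrite mule_ge0// lee_fin ?power_ge0 ?powR_ge0.
- by rewrite lee_fin sqr_ge0.
by rewrite lte_mul_pinfty// ?lee_fin ?sqr_ge0.
Qed.

End projection.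

(** For a basis vector xi, T_x xi is a row of x, so one slab around 0 contains all matrices with
    entries bounded by [X]. *)
Lemma frostman_finite {R : realType} {n l : nat} (l_gt0 : (0 < l)%N)
    (lambda : {measure set (borel_mx R l (n - l)) -> \bar R}) (c beta X : R) :
  0 <= X ->
  lambda (~` [set x : 'M[R]_(l, n - l) | forall i j, `|x i j| <= X]) = 0%E ->
  (forall (xi : 'rV[R]_l) (p2 : 'rV[R]_(n - l)) (r : R), enorm xi = 1 -> 0 < r ->
    (lambda [set x : 'M[R]_(l, n - l) | (enorm (Tmap x xi - p2) <= r)%R] <=
      (c * r `^ beta)%:E)%E) ->
  (lambda setT < +oo)%E.
Proof.
move=> X0 lX lF; pose i0 := Ordinal l_gt0.
pose e : 'rV[R]_l := delta_mx 0 i0.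
have e1 : enorm e = 1.
  rewrite /enorm /edot (bigD1 i0)//= big1 ?addr0.
    by rewrite !mxE !eqxx mulr1 sqrtr1.
  by move=> i ii0; rewrite !mxE (negPf ii0) andbF mulr0.
have mB := @measurable_mx_box R l (n - l) X.
(* The 1 keeps the radius positive when X = 0. *)
pose r := (n - l)%:R * X + 1.
have r0 : 0 < r by rewrite ltr_pwDr// mulr_ge0.
have := lF e 0 r e1 r0; set S := [set x | _] => lS.
have mS : measurable (S : set (borel_mx R l (n - l))) by exact: measurable_slab.
have BS : [set x : 'M[R]_(l, n - l) | forall i j, `|x i j| <= X] `<=` S.
  move=> x /= xX; rewrite /S/= subr0.
  apply: (@le_trans _ _ ((n - l)%:R * X)); last by rewrite /r lerDl.
  apply: enorm_le => j; rewrite mxE (bigD1 i0)//= big1 ?addr0.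
    by rewrite mxE !eqxx mulr1.
  by move=> i ii0; rewrite mxE (negPf ii0) andbF mulr0.
rewrite -(setUv S); apply: (@le_lt_trans _ _ (lambda S + lambda (~` S))%E).
  by apply: measureU2 => //; exact: measurableC.
rewrite [X in (_ + X)%E](_ : _ = 0%E) ?adde0; first exact: le_lt_trans lS (ltry _).
apply/eqP; rewrite eq_le measure_ge0 andbT -lX; apply: le_measure; rewrite ?inE.
- exact: measurableC.
- exact: measurableC.
- exact: subsetC.
Qed.

Theorem theorem1p2 (R : realType) (n l : nat)
    (hn : (2 <= n)%N) (hl : (1 <= l)%N) (hln : (l < n)%N)
    (alpha beta sigma : R) (halpha : 0 < alpha)
    (lambda : {measure set (borel_mx R l (n - l)) -> \bar R})
    (hsupp : compactly_supported lambda)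
    (hfrostman : exists2 c : R, 0 < c &
      forall (xi : 'rV[R]_l) (p2 : 'rV[R]_(n - l)) (r : R),
        enorm xi = 1 -> 0 < r ->
        (lambda [set x : 'M[R]_(l, n - l) | (enorm (Tmap x xi - p2) <= r)%R]
          <= (c * r `^ beta)%:E)%E)
    (E : set 'rV[R]_n)
    (hE : measurable (E : set (borel_mx R 1 n)))
    (hdim : (alpha%:E <= hausdorff_dim E)%E)
    (hbeta : n%:R - l%:R + sigma - alpha < beta) :
  {ae lambda, forall x : 'M[R]_(l, n - l),
    sobolev_dim_ge (Pmap (ltnW hln) x @` E) sigma}.
Proof.
have [K0 cK0 lK0] := hsupp; have [c c0 lF] := hfrostman.
have [X X0 KX] := compact_entries_bounded cK0.
have mB := @measurable_mx_box R l (n - l) X.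
have lX : lambda (~` [set x : 'M[R]_(l, n - l) | forall i j, `|x i j| <= X]) = 0%E.
  apply/eqP; rewrite eq_le measure_ge0 andbT -lK0; apply: le_measure; rewrite ?inE.
  - exact: measurableC.
  - apply: measurableC; apply: borel_mx_closed; apply: compact_closed => //.
  - exact: subsetC.
have lfin := frostman_finite hl X0 lX lF.
(* [lam] is [lambda] itself, equipped with the structure of a finite measure. *)
have [lam [lamE lamI]] := exists_restr measurableT lfin.
have lamEq A : measurable A -> lam A = lambda A by move=> mA; rewrite lamE// setIT.
(* A midpoint: the hypotheses put [alpha] above both 0 and n - l + sigma - beta. *)
have [s [s0 sa sb]] : exists s : R, [/\ 0 < s, s < alpha & n%:R - l%:R + sigma - beta < s].
  pose m := Num.max 0 (n%:R - l%:R + sigma - beta).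
  have ma : m < alpha by rewrite gt_max halpha/=; lra.
  have m0 : 0 <= m by rewrite le_max lexx.
  have mb : n%:R - l%:R + sigma - beta <= m by rewrite le_max lexx orbT.
  by exists ((m + alpha) / 2); split; lra.
have n0 : (0 < n)%N by apply: leq_trans hn.
have sdim : (s%:E < hausdorff_dim E)%E by apply: lt_le_trans hdim; rewrite lte_fin.
have [_ [z [mu [mu0 [K [cK KE muK]] muF]]]] := frostman n0 s0 sdim hE.
set D := expand z @` K in KE muK.
have cD : closed D by exact: closed_expand.
have muQ : mu (~` [set u : 'rV[R]_n | forall i, z 0 i <= u 0 i <= z 0 i + 1]) = 0%E.
  apply/eqP; rewrite eq_le measure_ge0 andbT -muK; apply: le_measure; rewrite ?inE.
  - by apply: measurableC; exact: measurable_rV_itv.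
  - by apply: measurableC; exact: borel_mx_closed.
  - by apply: subsetC => _ [b _ <-]; exact: expand_unit_cube.
have [delta [C1 [nu [d0 C10 nu0 nuac nus]]]] := smoothing muQ mu0.
have nuD : nu (~` D) = 0%E by apply: nuac => //; apply: measurableC; exact: borel_mx_closed.
set r := 2 `^ (- s) in muF.
have r0 : 0 <= r by exact: powR_ge0.
have en := energy r0 muF.
(* The total exponent of 2 is sigma - l - beta + n - s, negative by the choice of [s]. *)
have ratio_lt1 : 2 `^ (sigma - l%:R) * (2 `^ (- beta) * 2 ^+ n * r) < 1.
  rewrite -powR_mulrn// /r -!powRD ?pnatr_eq0 ?implybT//.
  rewrite -[X in 2 `^ X]opprK powRN invf_lt1 ?powR_gt0//; set u := - (_ + _).
  have u0 : 0 < u by rewrite /u; lra.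
  by have := @gt0_ltr_powR R u u0 1 2; rewrite powR1 !nnegrE ltr1n; apply.
have lamX : lam (~` [set x : 'M[R]_(l, n - l) | forall i j, `|x i j| <= X]) = 0%E.
  by rewrite lamEq//; exact: measurableC.
have lamF (xi : 'rV[R]_l) (p2 : 'rV[R]_(n - l)) (t : R) : enorm xi = 1 -> 0 < t ->
    (lam [set x : 'M[R]_(l, n - l) | (enorm (Tmap x xi - p2) <= t)%R] <=
      (c * t `^ beta)%:E)%E.
  by move=> xi1 t0; rewrite lamEq; [exact: lF|exact: measurable_slab].
have C20 : 0 <= 144 ^+ n * fine (mu setT) :> R by rewrite mulr_ge0 ?exprn_ge0 ?fine_ge0.
have := weighted_energy hln X0 lamX c0 lamF d0 C10 nus r0 C20 en ratio_lt1.
pose f (q : borel_mx R l (n - l) * borel_mx R 1 l) : \bar R :=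
  (((1 + enorm (q.2 : 'rV[R]_l)) `^ (sigma - l%:R))%:E *
   (power nu (lift_freq (ltnW hln) q.1 q.2))%:E)%E.
have f0 q : (0 <= f q)%E by rewrite mule_ge0 ?lee_fin ?power_ge0 ?powR_ge0.
have mp : measurable_fun setT (fun q : borel_mx R l (n - l) * borel_mx R 1 l =>
    power nu (lift_freq (ltnW hln) q.1 q.2)).
  by apply: (measurableT_comp (measurable_power nu)); exact: measurable_lift_freq.
have mf : measurable_fun setT f.
  apply: emeasurable_funM; apply/measurable_EFinP => //.
  apply: (@measurableT_comp _ _ _ _ _ _ (fun y : R => y `^ _)); first exact: measurable_powR.
  by apply: measurable_funD => //; apply: measurable_enorm; exact: measurable_snd.
have mF : measurable_fun setT (fun x => \int[lebesgue_rV R l]_xi f (x, xi))%E.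
  exact: measurable_fun_fubini_tonelli_F.
have F0 x : (0 <= \int[lebesgue_rV R l]_xi f (x, xi))%E by apply: integral_ge0.
rewrite (eq_integral (fun xi => \int[lam]_x f (x, xi))%E); last first.
  move=> xi _; rewrite -ge0_integralZl//.
  - by apply/measurable_EFinP; exact: (measurableT_comp mp (pair2_measurable (xi : borel_mx R 1 l))).
  - by move=> x _; rewrite lee_fin power_ge0.
  - by rewrite lee_fin powR_ge0.
rewrite -(fubini_tonelli _ mf)// lamI// => fin.
(* By Tonelli's theorem the mean over x of the Sobolev integrals is finite, so almost all of them
   are. *)
have /(integrable_ae measurableT) : lambda.-integrable setT
    (fun x => \int[lebesgue_rV R l]_xi f (x, xi))%E.
  by apply/integrableP; split=> //; under eq_integral do rewrite gee0_abs//.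
apply: filterS => x /(_ I) fx.
apply: (@sobolev_projection _ _ _ _ nu x E D) => //.
(* A linear image of a closed set need not be closed; here compactness of [K] in the Cantor space is
   used again, for the composite map. *)
- rewrite /D image_comp; apply: closed_cantor_image cK => U b oU Ub.
  have oV := @Pmap_continuous _ _ _ (ltnW hln) x _ oU.
  exact: (expand_continuous oV Ub).
- by move: fx; rewrite ge0_fin_numE.
Qed.
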